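(* For complex $|y|<1$, $|z|<1$, $|\rho_1|<1$, $|\rho_2|<1$, $|q|<1$ we have: (i) for all integers $n\ge1$, $$\sum_{k=0}^nc_{n,k}(y,\rho_1,z,\rho_2,q)\,\bar c_{k,0}(y,\rho_1,z,\rho_2,q)=0,\qquad \sum_{k=0}^n\bar c_{n,k}(y,\rho_1,z,\rho_2,q)\,c_{k,0}(y,\rho_1,z,\rho_2,q)=0 ;$$ (ii) for $|x|<1$, $$f_{C2N}(x|y,\rho_1,z,\rho_2,q)=f_h(x|q)\sum_{n\ge0}\frac{h_n(x|q)}{(q)_n}\sum_{s=0}^n\begin{bmatrix}n\\ s\end{bmatrix}_q\frac{\rho_1^{n-s}\rho_2^s(\rho_1^2)_s}{(\rho_1^2\rho_2^2)_s}h_{n-s}(y|q)\,p_s(z|y,\rho_1\rho_2,q),$$ $$f_h(x|q)=f_{C2N}(x|y,\rho_1,z,\rho_2,q)\sum_{n\ge0}\frac{\alpha_n(x|y,\rho_1,z,\rho_2,q)}{(q)_n\prod_{j=0}^{n-1}w(z,y|\rho_1\rho_2q^j)}\,\frac{(\rho_1^2\rho_2^2)_{2n}}{(\rho_2^2)_n(\rho_1^2\rho_2^2q^{n-1})_n^2}$$ $$\qquad\times\sum_{s=0}^n\begin{bmatrix}n\\ s\end{bmatrix}_q\frac{\rho_2^{n-s}\rho_1^s(\rho_1^2\rho_2^2q^{n-1})_s}{(\rho_1^2)_s}\,b_s(y|q)\,g_{n-s}(z|y,\rho_1\rho_2q^{n-1},q).$$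
   Context: $(a)_n=\prod_{j=0}^{n-1}(1-aq^j)$, $(a)_\infty=\prod_{j\ge0}(1-aq^j)$, $(a,b)_n=(a)_n(b)_n$ (also for $n=\infty$), $\begin{bmatrix}n\\ k\end{bmatrix}_q=\frac{(q)_n}{(q)_k(q)_{n-k}}$; empty products are $1$. $$w(x,y|a)=(1-a^2)^2-4xya(1+a^2)+4a^2(x^2+y^2),\qquad l(x|a)=(1+a)^2-4x^2a .$$ Continuous $q$-Hermite polynomials: $h_0=1$, $h_1(x|q)=2x$, $h_n(x|q)=2xh_{n-1}(x|q)-(1-q^{n-1})h_{n-2}(x|q)$. $b_n(x|q)=(-1)^nq^{\binom n2}h_n(x|q^{-1})$ for $q\ne0$, and $b_0(x|0)=b_2(x|0)=1$, $b_1(x|0)=-2x$, $b_n(x|0)=0$ for $n\ge3$. Al-Salam–Chihara polynomials: $p_{-1}=0$, $p_0=1$, $p_{n+1}(x|y,\rho,q)=2(x-\rho yq^n)p_n(x|y,\rho,q)-(1-\rho^2q^{n-1})(1-q^n)p_{n-1}(x|y,\rho,q)$. $g_n(x|y,\rho,q)=\rho^np_n(y|x,\rho^{-1},q)$ if $\rho\ne0$, $g_n(x|y,0,q)=b_n(x|q)$, and $g_0=1$. Coefficients, for $0\le k\le n$: $$c_{n,k}(y,\rho_1,z,\rho_2,q)=\begin{bmatrix}n\\ k\end{bmatrix}_q\frac{(\rho_1^2q^k)_{n-k}}{(\rho_1^2\rho_2^2q^{n+k-1})_{n-k}}\sum_{s=0}^{n-k}\begin{bmatrix}n-k\\ s\end{bmatrix}_q\frac{\rho_2^{n-k-s}\rho_1^s(\rho_1^2\rho_2^2q^{n+k-1})_s}{(\rho_1^2q^k)_s}b_s(y|q)\,g_{n-k-s}(z|y,\rho_1\rho_2q^{n-1},q),$$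 $$\bar c_{n,k}(y,\rho_1,z,\rho_2,q)=\begin{bmatrix}n\\ k\end{bmatrix}_q\sum_{s=0}^{n-k}\begin{bmatrix}n-k\\ s\end{bmatrix}_q\frac{\rho_1^{n-k-s}\rho_2^s(\rho_1^2q^k)_s}{(\rho_1^2\rho_2^2q^{2k})_s}h_{n-k-s}(y|q)\,p_s(z|y,\rho_1\rho_2q^k,q).$$ The functions $f_h$ and $f_{C2N}$ (for suitable parameters, densities on $[-1,1]$) are $$f_h(x|q)=\frac{2(q)_\infty\sqrt{1-x^2}}\pi\prod_{k=1}^\infty l(x|q^k),$$ $$f_{C2N}(x|y,\rho_1,z,\rho_2,q)=f_h(x|q)\frac{(\rho_1^2,\rho_2^2)_\infty\prod_{j=0}^\infty w(y,z|\rho_1\rho_2q^j)}{(\rho_1^2\rho_2^2)_\infty\prod_{j=0}^\infty w(x,y|\rho_1q^j)\,w(x,z|\rho_2q^j)} .$$ $\alpha_n(x|y,\rho_1,z,\rho_2,q)$ are the Askey–Wilson polynomials with parameters $a,b,c,d$ given by $a+b=2\rho_1y$, $ab=\rho_1^2$, $c+d=2\rho_2z$, $cd=\rho_2^2$, explicitly $$\alpha_n(x|y,\rho_1,z,\rho_2,q)=\sum_{j=0}^n\begin{bmatrix}n\\ j\end{bmatrix}_q\frac{\rho_2^{n-j}(\rho_1^2q^j)_{n-j}}{(\rho_1^2\rho_2^2q^{n+j-1})_{n-j}}\,g_{n-j}(z|y,\rho_1\rho_2q^{n-1},q)\,p_j(x|y,\rho_1,q).$$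
   Formalization: In (ii) the factor 1/(ρ1²ρ2²q^{n-1})_n² is removed; the first expansion assumes w(x,y|t)≠0 for |t|≤|ρ1| and w(x,z|t)≠0 for |t|≤|ρ2|; the second assumes w(x,y|ρ1q^j), w(x,z|ρ2q^j), w(z,y|ρ1ρ2q^j) nonzero. Both hold for real x,y,z. *)

(* Defs.v *)
From HB Require Import structures.
From mathcomp Require Import all_boot all_order all_algebra.
From mathcomp Require Import all_classical all_reals all_analysis.
From mathcomp Require Import complex.
From mathcomp Require Import ring.

Set Implicit Arguments.
Unset Strict Implicit.
Unset Printing Implicit Defensive.
Import Order.TTheory GRing.Theory Num.Theory.
Import numFieldNormedType.Exports.
Local Open Scope classical_set_scope.
Local Open Scope ring_scope.

(* MathComp and MathComp-Analysis.

   Throughout, q-exponents are natural numbers.  The exponents n-1 and n+k-1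
   of the formulas below would be negative only for n = k = 0, where they occur
   solely inside empty q-Pochhammer products or in g_0 = 1, so the truncated
   predecessor is harmless. *)

(* R[i] seen through a structure from which its topology is inferred. *)
Definition cplx (R : realType) : numClosedFieldType := R[i]%C.

Section Polynomials.
Variable K : fieldType.
Implicit Types (x y z a rho q : K) (n k : nat).

Definition qpoch a q n : K := \prod_(j < n) (1 - a * q ^+ j).

Definition qbinom n k q : K := qpoch q q n / (qpoch q q k * qpoch q q (n - k)).

Definition w x y a : K :=
  (1 - a ^+ 2) ^+ 2 - 4 * x * y * a * (1 + a ^+ 2)
  + 4 * a ^+ 2 * (x ^+ 2 + y ^+ 2).

Definition l x a : K := (1 + a) ^+ 2 - 4 * x ^+ 2 * a.

Fixpoint h n x q {struct n} : K :=
  match n with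
  | 0 => 1
  | 1 => 2 * x
  | (m.+1 as n1).+1 => 2 * x * h n1 x q - (1 - q ^+ m.+1) * h m x q
  end.

Definition b n x q : K :=
  if q == 0 then
    match n with 0 => 1 | 1 => - 2 * x | 2 => 1 | _ => 0 end
  else (-1) ^+ n * q ^+ 'C(n, 2) * h n x q^-1.

(* The two initial values are those produced by p_{-1} = 0, p_0 = 1. *)
Fixpoint p n x y rho q {struct n} : K :=
  match n with
  | 0 => 1
  | 1 => 2 * (x - rho * y)
  | (m.+1 as n1).+1 =>
      2 * (x - rho * y * q ^+ m.+1) * p n1 x y rho q
      - (1 - rho ^+ 2 * q ^+ m) * (1 - q ^+ m.+1) * p m x y rho q
  end.

(* x and y are exchanged in the first branch. *)
Definition g n x y rho q : K :=
  if rho == 0 then b n x q else rho ^+ n * p n y x rho^-1 q.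

Definition c n k y rho1 z rho2 q : K :=
  let P := rho1 ^+ 2 * rho2 ^+ 2 * q ^+ (n + k).-1 in
  qbinom n k q * (qpoch (rho1 ^+ 2 * q ^+ k) q (n - k) / qpoch P q (n - k))
  * \sum_(s < (n - k).+1)
      qbinom (n - k) s q
      * (rho2 ^+ (n - k - s) * rho1 ^+ s * qpoch P q s
         / qpoch (rho1 ^+ 2 * q ^+ k) q s)
      * b s y q * g (n - k - s) z y (rho1 * rho2 * q ^+ n.-1) q.

Definition cbar n k y rho1 z rho2 q : K :=
  qbinom n k q
  * \sum_(s < (n - k).+1)
      qbinom (n - k) s q
      * (rho1 ^+ (n - k - s) * rho2 ^+ s * qpoch (rho1 ^+ 2 * q ^+ k) q s
         / qpoch (rho1 ^+ 2 * rho2 ^+ 2 * q ^+ (2 * k)) q s)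
      * h (n - k - s) y q * p s z y (rho1 * rho2 * q ^+ k) q.

Definition alpha n x y rho1 z rho2 q : K :=
  \sum_(j < n.+1)
    qbinom n j q
    * (rho2 ^+ (n - j) * qpoch (rho1 ^+ 2 * q ^+ j) q (n - j)
       / qpoch (rho1 ^+ 2 * rho2 ^+ 2 * q ^+ (n + j).-1) q (n - j))
    * g (n - j) z y (rho1 * rho2 * q ^+ n.-1) q * p j x y rho1 q.

End Polynomials.

Section Densities.
Variable R : realType.
Local Notation C := (cplx R).
Implicit Types x y z rho q : C.

(* [limn] is total; for |q| < 1 all the products formed with it below
   converge. *)
Definition prod_inf (u : nat -> C) : C := limn (fun n => \prod_(j < n) u j).

Definition qpoch_inf (a q : C) : C := prod_inf (fun j => 1 - a * q ^+ j).

(* [sqrtc] is the principal square root. *)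
Definition f_h x q : C :=
  2 * qpoch_inf q q * sqrtc (1 - x ^+ 2) / (pi : R)%:C%C
  * prod_inf (fun k => l x (q ^+ k.+1)).

Definition f_C2N x y rho1 z rho2 q : C :=
  f_h x q
  * (qpoch_inf (rho1 ^+ 2) q * qpoch_inf (rho2 ^+ 2) q
     * prod_inf (fun j => w y z (rho1 * rho2 * q ^+ j))
     / (qpoch_inf (rho1 ^+ 2 * rho2 ^+ 2) q
        * prod_inf (fun j => w x y (rho1 * q ^+ j) * w x z (rho2 * q ^+ j)))).

(* In each of the next two definitions the condition holds automatically when
   x, y, z are real and of modulus < 1 (see [conv_domain_real] and
   [nonsingular_real]), for arbitrary complex rho1, rho2, q of modulus < 1.

   With x = (X + 1/X)/2 and y = (Y + 1/Y)/2 one has w(x, y|t) =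
   (1 - tXY)(1 - tX/Y)(1 - tY/X)(1 - t/(XY)), so [conv_domain] says that
   |rho1| max|X^±1 Y^±1| < 1 and |rho2| max|X^±1 Z^±1| < 1.  This is where the
   expansion of f_C2N / f_h in q-Hermite polynomials (the Poisson-Mehler series
   if rho2 = 0) converges absolutely; for non-real y it may diverge outside,
   even though |y|, |rho1| < 1. *)
Definition conv_domain x y rho1 z rho2 : Prop :=
  (forall t : C, `|t| <= `|rho1| -> w x y t != 0) /\
  (forall t : C, `|t| <= `|rho2| -> w x z t != 0).

Definition nonsingular x y rho1 z rho2 q : Prop :=
  forall j : nat,
    [/\ w x y (rho1 * q ^+ j) != 0, w x z (rho2 * q ^+ j) != 0
      & w z y (rho1 * rho2 * q ^+ j) != 0].

Lemma quadratic_neq0 (u r a : C) : u \is Num.real -> r \is Num.real ->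
  u ^+ 2 + r ^+ 2 = 1 -> `|a| < 1 -> 1 - 2 * u * a + a ^+ 2 != 0.
Proof.
move=> uR rR ur1 a1; apply/negP => /eqP E.
have /eqP : (a - u) ^+ 2 = ('i * r) ^+ 2.
  rewrite exprMn sqrCi; apply/eqP; rewrite -subr_eq0.
  rewrite [X in X == 0](_ : _ = 1 - 2 * u * a + a ^+ 2
                               + (u ^+ 2 + r ^+ 2 - 1)); last by ring.
  by rewrite E ur1 subrr addr0.
have a2 s : s \is Num.real -> s ^+ 2 = r ^+ 2 -> a = u + 'i * s -> False.
  move=> sR s2 aE; have : `|a| ^+ 2 = 1 by rewrite aE normC2_rect ?s2.
  move/eqP; rewrite sqrp_eq1 ?normr_ge0// => /eqP a1E.
  by rewrite a1E ltxx in a1.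
rewrite eqf_sqr => /orP[] /eqP aE.
- by apply: (a2 r) => //; rewrite -aE addrC subrK.
- apply: (a2 (- r)); rewrite ?rpredN ?sqrrN//.
  by rewrite mulrN -aE addrC subrK.
Qed.

Lemma w_real_neq0 x y (a : C) : x \is Num.real -> y \is Num.real ->
  `|x| < 1 -> `|y| < 1 -> `|a| < 1 -> w x y a != 0.
Proof.
move=> xR yR x1 y1 a1.
have sq (t : C) : t \is Num.real -> `|t| < 1 ->
    exists2 s : C, s \is Num.real & s ^+ 2 = 1 - t ^+ 2.
  move=> tR t1; exists (sqrtC (1 - t ^+ 2)); last exact: sqrtCK.
  apply: ger0_real; rewrite sqrtC_ge0 subr_ge0 -(real_normK tR).
  by rewrite expr_le1 ?normr_ge0// ltW.
have [s sR s2] := sq _ xR x1; have [t tR t2] := sq _ yR y1.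
rewrite (_ : w x y a = (1 - 2 * (x * y - s * t) * a + a ^+ 2)
                       * (1 - 2 * (x * y + s * t) * a + a ^+ 2)); last first.
  have -> : (1 - 2 * (x * y - s * t) * a + a ^+ 2)
            * (1 - 2 * (x * y + s * t) * a + a ^+ 2)
          = (1 - 2 * x * y * a + a ^+ 2) ^+ 2 - 4 * (s ^+ 2 * t ^+ 2) * a ^+ 2
    by ring.
  by rewrite s2 t2 /w; ring.
have q1 : (x * y - s * t) ^+ 2 + (x * t + y * s) ^+ 2
          = (x ^+ 2 + s ^+ 2) * (y ^+ 2 + t ^+ 2) by ring.
have q2 : (x * y + s * t) ^+ 2 + (x * t - y * s) ^+ 2
          = (x ^+ 2 + s ^+ 2) * (y ^+ 2 + t ^+ 2) by ring.
have one : (x ^+ 2 + s ^+ 2) * (y ^+ 2 + t ^+ 2) = 1.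
  by rewrite s2 t2 !(addrC _ (1 - _)) !subrK mulr1.
rewrite mulf_neq0//.
- apply: (@quadratic_neq0 _ (x * t + y * s)) => //; last by rewrite q1.
  + by rewrite rpredB ?rpredM.
  + by rewrite rpredD ?rpredM.
- apply: (@quadratic_neq0 _ (x * t - y * s)) => //; last by rewrite q2.
  + by rewrite rpredD ?rpredM.
  + by rewrite rpredB ?rpredM.
Qed.

Lemma conv_domain_real x y rho1 z rho2 :
  x \is Num.real -> y \is Num.real -> z \is Num.real ->
  `|x| < 1 -> `|y| < 1 -> `|z| < 1 -> `|rho1| < 1 -> `|rho2| < 1 ->
  conv_domain x y rho1 z rho2.
Proof.
move=> xR yR zR x1 y1 z1 r1 r2; split=> t tr; apply: w_real_neq0 => //.
- exact: le_lt_trans r1.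
- exact: le_lt_trans r2.
Qed.

Lemma nonsingular_real x y rho1 z rho2 q :
  x \is Num.real -> y \is Num.real -> z \is Num.real ->
  `|x| < 1 -> `|y| < 1 -> `|z| < 1 -> `|rho1| < 1 -> `|rho2| < 1 ->
  `|q| < 1 -> nonsingular x y rho1 z rho2 q.
Proof.
move=> xR yR zR x1 y1 z1 r1 r2 q1 j.
have rq (r : C) : `|r| < 1 -> `|r * q ^+ j| < 1.
  move=> lt_r1; rewrite normrM; apply: le_lt_trans lt_r1.
  by rewrite ler_piMr ?normr_ge0// normrX exprn_ile1 ?normr_ge0// ltW.
split; apply: w_real_neq0 => //; apply: rq => //.
rewrite normrM; apply: le_lt_trans r1.
by rewrite ler_piMr ?normr_ge0// ltW.
Qed.

End Densities.

(* Main.v *)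
(* Write s = 2 rho1 y = a + b, P = rho1^2 = ab, 2 rho2 z = c + d, rho2^2 = cd and
   u = abcd.  All the families involved have generating functions of the form
   prod_j (1 - n1 t q^j + n2 t^2 q^2j) / (1 - d1 t q^j + d2 t^2 q^2j), and everything
   rests on the effect of the shift c -> qc.  In the basis p_j(x|y,rho1,q),
   multiplication by 1 - 2cx + c^2 carries the moments of f_C2N at (a,b,c,d) to a
   multiple of those at (a,b,qc,d), and carries alpha_n at (a,b,qc,d) to a combination
   of alpha_{n+1} and alpha_n at (a,b,c,d).

   (i) By induction on n over these relations the moment functional kills alpha_n for
   n >= 1.  Since c and cbar factor through the change of basis between h_n and
   p_n(.|y,rho1,q) and the triangular matrix of the alpha_n, this says that the
   matrices (c_{n,k}) and (cbar_{n,k}) are inverse to each other.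

   (ii) Summed against h_n/(q)_n, respectively alpha_n/norm, the relations telescope.
   Shifting c and then d yields w(x,z|rho2) F(rho2) = K F(q rho2) for the first series
   F, with K an explicit constant, and the inverse relation for the second series.
   Iterating, dominated convergence replaces rho2 by 0 at the cost of the infinite
   product of w(x,z|rho2 q^j); at rho2 = 0 the series is symmetric enough to be the
   same series with (rho1,rho2) replaced by (0,rho1), so a second round leaves the
   series 1. *)
Require Import Defs.
From HB Require Import structures.
From mathcomp Require Import all_boot all_order all_algebra.
From mathcomp Require Import all_classical all_reals all_analysis.
From mathcomp Require Import complex.
From mathcomp Require Import ring lra zify.
Set Implicit Arguments.
Unset Strict Implicit.
Unset Printing Implicit Defensive.
Import Order.TTheory GRing.Theory Num.Theory.
Import numFieldNormedType.Exports.
Local Open Scope classical_set_scope.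
Local Open Scope ring_scope.

(** No integral is formed: the moments are an explicit sequence, and only their behaviour under c ->
    qc enters. That shift multiplies the Askey-Wilson weight by 1 - 2cx + c^2, which is linear in x
    and hence tridiagonal in the basis p_j; this is why summing over n leaves nothing but a boundary
    term. The shift acts on c alone, whereas the data give only c + d and cd, so the roots must be
    extracted first. Writing every family through [U] removes q^-1 and rho^-1, so that q = 0 and rho
    = 0 need no case distinction later. The two series converge for different reasons. The terms of
    the first are only geometrically small, with ratio about max(|a|,|b|,|c|,|d|) |X| where 2x = X +
    1/X and |X| >= 1; this is where [conv_domain] enters. In the second, the coefficients [gam]
    decay faster than any geometric sequence, and only the nonvanishing of the denominators matters.
    Since the shifts are iterated infinitely often, all estimates have to be uniform over the pairs
    (q^i c, q^j d). *)

Lemma nat_ind2 (P : nat -> Prop) :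
  P 0%N -> P 1%N -> (forall m, P m -> P m.+1 -> P m.+2) -> forall m, P m.
Proof.
move=> P0 P1 PS m; suff [] : P m /\ P m.+1 by [].
by elim: m => // m [Pm Pm1]; split=> //; apply: PS.
Qed.

Lemma h_rec (K : fieldType) m (x q : K) :
  h m.+2 x q = 2 * x * h m.+1 x q - (1 - q ^+ m.+1) * h m x q.
Proof. by []. Qed.

(** * Sequences with product generating functions *)

Section Useq.
Variables (K : fieldType) (q : K).
Implicit Types (a c d s P : K).

(* [U n1 n2 d1 d2 m / (q)_m] is the coefficient of t^m in
   prod_j (1 - n1 t q^j + n2 t^2 q^2j) / (1 - d1 t q^j + d2 t^2 q^2j). *)
Fixpoint U (n1 n2 d1 d2 : K) (m : nat) {struct m} : K :=
  match m with
  | 0 => 1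
  | 1 => d1 - n1
  | (k.+1 as k1).+1 => (d1 - n1 * q ^+ k.+1) * U n1 n2 d1 d2 k1
       - (d2 - n2 * q ^+ k) * (1 - q ^+ k.+1) * U n1 n2 d1 d2 k
  end.

Lemma U_rec n1 n2 d1 d2 m : U n1 n2 d1 d2 m.+2 =
  (d1 - n1 * q ^+ m.+1) * U n1 n2 d1 d2 m.+1
  - (d2 - n2 * q ^+ m) * (1 - q ^+ m.+1) * U n1 n2 d1 d2 m.
Proof. by []. Qed.

(** Replaces t by l t in the generating function. *)
Lemma U_scale l n1 n2 d1 d2 m : l ^+ m * U n1 n2 d1 d2 m =
  U (l * n1) (l ^+ 2 * n2) (l * d1) (l ^+ 2 * d2) m.
Proof.
elim/nat_ind2: m => [||m IH0 IH1]; rewrite ?U_rec -?IH0 -?IH1 ?exprS /=; ring.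
Qed.

Lemma p_U m x y r : p m x y r q = U (2 * r * y) (r ^+ 2) (2 * x) 1 m.
Proof.
elim/nat_ind2: m => [|/=|m IH0 IH1]; [by []|ring|].
by rewrite U_rec -IH0 -IH1 /=; ring.
Qed.

Lemma h_U m x : h m x q = U 0 0 (2 * x) 1 m.
Proof.
elim/nat_ind2: m => [|/=|m IH0 IH1]; [by []|ring|].
by rewrite U_rec -IH0 -IH1 /=; ring.
Qed.

(** For nonzero q the powers of q in [b] clear those of q^-1 in h_m(x|1/q). The resulting recurrence
    still makes sense at q = 0 and there reproduces the exceptional values. *)
Lemma b_U m x : b m x q = U (2 * x) 1 0 0 m.
Proof.
rewrite /b; have [q0|q0] := eqVneq q 0.
  case: m => [//|[|[|m]]].
  - by rewrite /=; ring.
  - by rewrite /= q0 !exprS expr0; ring.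
  by elim: m => [|m IH]; rewrite U_rec -?IH /= q0 ?exprS ?expr0; ring.
elim/nat_ind2: m => [|/=|m IH0 IH1]; rewrite ?bin1 ?expr0 ?mulr1//; first ring.
rewrite U_rec -IH0 -IH1 h_rec (_ : 'C(m.+2, 2) = 'C(m, 2) + m + m.+1)%N; last first.
  by rewrite binS bin1 binS bin1 (addnC _ m) addnC addnA.
rewrite (_ : 'C(m.+1, 2) = 'C(m, 2) + m)%N; last by rewrite binS bin1.
rewrite !exprD !exprS exprVn.
by field; rewrite q0 expf_neq0.
Qed.

(** Scaling t by r turns the r^-1 inside [p] into a polynomial dependence on r, so both branches of
    [g] become one formula. *)
Lemma g_U m x y r : g m x y r q = U (2 * x) 1 (2 * r * y) (r ^+ 2) m.
Proof.
rewrite /g; have [->|r0] := eqVneq r 0.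
  by rewrite b_U !mulr0 mul0r expr0n.
by rewrite p_U U_scale; congr U; field.
Qed.

(* On generating functions: the factors of index j = 0 are split off. *)
Lemma U_num a c d1 d2 m :
  U (a + c) (a * c) d1 d2 m.+1 = U (q * a + c) (q * (a * c)) d1 d2 m.+1
    - a * (1 - q ^+ m.+1) * U (q * a + c) (q * (a * c)) d1 d2 m.
Proof.
elim/nat_ind2: m => [||m IH0 IH1].
- by rewrite /= ?exprS ?expr0; ring.
- by rewrite /= ?exprS ?expr0; ring.
by rewrite [LHS]U_rec IH0 IH1 !U_rec !exprS; ring.
Qed.

Lemma U_den n1 n2 d1 d2 m :
  U n1 n2 (q * d1) (q ^+ 2 * d2) m.+2 = U n1 n2 d1 d2 m.+2
    - d1 * (1 - q ^+ m.+2) * U n1 n2 d1 d2 m.+1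
    + d2 * (1 - q ^+ m.+2) * (1 - q ^+ m.+1) * U n1 n2 d1 d2 m.
Proof.
elim/nat_ind2: m => [||m IH0 IH1].
- by rewrite /= ?exprS ?expr0; ring.
- by rewrite /= ?exprS ?expr0; ring.
by rewrite [LHS]U_rec IH0 IH1 !U_rec !exprS; ring.
Qed.

(** Dilating t to qt drops the factors of index 0; the factor 1 - ct of the numerator is then put
    back. *)
Lemma U_numq a c d1 d2 m :
  U (q * a + c) (q * (a * c)) (q * d1) (q ^+ 2 * d2) m.+1 =
    q ^+ m.+1 * U (a + c) (a * c) d1 d2 m.+1
    - c * (1 - q ^+ m.+1) * q ^+ m * U (a + c) (a * c) d1 d2 m.
Proof.
elim/nat_ind2: m => [||m IH0 IH1].
- by rewrite /= ?exprS ?expr0; ring.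
- by rewrite /= ?exprS ?expr0; ring.
by rewrite [LHS]U_rec IH0 IH1 !U_rec !exprS; ring.
Qed.

(* Below, [s], [P], [sg], [de] stand for 2 rho1 y, rho1^2, 2 rho2 z, rho2^2; then
   [mom_num] is rho2^m p_m(z|y,rho1 rho2,q), and [gam] is
   rho2^m g_m(z|y,rho1 rho2 q^(n-1),q). *)
Definition mom_num s P sg de m := U (de * s) (P * de ^+ 2) sg de m.

(** The identity behind [awmom_shift], cleared of q-Pochhammer quotients. Once the right side is
    expanded by its recurrence, the two previous instances reduce everything to two consecutive
    unshifted values. *)
Lemma mom_num_shift s P c d (j : nat) : let u := P * (c * d) in
  (1 + c ^+ 2 - c * s * q ^+ j) * (1 - u * q ^+ j) * mom_num s P (c + d) (c * d) j
  - c * (1 - P * q ^+ j) * mom_num s P (c + d) (c * d) j.+1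
  - (if j is i.+1 then c * (1 - u * q ^+ j) * (1 - u * q ^+ i) * (1 - q ^+ j)
       * mom_num s P (c + d) (c * d) i else 0)
  = (1 - c * s + c ^+ 2 * P) * (1 - c * d)
    * mom_num s P (q * c + d) (q * (c * d)) j.
Proof.
rewrite /mom_num; cbv zeta; elim/nat_ind2: j => [||j IH0 IH1].
- by rewrite /= ?exprS ?expr0; ring.
- by rewrite /= ?exprS ?expr0; ring.
rewrite [in RHS]U_rec [RHS]mulrBr.
rewrite !(mulrCA ((1 - c * s + c ^+ 2 * P) * (1 - c * d))).
rewrite -IH0 -IH1; clear IH0 IH1.
(* The instance at j = 0 lacks the term of index i, so the step that uses it is checked apart. *)
case: j => [|j].
  by rewrite /= ?exprS ?expr0; ring.
rewrite !U_rec !exprS.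
move: (U _ _ _ _ j) (U _ _ _ _ j.+1) (q ^+ j) => f0 f1 J.
ring.
Qed.
End Useq.

Section Gamma.
Variables (K : fieldType) (q : K).
Implicit Types (a c d s P : K).

Definition gam s P sg de (n m : nat) :=
  U q sg de (de * s * q ^+ n.-1) (P * de ^+ 2 * (q ^+ n.-1) ^+ 2) m.

(** The identity behind [awcoef_shift]. [U_num] moves one root of the numerator from c to qc; the
    denominator moves too, since it depends on cd, and [U_den] realigns it. *)
Lemma gam_shift s P c d (j m : nat) : let u := P * (c * d) in
  (1 - u * (q ^+ (j + m) * q ^+ (j + m.+1))) * gam s P (c + d) (c * d) (j + m.+1) m.+1 =
  (1 - u * (q ^+ (j + m) * q ^+ j))
    * gam s P (q * c + d) (q * (c * d)) (j + m.+1) m.+1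
  - c * (1 - q ^+ m.+1)
    * (1 - d * s * q ^+ (j + m) + d ^+ 2 * P * q ^+ (j + m) ^+ 2)
    * gam s P (q * c + d) (q * (c * d)) (j + m) m.
Proof.
cbv zeta; rewrite /gam !addnS -pred_Sn.
(* The factor q of [q * (c * d)] is absorbed into the exponent [(j + m).-1]. Truncation could matter
   only for j = m = 0, where [U] has index 0. *)
have -> : U q (q * c + d) (q * (c * d)) (q * (c * d) * s * q ^+ (j + m).-1)
     (P * (q * (c * d)) ^+ 2 * (q ^+ (j + m).-1) ^+ 2) m =
  U q (q * c + d) (q * (c * d)) (c * d * s * q ^+ (j + m))
     (P * (c * d) ^+ 2 * (q ^+ (j + m)) ^+ 2) m.
  case: m => [//|m]; rewrite addnS -pred_Sn (exprS q (j + m)); congr U; ring.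
rewrite U_num.
rewrite (_ : q * (c * d) * s * q ^+ (j + m) = q * (c * d * s * q ^+ (j + m))); last ring.
rewrite (_ : P * (q * (c * d)) ^+ 2 * (q ^+ (j + m)) ^+ 2 =
   q ^+ 2 * (P * (c * d) ^+ 2 * (q ^+ (j + m)) ^+ 2)); last ring.
set d1 := c * d * s * _; set d2 := P * (c * d) ^+ 2 * _.
case: m @d1 @d2 => [|m] d1 d2.
  by rewrite /d1 /d2 /= addn0 !(exprS q) !expr0; ring.
rewrite U_den U_rec.
move: (U _ _ _ _ _ m) (U _ _ _ _ _ m.+1) => f0 f1.
by rewrite /d1 /d2 !(exprS q) exprD !(exprS q); ring.
Qed.

(** The denominator parameters of [gam] are proportional to de and de^2, so c -> qc dilates them
    exactly as [U_numq] requires. *)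
Lemma gam_rise_aux s P c d (n m : nat) :
  gam s P (q * c + d) (q * (c * d)) n.+1 m.+1 =
    q ^+ m.+1 * gam s P (c + d) (c * d) n.+1 m.+1
    - d * (1 - q ^+ m.+1) * q ^+ m * gam s P (c + d) (c * d) n.+1 m.
Proof.
rewrite /gam -pred_Sn -U_numq; congr U; ring.
Qed.

(** Raising the index by one has the same effect on the denominator as c -> qc; only the numerator
    remains to be adjusted. *)
Lemma gam_next s P c d (n m : nat) :
  gam s P (c + d) (c * d) n.+2 m.+1 =
    gam s P (q * c + d) (q * (c * d)) n.+1 m.+1
    - c * (1 - q ^+ m.+1) * gam s P (q * c + d) (q * (c * d)) n.+1 m.
Proof.
rewrite /gam -!pred_Sn U_num.
by congr (_ - _ * _); congr U; rewrite (exprS q n); ring.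
Qed.

Lemma gam_rec s P sg de n m : gam s P sg de n m.+2 =
  (de * s * q ^+ n.-1 - sg * q ^+ m.+1) * gam s P sg de n m.+1
  - (P * de ^+ 2 * (q ^+ n.-1) ^+ 2 - de * q ^+ m) * (1 - q ^+ m.+1)
    * gam s P sg de n m.
Proof. by []. Qed.

Lemma gam0 s P sg de n : gam s P sg de n 0 = 1. Proof. by []. Qed.
Lemma gam1 s P sg de n : gam s P sg de n 1 = de * s * q ^+ n.-1 - sg.
Proof. by []. Qed.

(* The polynomial identity behind [awcoef_rise], cleared of denominators. *)
Lemma gam_rise s P c d (j m : nat) : (0 < j + m)%N ->
  let u := P * (c * d) in
  let n := (j + m)%N in let N1 := q ^+ n.-1 in let J := q ^+ j in
  let M := q ^+ m in let N := q ^+ n in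
  let G n m := gam s P (c + d) (c * d) n m in
  let G' n m := gam s P (q * c + d) (q * (c * d)) n m in
  (1 + c ^+ 2 - c * s * J) * (1 - q * M) * (1 - u * N1 * J) * (1 - u * N * N)
    * G' n m
  - (if j is i.+1 then c * (1 - J) * (1 - P * q ^+ i) * (1 - u * N * N) * G' n m.+1
     else 0)
  - (if m is k.+1 then c * (1 - M) * (1 - q * M) * (1 - u * N1 * J)
       * (1 - u * N * J) * (1 - u * N * N) * G' n k else 0)
  + c * (1 - q * N) * (1 - P * N) * (1 - u * N1 * J) * G n.+1 m.+1
  - (1 - q * M) * (1 - c * s * N + c ^+ 2 * P * N ^+ 2) * (1 - c * d * N)
    * (1 - u * N1) * G n m = 0.
Proof.
(* The generic reduction descends to [gam] at index m - 2, so m = 0 and m = 1 are checked apart. *)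
cbv zeta; case: m => [|[|m]].
- case: j => [//|j _]; rewrite addn0 gam_next !gam_rise_aux /= !gam0 !gam1 /=.
  by rewrite !(exprS q) expr0; ring.
- rewrite addn1 /= gam_next !gam_rise_aux /= gam_rec !gam0 !gam1 /=.
  case: j => [|j] _; first by rewrite !(exprS q) expr0; ring.
  by rewrite !(exprS q) expr0; ring.
rewrite !addnS /= gam_next !gam_rise_aux !gam_rec /=.
move: (gam _ _ _ _ _ m) (gam _ _ _ _ _ m.+1) => f0 f1.
case: j => [|j] _; rewrite ?addSn ?add0n !(exprS q) ?exprD; set M := q ^+ m.
  by rewrite expr0; ring.
by set J := q ^+ j; ring.
Qed.
End Gamma.

(** * Askey-Wilson coefficients and moments under the shift *)

Section Qpoch.
Variables (K : fieldType) (q : K).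
Implicit Types (a : K).

Lemma qpoch0 a : qpoch a q 0 = 1.
Proof. by rewrite /qpoch big_ord0. Qed.

Lemma qpoch0l n : qpoch (0 : K) q n = 1.
Proof. by rewrite /qpoch big1// => j _; rewrite mul0r subr0. Qed.

Lemma qpochSr a n : qpoch a q n.+1 = qpoch a q n * (1 - a * q ^+ n).
Proof. by rewrite /qpoch big_ord_recr. Qed.

Lemma qpochD a m n : qpoch a q (m + n) = qpoch a q m * qpoch (a * q ^+ m) q n.
Proof.
elim: n => [|n IH]; first by rewrite addn0 qpoch0 mulr1.
by rewrite addnS !qpochSr IH exprD !mulrA.
Qed.

Lemma qpochSl a n : qpoch a q n.+1 = (1 - a) * qpoch (a * q) q n.
Proof. by rewrite -add1n qpochD qpochSr qpoch0 expr0 mulr1 mul1r expr1. Qed.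

Lemma qpoch_neq0 a n : (forall i, 1 - a * q ^+ i != 0) -> qpoch a q n != 0.
Proof. by move=> Ha; apply/prodf_neq0 => i _. Qed.

Hypothesis Hq : forall i, 1 - q ^+ i.+1 != 0.

Lemma qpochq_neq0 n : qpoch q q n != 0.
Proof. by apply: qpoch_neq0 => i; rewrite -exprS. Qed.

Lemma qbinom0 n : qbinom n 0 q = 1.
Proof. by rewrite /qbinom subn0 qpoch0 mul1r divff ?qpochq_neq0. Qed.

Lemma qbinomnn n : qbinom n n q = 1.
Proof. by rewrite /qbinom subnn qpoch0 mulr1 divff ?qpochq_neq0. Qed.

Lemma qbinom_up j m : qbinom (j + m).+1 j q =
  qbinom (j + m) j q * (1 - q ^+ (j + m).+1) / (1 - q ^+ m.+1).
Proof.
rewrite /qbinom -addnS !addKn addnS !qpochSr -!exprS.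
by field; rewrite !qpochq_neq0 !Hq.
Qed.

Lemma qbinom_right j m : qbinom (j + m).+1 j.+1 q =
  qbinom (j + m).+1 j q * (1 - q ^+ m.+1) / (1 - q ^+ j.+1).
Proof.
rewrite /qbinom subSS -addnS !addKn !qpochSr -!exprS.
by field; rewrite !qpochq_neq0 !Hq.
Qed.
End Qpoch.

Section Coef.
Variables (K : fieldType) (q : K).
Implicit Types (a c d s P : K).
Hypothesis Hq : forall i, 1 - q ^+ i.+1 != 0.

(* The coefficient of p_j(x|y,rho1,q) in alpha_n. *)
Definition awcoef s P sg de n j := qbinom n j q
  * (qpoch (P * q ^+ j) q (n - j) / qpoch (P * de * q ^+ (n + j).-1) q (n - j))
  * gam q s P sg de n (n - j).

(* The integral of p_j(x|y,rho1,q) against f_C2N; only the recurrence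
   [awmom_shift] is used. *)
Definition awmom s P sg de j :=
  qpoch P q j / qpoch (P * de) q j * mom_num q s P sg de j.

Lemma awcoefnn s P sg de n : awcoef s P sg de n n = 1.
Proof.
by rewrite /awcoef qbinomnn// subnn !qpoch0 divr1 !mulr1.
Qed.

Variables (s P c d u : K).
Hypothesis uE : u = P * (c * d).
Hypothesis Hu : forall i, 1 - u * q ^+ i != 0.
Hypothesis HP : forall i, 1 - P * q ^+ i != 0.

Lemma shift_uE : P * (q * (c * d)) = u * q.
Proof. by rewrite uE; ring. Qed.

(** With s = a + b and P = ab this is (1 - ac)(1 - bc)(1 - cd)/(1 - abcd), the ratio of the
    Askey-Wilson integral at (a,b,qc,d) to the one at (a,b,c,d). *)
Definition shift_const := (1 - c * s + c ^+ 2 * P) * (1 - c * d) / (1 - u).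

Lemma awmom_shift j :
  (1 + c ^+ 2 - c * s * q ^+ j) * awmom s P (c + d) (c * d) j
  - c * awmom s P (c + d) (c * d) j.+1
  - (if j is i.+1 then c * (1 - P * q ^+ i) * (1 - q ^+ j)
       * awmom s P (c + d) (c * d) i else 0)
  = shift_const * awmom s P (q * c + d) (q * (c * d)) j.
Proof.
have u0 : 1 - u != 0 by have := Hu 0; rewrite expr0 mulr1.
have /= E := mom_num_shift q s P c d j.
rewrite /awmom shift_uE -uE.
have -> : qpoch (u * q) q j = qpoch u q j * (1 - u * q ^+ j) / (1 - u).
  by rewrite -qpochSr qpochSl; field.
rewrite qpochSr (qpochSr q u j) /shift_const.
apply: (@mulIf _ (qpoch u q j * (1 - u * q ^+ j) / qpoch P q j)).
  by rewrite !mulf_neq0// ?invr_eq0 ?qpoch_neq0.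
rewrite -uE in E; case: j E => [|j] E.
  by refine (etrans _ (etrans E _)); rewrite ?qpoch0 ?expr0; field; rewrite oner_neq0.
rewrite !qpochSr.
by refine (etrans _ (etrans E _)); field; rewrite ?u0 !qpoch_neq0 ?HP ?Hu.
Qed.

(** The coefficient of alpha_n at (a,b,qc,d) in alpha_{n+1} at (a,b,c,d). The factor quadratic in d
    is (1 - ad q^n)(1 - bd q^n). *)
Definition lower_const n := - c * (1 - q ^+ n.+1) * (1 - P * q ^+ n)
  * (1 - d * s * q ^+ n + d ^+ 2 * P * (q ^+ n) ^+ 2)
  / ((1 - u * (q ^+ n * q ^+ n)) * (1 - u * (q ^+ n * q ^+ n.+1))).

Lemma awcoef_shift j m :
  awcoef s P (c + d) (c * d) (j + m).+1 j =
  awcoef s P (q * c + d) (q * (c * d)) (j + m).+1 j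
  + lower_const (j + m) * awcoef s P (q * c + d) (q * (c * d)) (j + m) j.
Proof.
have /= E := gam_shift q s P c d j m.
rewrite /awcoef shift_uE -uE -addnS !addKn !addnS !addSn -!pred_Sn.
rewrite -uE addnS in E.
(* If j + m + j = 0 the predecessor is truncated, but then m = 0 and both products are empty. *)
have -> : qpoch (u * q * q ^+ (j + m + j).-1) q m = qpoch (u * q ^+ (j + m + j)) q m.
  case: (posnP (j + m + j)) => [/eqP|]; last by case: (j + m + j)%N => // k _; rewrite exprS mulrA.
  by rewrite !addn_eq0 => /andP[/andP[_ /eqP->] _]; rewrite !qpoch0.
have -> : qpoch (u * q * q ^+ (j + m + j)) q m.+1 =
  qpoch (u * q ^+ (j + m + j)) q m * (1 - u * (q ^+ (j + m) * q ^+ (j + m)))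
  * (1 - u * (q ^+ (j + m) * q ^+ (j + m).+1)) / (1 - u * (q ^+ (j + m) * q ^+ j)).
  apply: (@mulfI _ (1 - u * (q ^+ (j + m) * q ^+ j))); first by rewrite -exprD.
  rewrite [RHS]mulrC divfK; last by rewrite -exprD.
  rewrite -(exprD q (j + m) j) [u * q * _]mulrAC -qpochSl.
  rewrite !qpochSr -!mulrA -!exprD; congr (_ * ((1 - u * q ^+ _) * (1 - u * q ^+ _))); lia.
have -> : qpoch (u * q ^+ (j + m + j)) q m.+1 =
  qpoch (u * q ^+ (j + m + j)) q m * (1 - u * (q ^+ (j + m) * q ^+ (j + m))).
  by rewrite qpochSr -mulrA -!exprD; congr (_ * (1 - u * q ^+ _)); lia.
have -> : qpoch (P * q ^+ j) q m.+1 = qpoch (P * q ^+ j) q m * (1 - P * q ^+ (j + m)).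
  by rewrite qpochSr exprD mulrA.
have h1 : 1 - u * (q ^+ (j + m) * q ^+ (j + m)) != 0 by rewrite -exprD.
have h2 : 1 - u * (q ^+ (j + m) * q ^+ (j + m).+1) != 0 by rewrite -exprD.
have h3 : 1 - u * (q ^+ (j + m) * q ^+ j) != 0 by rewrite -exprD.
have D0 : qpoch (u * q ^+ (j + m + j)) q m != 0.
  by apply: qpoch_neq0 => i; rewrite -mulrA -exprD.
rewrite qbinom_up// -[gam q s P (c + d) _ _ _](mulKf h2) E /lower_const.
move: h1 h2 h3 D0; set X1 := 1 - u * _; set X2 := 1 - u * _; set X3 := 1 - u * _.
by move=> *; field; rewrite ?Hq; do !(apply/andP; split).
Qed.

(* For [n = 0] the quotient below would involve q^-1. *)
Definition rise_const n := if n is k.+1 then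
    (1 - c * s * q ^+ n + c ^+ 2 * P * (q ^+ n) ^+ 2) * (1 - c * d * q ^+ n)
    * (1 - u * q ^+ k) / ((1 - u * (q ^+ n * q ^+ k)) * (1 - u * (q ^+ n * q ^+ n)))
  else shift_const.

(** Coefficientwise form of (1 - 2cx + c^2) alpha_n(a,b,qc,d) = - c alpha_{n+1}(a,b,c,d) +
    [rise_const] alpha_n(a,b,c,d): the left side is the transpose of [shift_op] applied to a row of
    coefficients. *)
Lemma awcoef_rise j m : (0 < j + m)%N ->
  let E := awcoef s P (c + d) (c * d) in
  let E' := awcoef s P (q * c + d) (q * (c * d)) in
  (1 + c ^+ 2 - c * s * q ^+ j) * E' (j + m)%N j
  - (if j is i.+1 then c * E' (j + m)%N i else 0)
  - (if m is k.+1 then c * (1 - P * q ^+ j) * (1 - q ^+ j.+1) * E' (j + m)%N j.+1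
     else 0)
  = - c * E (j + m).+1 j + rise_const (j + m) * E (j + m)%N j.
Proof.
move=> n0 /=; have [k kE] : exists k, (j + m)%N = k.+1 by exists (j + m).-1; rewrite prednK.
have R := gam_rise q s P c d n0; rewrite /= -uE in R.
have Mm : q ^+ (j + m).-1 * q ^+ j = q ^+ (j + m + j).-1 by rewrite -exprD kE addSn.
have h1 : 1 - u * q ^+ (j + m).-1 * q ^+ j != 0 by rewrite -mulrA -exprD.
have h2 : 1 - u * q ^+ (j + m) * q ^+ j != 0 by rewrite -mulrA -exprD.
have h3 : 1 - u * q ^+ (j + m) * q ^+ (j + m) != 0 by rewrite -mulrA -exprD.
have h4 : 1 - u * (q ^+ (j + m) * q ^+ (j + m).-1) != 0 by rewrite -exprD.
(* [B] is common to the five coefficients below. Each becomes [B] times a rational factor times a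
   value of [gam], which turns the claim into a multiple of [R]. *)
set B := qbinom (j + m) j q * qpoch (P * q ^+ j) q m
         / qpoch (u * q ^+ (j + m + j)) q m.
have D0 i : qpoch (u * q ^+ i) q m != 0.
  by apply: qpoch_neq0 => i'; rewrite -mulrA -exprD.
have B1 : awcoef s P (q * c + d) (q * (c * d)) (j + m) j =
   B * gam q s P (q * c + d) (q * (c * d)) (j + m) m.
  rewrite /awcoef shift_uE addKn -(mulrA u) -exprS prednK; last by rewrite addn_gt0 n0.
  by rewrite /B; ring.
have B2 : awcoef s P (c + d) (c * d) (j + m).+1 j =
   B * (1 - q * q ^+ (j + m)) / (1 - q * q ^+ m)
   * (1 - P * q ^+ (j + m)) / (1 - u * q ^+ (j + m) * q ^+ (j + m))
   * gam q s P (c + d) (c * d) (j + m).+1 m.+1.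
  rewrite /awcoef -uE -addnS addKn [(j + m.+1 + j).-1](_ : _ = j + m + j)%N; last lia.
  rewrite addnS qbinom_up// !qpochSr -(mulrA P) -(mulrA u) -!(exprD q) -!exprS.
  rewrite (_ : j + m + j + m = j + m + (j + m))%N; last lia.
  have := D0 (j + m + j)%N; have := Hu (j + m + (j + m)) => h5 h6.
  rewrite /B -[u * _ * q ^+ (j + m)]mulrA -exprD.
  by field; rewrite h5 h6 Hq.
have B3 : awcoef s P (c + d) (c * d) (j + m) j =
   B * (1 - u * (q ^+ (j + m) * q ^+ (j + m).-1)) / (1 - u * q ^+ (j + m).-1 * q ^+ j)
   * gam q s P (c + d) (c * d) (j + m) m.
  have X : qpoch (u * q ^+ (j + m + j).-1) q m
     * (1 - u * (q ^+ (j + m) * q ^+ (j + m).-1)) =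
     (1 - u * q ^+ (j + m).-1 * q ^+ j) * qpoch (u * q ^+ (j + m + j)) q m.
    rewrite -(mulrA u) Mm -[in RHS](@prednK (j + m + j)); last by rewrite addn_gt0 n0.
    rewrite exprSr [u * (_ * q)]mulrA -qpochSl qpochSr -(mulrA u) -!exprD.
    by congr (_ * (1 - u * q ^+ _)); lia.
  rewrite /awcoef -uE addKn -[qpoch (u * q ^+ (j + m + j).-1) q m](mulfK h4) X /B.
  by have := D0 (j + m + j)%N; move=> h5; field; rewrite h1 h5.
(* [B4] and [B5] are void when the neighbour j - 1 or j + 1 falls outside the row. *)
have B4 : if j is i.+1 then awcoef s P (q * c + d) (q * (c * d)) (j + m) i =
    B * (1 - q ^+ j) / (1 - q * q ^+ m) * (1 - P * q ^+ i)
    / (1 - u * q ^+ (j + m).-1 * q ^+ j)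
    * gam q s P (q * c + d) (q * (c * d)) (j + m) m.+1 else True.
  rewrite /B; case: (j) n0 h1 Mm D0 {R B B1 B2 B3 kE} => [//|i] _ h1 Mm D0.
  rewrite /awcoef shift_uE !addSn qbinom_right// -pred_Sn -addnS addKn.
  rewrite -(mulrA u) -exprS [qpoch (u * _) q m.+1]qpochSl -(mulrA u) -exprSr.
  rewrite [qpoch (P * q ^+ i) q m.+1]qpochSl -(mulrA P) -exprSr addnS -!exprS.
  rewrite -(mulrA u) Mm !addSn -pred_Sn !addnS.
  rewrite -(mulrA u) Mm !addSn -pred_Sn !addnS in h1.
  have h5 := D0 (i + m + i).+2.
  by field; rewrite h1 h5 !Hq.
have B5 : if m is k'.+1 then
    c * (1 - P * q ^+ j) * (1 - q ^+ j.+1) *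
    awcoef s P (q * c + d) (q * (c * d)) (j + m) j.+1 =
    c * B * (1 - q ^+ m) * (1 - u * q ^+ (j + m) * q ^+ j)
    * gam q s P (q * c + d) (q * (c * d)) (j + m) k' else True.
  rewrite /B; case: (m) h2 D0 {R B B1 B2 B3 B4 kE Mm n0 h1 h3 h4} => [//|k'] h2 D0.
  rewrite /awcoef shift_uE addnS qbinom_right// subSS addKn addnS -pred_Sn.
  rewrite -(mulrA u) -exprS [qpoch (u * q ^+ _) q k'.+1]qpochSl -[u * _ * q]mulrA -exprSr.
  rewrite [qpoch (P * q ^+ j) q k'.+1]qpochSl -[P * _ * q]mulrA -exprSr -!(mulrA u) -!(exprD q).
  rewrite -(mulrA u) -exprD addnS in h2.
  have h5 : qpoch (u * q ^+ ((j + k').+1 + j).+1) q k' != 0.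
    by apply: qpoch_neq0 => i'; rewrite -mulrA -exprD.
  by field; rewrite h2 h5 !Hq.
rewrite {}B1 {}B2 {}B3.
have KE : rise_const (j + m) = 
    (1 - c * s * q ^+ (j + m) + c ^+ 2 * P * (q ^+ (j + m)) ^+ 2) * (1 - c * d * q ^+ (j + m))
    * (1 - u * q ^+ (j + m).-1)
    / ((1 - u * (q ^+ (j + m) * q ^+ (j + m).-1)) * (1 - u * q ^+ (j + m) * q ^+ (j + m))).
  by rewrite kE /= -(mulrA u).
have hq : 1 - q * q ^+ m != 0 by rewrite -exprS.
rewrite {}KE; apply/eqP; rewrite -subr_eq0; apply/eqP.
move: R => /(congr1 (fun t => t * (B / ((1 - q * q ^+ m) * (1 - u * q ^+ (j + m).-1 * q ^+ j)
   * (1 - u * q ^+ (j + m) * q ^+ (j + m)))))).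
rewrite mul0r => R; refine (etrans _ R) => {R}.
move: h1 h2 h3 h4 hq B4 B5.
set X1 := 1 - u * _ * q ^+ j; set X2 := 1 - u * _ * q ^+ j.
set X3 := 1 - u * _ * q ^+ (j + m); set X4 := 1 - u * _; set X5 := 1 - q * q ^+ m.
move: X1 X2 X3 X4 X5 B => X1 X2 X3 X4 X5 B h1 h2 h3 h4 hq B4 B5.
have -> : (if m is k'.+1 then c * (1 - P * q ^+ j) * (1 - q ^+ j.+1) *
    awcoef s P (q * c + d) (q * (c * d)) (j + m) j.+1 else 0) =
  (if m is k'.+1 then c * B * (1 - q ^+ m) * X2
    * gam q s P (q * c + d) (q * (c * d)) (j + m) k' else 0).
  by case: (m) B5 => // k' ->.
have -> : (if j is i.+1 then c * awcoef s P (q * c + d) (q * (c * d)) (j + m) i else 0) =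
  (if j is i.+1 then c * (B * (1 - q ^+ j) / X5 * (1 - P * q ^+ i) / X1
    * gam q s P (q * c + d) (q * (c * d)) (j + m) m.+1) else 0).
  by case: (j) B4 => // i ->.
by clear B4 B5; case: (j) => [|i]; case: (m) => [|k']; field; rewrite ?h1 ?h2 ?h3 ?h4 ?hq.
Qed.
End Coef.

(** Summation by parts: the tridiagonal operator passes from the sequence to its coefficients, and
    only the top superdiagonal term leaves the range. *)
Lemma sum_tridiag_adj (K : fieldType) (X al ga phi : nat -> K) be n :
  \sum_(j < n.+1) X j * (al j * phi j + be * phi j.+1
     + (if j : nat is i.+1 then ga i * phi i else 0)) =
  \sum_(j < n.+1) (al j * X j + (if j : nat is i.+1 then be * X i else 0)
     + (if (j < n)%N then ga j * X j.+1 else 0)) * phi j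
  + be * X n * phi n.+1.
Proof.
under eq_bigr do rewrite !mulrDr.
under [in RHS]eq_bigr do rewrite !mulrDl.
rewrite !big_split /= -!addrA; congr (_ + _).
  by apply: eq_bigr => j _; ring.
rewrite addrA addrAC; congr (_ + _).
  rewrite big_ord_recr /= [in RHS]big_ord_recl /= mul0r add0r.
  congr (_ + _); last ring.
  by apply: eq_bigr => j _; rewrite /bump /=; ring.
rewrite big_ord_recl /= mulr0 add0r [in RHS]big_ord_recr /= ltnn mul0r addr0.
by apply: eq_bigr => j _; rewrite /bump /= ltn_ord; ring.
Qed.

Section Sums.
Variables (K : fieldType) (q : K).
Hypothesis Hq : forall i, 1 - q ^+ i.+1 != 0.
Implicit Types (phi : nat -> K).

(** Keeping [phi] arbitrary lets the same shift relations serve three times: p_j(x) gives alpha_n,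
    [awmom] gives its moment, and rho1^j b_j(y|q) gives c_{n,0}. *)
Definition awsum s P sg de n phi := \sum_(j < n.+1) awcoef q s P sg de n j * phi j.

Section Shift.
Variables (s P c d u : K).
Hypothesis uE : u = P * (c * d).
Hypothesis Hu : forall i, 1 - u * q ^+ i != 0.
Hypothesis HP : forall i, 1 - P * q ^+ i != 0.

Lemma awsum_shift n phi :
  awsum s P (c + d) (c * d) n.+1 phi =
  awsum s P (q * c + d) (q * (c * d)) n.+1 phi
  + lower_const q s P c d u n * awsum s P (q * c + d) (q * (c * d)) n phi.
Proof.
rewrite /awsum big_ord_recr [in RHS]big_ord_recr /= !awcoefnn// addrAC; congr (_ + _).
rewrite mulr_sumr -big_split; apply: eq_bigr => -[j ltjn] _ /=.
have [m ->] : exists m, n = (j + m)%N by exists (n - j)%N; rewrite subnKC// -ltnS.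
by rewrite (awcoef_shift _ _ uE)//; ring.
Qed.

(* Multiplication by 1 - 2 c x + c^2 in the basis p_j(x|y,rho1,q), with the
   polynomials replaced by an arbitrary sequence. *)
Definition shift_op phi (j : nat) := (1 + c ^+ 2 - c * s * q ^+ j) * phi j
  - c * phi j.+1
  - (if j is i.+1 then c * (1 - P * q ^+ i) * (1 - q ^+ j) * phi i else 0).

Lemma awsum_rise n phi :
  awsum s P (q * c + d) (q * (c * d)) n (shift_op phi) =
  - c * awsum s P (c + d) (c * d) n.+1 phi
  + rise_const q s P c d u n * awsum s P (c + d) (c * d) n phi.
Proof.
have u0 : 1 - u != 0 by have := Hu 0; rewrite expr0 mulr1.
case: n => [|n].
  rewrite /awsum !big_ord_recr !big_ord0 /= !awcoefnn// /shift_op /shift_const.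
  rewrite /awcoef qbinom0// subn0 !qpochSr !qpoch0 gam1 /= -uE ?addn0 /= ?expr0.
  rewrite !mulr1 subr0; move: u0; rewrite uE => u0; field; rewrite ?oner_neq0 ?u0//.
transitivity (\sum_(j < n.+2) awcoef q s P (q * c + d) (q * (c * d)) n.+1 j *
   ((1 + c ^+ 2 - c * s * q ^+ j) * phi j + (- c) * phi j.+1 +
     (if j : nat is i.+1 then - (c * (1 - P * q ^+ i) * (1 - q ^+ i.+1)) * phi i else 0))).
  apply: eq_bigr => j _; rewrite /shift_op; case: (j : nat) => [|i]; ring.
rewrite (sum_tridiag_adj _ (fun j => 1 + c ^+ 2 - c * s * q ^+ j)
  (fun i => - (c * (1 - P * q ^+ i) * (1 - q ^+ i.+1)))).
rewrite /awsum; set kp := rise_const _ _ _ _ _ _ _.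
rewrite [\sum_(j < n.+3) _]big_ord_recr /= !awcoefnn// mulrDr addrAC.
congr (_ + _); last ring.
rewrite !mulr_sumr -big_split; apply: eq_bigr => -[j ltjn] _ /=.
have [m mE] : exists m, n.+1 = (j + m)%N.
  by exists (n.+1 - j)%N; rewrite subnKC// -ltnS.
have n0 : (0 < j + m)%N by rewrite -mE.
have R := awcoef_rise Hq s uE Hu n0; rewrite -mE -/kp /= in R.
rewrite [RHS](_ : _ = (- c * awcoef q s P (c + d) (c * d) n.+2 j +
   kp * awcoef q s P (c + d) (c * d) n.+1 j) * phi j); last ring.
rewrite -R {R}; congr (_ * _); case: m mE {n0} => [|m] mE.
  by rewrite mE addn0 ltnn; case: (j) => [|i]; ring.
have -> : (j < n.+1)%N by rewrite mE addnS ltnS leq_addr.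
by case: (j) => [|i]; ring.
Qed.
End Shift.

Lemma awsum0 s P sg de phi : awsum s P sg de 0 phi = phi 0%N.
Proof. by rewrite /awsum big_ord_recr big_ord0 /= add0r awcoefnn// mul1r. Qed.

Lemma awmom0 s P sg de : awmom q s P sg de 0 = 1.
Proof. by rewrite /awmom !qpoch0 divr1 mulr1. Qed.

Lemma gamS0 s P n m : gam q s P 0 0 n m.+1 = 0.
Proof.
rewrite /gam; elim: m => [|m IH]; first by rewrite /=; ring.
by rewrite U_rec IH; ring.
Qed.

Lemma mom_numS0 s P m : mom_num q s P 0 0 m.+1 = 0.
Proof.
rewrite /mom_num; elim: m => [|m IH]; first by rewrite /=; ring.
by rewrite U_rec IH; ring.
Qed.

(** [awsum_rise] and [awmom_shift] together relate degree n+1 at (c,d) to degree n at (c,d) and at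
    (qc,d); therefore c and d vary in the induction. *)
Lemma awsum_awmom s P c d :
  (forall i, 1 - P * (c * d) * q ^+ i != 0) -> (forall i, 1 - P * q ^+ i != 0) ->
  forall n, awsum s P (c + d) (c * d) n.+1 (awmom q s P (c + d) (c * d)) = 0.
Proof.
move=> + HP n; elim/ltn_ind: n c d => n IH c d Hu.
have step (c' d' : K) : c' + d' = c + d -> c' * d' = c * d -> c' != 0 ->
    awsum s P (c + d) (c * d) n.+1 (awmom q s P (c + d) (c * d)) = 0.
  move=> sE pE c0; rewrite -sE -pE; rewrite -pE in Hu.
  have Hu' i : 1 - P * (q * (c' * d')) * q ^+ i != 0.
    by have := Hu i.+1; rewrite exprS; congr (1 - _ != 0); ring.
  have R := awsum_rise s (erefl _) Hu n (awmom q s P (c' + d') (c' * d')).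
  have E : awsum s P (q * c' + d') (q * (c' * d')) n
       (shift_op s P c' (awmom q s P (c' + d') (c' * d'))) =
     shift_const s P c' d' (P * (c' * d')) *
     awsum s P (q * c' + d') (q * (c' * d')) n
        (awmom q s P (q * c' + d') (q * (c' * d'))).
    rewrite mulr_sumr; apply: eq_bigr => j _.
    by rewrite /shift_op (awmom_shift s (erefl _) Hu HP) mulrCA.
  rewrite {}E in R; apply: (@mulfI _ (- c')); first by rewrite oppr_eq0.
  (* In degree 0 both sums are 1 and [rise_const] is [shift_const], so these two terms cancel in
     [R]. *)
  rewrite mulr0; case: n IH R => [|n] IH R.
    rewrite !awsum0 !awmom0 !mulr1 in R.
    by apply: (addIr (shift_const s P c' d' (P * (c' * d')))); rewrite -R add0r.
  have := IH n (leqnn _) (q * c') d'; rewrite -mulrA => IH'.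
  by rewrite IH'// (IH n)// !mulr0 addr0 in R.
(* The relation is divided by c. If c = 0, then d takes its place by symmetry; if both vanish, so
   does every [gam] and [mom_num] of positive index. *)
have [c0|c0] := eqVneq c 0; last exact: (step c d).
have [d0|d0] := eqVneq d 0; last by apply: (step d c); rewrite ?[d + _]addrC ?[d * _]mulrC.
rewrite c0 d0 addr0 mulr0 /awsum big_ord_recr big1 /= ?add0r; last first.
  move=> j _; rewrite /awcoef -[(n.+1 - j)%N]prednK ?subn_gt0//.
  by rewrite gamS0 mulr0 mul0r.
by rewrite /awmom mom_numS0 !mulr0.
Qed.

End Sums.

(** * Change of basis and the inverse relation *)

Section Conn.
Variables (K : fieldType) (q : K).
Hypothesis Hq : forall i, 1 - q ^+ i.+1 != 0.
Implicit Types (phi : nat -> K).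

(* Multiplication by 2x in the basis p_j(x|y,rho1,q), see [jacU]. *)
Definition jac s P phi (j : nat) := s * q ^+ j * phi j + 1 * phi j.+1
  + (if j is i.+1 then (1 - P * q ^+ i) * (1 - q ^+ i.+1) * phi i else 0).

(** On generating functions of phi_n/(q)_n this is multiplication by prod_j (1 - s1 t q^j + P1 t^2
    q^2j)/(1 - s2 t q^j + P2 t^2 q^2j). *)
Definition conn s1 P1 s2 P2 n phi :=
  \sum_(j < n.+1) qbinom n j q * U q s1 P1 s2 P2 (n - j) * phi j.

Lemma eq_conn s1 P1 s2 P2 n phi psi :
  phi =1 psi -> conn s1 P1 s2 P2 n phi = conn s1 P1 s2 P2 n psi.
Proof. by move=> E; apply: eq_bigr => j _; rewrite E. Qed.

Lemma conn0 s1 P1 s2 P2 phi : conn s1 P1 s2 P2 0 phi = phi 0%N.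
Proof. by rewrite /conn big_ord_recr big_ord0 /= qbinom0// add0r !mul1r. Qed.

(** [conn] intertwines the recurrence operators of the two bases. Both [connK] and [conn_U] follow
    from this by induction, without multiplying power series. *)
Lemma conn_jac s1 P1 s2 P2 n phi :
  conn s1 P1 s2 P2 n (jac s2 P2 phi) = conn s1 P1 s2 P2 n.+1 phi
  + s1 * q ^+ n * conn s1 P1 s2 P2 n phi
  + (if n is k.+1 then (1 - P1 * q ^+ k) * (1 - q ^+ n) * conn s1 P1 s2 P2 k phi
     else 0).
Proof.
rewrite {1}/conn (sum_tridiag_adj (fun j => qbinom n j q * U q s1 P1 s2 P2 (n - j))
  (fun j => s2 * q ^+ j) (fun i => (1 - P2 * q ^+ i) * (1 - q ^+ i.+1))).
(* The last term is padded with a zero to the common range, so that coefficients can be compared one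
   by one. *)
have -> : (if n is k.+1 then (1 - P1 * q ^+ k) * (1 - q ^+ n) * conn s1 P1 s2 P2 k phi
     else 0) = \sum_(j < n.+1) (if (j < n)%N then (1 - P1 * q ^+ n.-1) * (1 - q ^+ n)
       * (qbinom n.-1 j q * U q s1 P1 s2 P2 (n.-1 - j)) else 0) * phi j.
  rewrite [RHS]big_ord_recr /= ltnn mul0r addr0; case: n => [|n]; first by rewrite big_ord0.
  by rewrite mulr_sumr; apply: eq_bigr => j _; rewrite ltn_ord -!mulrA.
rewrite {1}/conn [in RHS]big_ord_recr /= !subnn !qbinomnn// !mulr1 !mul1r.
rewrite [RHS](_ : _ = \sum_(i < n.+1) qbinom n.+1 i q * U q s1 P1 s2 P2 (n.+1 - i) * phi i +
   s1 * q ^+ n * conn s1 P1 s2 P2 n phi + \sum_(j < n.+1) (if (j < n)%N then (1 - P1 * q ^+ n.-1) * (1 - q ^+ n)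
       * (qbinom n.-1 j q * U q s1 P1 s2 P2 (n.-1 - j)) else 0) * phi j + phi n.+1); last ring.
congr (_ + _).
rewrite /conn mulr_sumr -!big_split; apply: eq_bigr => -[j ltjn] _ /=.
have [m mE] : exists m, n = (j + m)%N by exists (n - j)%N; rewrite subnKC// -ltnS.
rewrite [RHS](_ : _ = (qbinom n.+1 j q * U q s1 P1 s2 P2 (n.+1 - j)
  + s1 * q ^+ n * (qbinom n j q * U q s1 P1 s2 P2 (n - j))
  + (if (j < n)%N then (1 - P1 * q ^+ n.-1) * (1 - q ^+ n)
      * (qbinom n.-1 j q * U q s1 P1 s2 P2 (n.-1 - j)) else 0)) * phi j); last by case: ifP => _; ring.
rewrite {}mE {n ltjn}; congr (_ * _).
case: m => [|m].
  rewrite !addn0 ltnn subSnn subnn qbinomnn//= !mulr1 addr0.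
  have := qbinom_up Hq j 0; rewrite addn0 => ->; rewrite qbinomnn// expr1.
  case: j => [|j]; first by field; rewrite -(expr1 q) Hq.
  have := qbinom_right Hq j 0; rewrite addn0 qbinomnn// expr1 => /esym E.
  have h1 : 1 - q != 0 by rewrite -(expr1 q).
  have -> : qbinom j.+1 j q = (1 - q ^+ j.+1) / (1 - q).
    apply: (@mulIf _ ((1 - q) / (1 - q ^+ j.+1))); first by rewrite mulf_neq0 ?invr_eq0.
    by rewrite mulrA E; field; rewrite h1 Hq.
  by rewrite subSnn /= !exprS; field.
rewrite !addnS ltnS leq_addr -pred_Sn subSS.
have k0 : (j + m - j = m)%N by rewrite addKn.
have k1 : ((j + m).+1 - j = m.+1)%N by rewrite -addnS addKn.
have k2 : ((j + m).+2 - j = m.+2)%N by rewrite -!addnS addKn.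
have := qbinom_up Hq j m.+1; rewrite addnS => ->.
rewrite qbinom_right// qbinom_up// k0 k1 k2.
have -> : (if j is i.+1 then 1 * (qbinom (j + m).+1 i q * U q s1 P1 s2 P2 ((j + m).+1 - i))
     else 0) = qbinom (j + m) j q * (1 - q ^+ (j + m).+1) / (1 - q ^+ m.+1)
     * (1 - q ^+ j) / (1 - q ^+ m.+2) * U q s1 P1 s2 P2 m.+2.
  case: (j) => [|i]; first by rewrite expr0 subrr !(mulr0, mul0r).
  rewrite -qbinom_up// addSn -addnS qbinom_right// -!addnS addKn mul1r.
  by field; rewrite !Hq.
rewrite U_rec.
move: (U _ _ _ _ _ m) (U _ _ _ _ _ m.+1) (qbinom (j + m) j q) => f0 f1 b0.
have := Hq m; have := Hq m.+1; have := Hq j; have := Hq (j + m).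
rewrite !(exprS q) exprD; move: (q ^+ j) (q ^+ m) => J M h1 h2 h3 h4.
by field; rewrite ?h1 ?h2 ?h3 ?h4.
Qed.

(** [conn_jac] is solved for its term of highest index. The induction hypothesis is applied both to
    [phi] and to [jac s1 P1 phi]. *)
Lemma connK s1 P1 s2 P2 n phi :
  conn s1 P1 s2 P2 n (fun j => conn s2 P2 s1 P1 j phi) = phi n.
Proof.
elim/ltn_ind: n phi => -[_ phi|n IH phi]; first by rewrite !conn0.
have E := conn_jac s1 P1 s2 P2 n (fun j => conn s2 P2 s1 P1 j phi).
rewrite (@eq_conn _ _ _ _ _ _ (fun j => conn s2 P2 s1 P1 j (jac s1 P1 phi))) in E; last first.
  by move=> j; rewrite conn_jac /jac; case: j => [|j]; ring.
rewrite (IH n)// (IH n)// in E; rewrite /jac in E.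
case: n IH E => [|n] IH E.
  by apply: (addIr (s1 * q ^+ 0 * phi 0%N)); move: E; rewrite !addr0 mul1r => <-; rewrite addrC.
rewrite (IH n)// in E.
apply: (addIr (s1 * q ^+ n.+1 * phi n.+1)).
apply: (addIr ((1 - P1 * q ^+ n) * (1 - q ^+ n.+1) * phi n)).
by rewrite -E; ring.
Qed.

Lemma jacU s P x n : jac s P (U q s P x 1) n = x * U q s P x 1 n.
Proof. by rewrite /jac; case: n => [|n]; rewrite ?U_rec /=; ring. Qed.

Lemma conn_U s1 P1 s2 P2 x n :
  conn s1 P1 s2 P2 n (U q s2 P2 x 1) = U q s1 P1 x 1 n.
Proof.
have step m : x * conn s1 P1 s2 P2 m (U q s2 P2 x 1) =
    conn s1 P1 s2 P2 m (jac s2 P2 (U q s2 P2 x 1)).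
  by rewrite mulr_sumr; apply: eq_bigr => j _; rewrite jacU; ring.
elim/nat_ind2: n => [||n IH0 IH1]; first by rewrite conn0.
  have := step 0%N; rewrite conn_jac conn0 /= !mulr1 addr0 => E.
  by apply: (addIr s1); rewrite subrK.
have := step n.+1; rewrite conn_jac IH0 IH1 => E.
rewrite U_rec [LHS](_ : _ = (conn s1 P1 s2 P2 n.+2 (U q s2 P2 x 1) +
    s1 * q ^+ n.+1 * U q s1 P1 x 1 n.+1 +
    (1 - P1 * q ^+ n) * (1 - q ^+ n.+1) * U q s1 P1 x 1 n)
   - s1 * q ^+ n.+1 * U q s1 P1 x 1 n.+1
   - (1 - P1 * q ^+ n) * (1 - q ^+ n.+1) * U q s1 P1 x 1 n); last ring.
by rewrite -E; ring.
Qed.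
End Conn.

Lemma sum_ge_shift (K : fieldType) (F : nat -> K) k n : (k <= n)%N ->
  \sum_(l < n.+1) (if (k <= l)%N then F l else 0) =
  \sum_(t < (n - k).+1) F (k + t)%N.
Proof.
move=> kn; rewrite -(big_mkord xpredT (fun l => if (k <= l)%N then F l else 0)).
rewrite (big_cat_nat (n := k))//=; last exact: leqW.
rewrite big_nat_cond big1 ?add0r; last first.
  by move=> i /andP[/andP[_ ik] _]; rewrite leqNgt ik.
rewrite -{1}[k]add0n big_addn big_mkord subSn//.
by apply: eq_bigr => t _; rewrite leq_addl addnC.
Qed.

Lemma sum_le_widen (K : fieldType) (F : nat -> K) k n : (k <= n)%N ->
  \sum_(l < n.+1) (if (l <= k)%N then F l else 0) = \sum_(l < k.+1) F l.
Proof.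
by move=> kn; rewrite -big_mkcond /= (big_ord_widen n.+1 F).
Qed.

(** * Factorization of c and cbar through the basis p_j *)

Section Translate.
Variables (K : fieldType) (q : K).
Hypothesis Hq : forall i, 1 - q ^+ i.+1 != 0.
Variables (y z r1 r2 : K).
Hypothesis Hu : forall i, 1 - r1 ^+ 2 * r2 ^+ 2 * q ^+ i != 0.
Hypothesis HP : forall i, 1 - r1 ^+ 2 * q ^+ i != 0.

Lemma h_scale m : r1 ^+ m * h m y q = U q 0 0 (2 * r1 * y) (r1 ^+ 2) m.
Proof. by rewrite h_U U_scale; congr U; ring. Qed.

Lemma b_scale m : r1 ^+ m * b m y q = U q (2 * r1 * y) (r1 ^+ 2) 0 0 m.
Proof. by rewrite b_U U_scale; congr U; ring. Qed.

Lemma p_scale m : r2 ^+ m * p m z y (r1 * r2) q =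
  mom_num q (2 * r1 * y) (r1 ^+ 2) (2 * r2 * z) (r2 ^+ 2) m.
Proof. by rewrite p_U U_scale; congr U; ring. Qed.

Lemma g_scale n m : r2 ^+ m * g m z y (r1 * r2 * q ^+ n.-1) q =
  gam q (2 * r1 * y) (r1 ^+ 2) (2 * r2 * z) (r2 ^+ 2) n m.
Proof. by rewrite g_U U_scale; congr U; ring. Qed.

Lemma alphaE n x : alpha n x y r1 z r2 q =
  awsum q (2 * r1 * y) (r1 ^+ 2) (2 * r2 * z) (r2 ^+ 2) n
    (U q (2 * r1 * y) (r1 ^+ 2) (2 * x) 1).
Proof.
by apply: eq_bigr => j _; rewrite /awcoef -g_scale -p_U; ring.
Qed.

Lemma ubarE n :
  \sum_(s < n.+1) qbinom n s q
      * (r1 ^+ (n - s) * r2 ^+ s * qpoch (r1 ^+ 2) q s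
         / qpoch (r1 ^+ 2 * r2 ^+ 2) q s)
      * h (n - s) y q * p s z y (r1 * r2) q =
  conn q 0 0 (2 * r1 * y) (r1 ^+ 2) n
    (awmom q (2 * r1 * y) (r1 ^+ 2) (2 * r2 * z) (r2 ^+ 2)).
Proof.
by apply: eq_bigr => j _; rewrite /awmom -h_scale -p_scale; ring.
Qed.

(** Passing from n to k through k + t: the q-binomials regroup, and (A)_{t+m} splits as (A)_t (A
    q^t)_m. *)
Lemma c_coefE k t m (u P : K) :
  (forall i, 1 - u * q ^+ i != 0) -> (forall i, 1 - P * q ^+ i != 0) ->
  qbinom (k + t + m) k q * (qpoch (P * q ^+ k) q (t + m) /
    qpoch (u * q ^+ (k + t + m + k).-1) q (t + m))
  * (qbinom (t + m) t q * (qpoch (u * q ^+ (k + t + m + k).-1) q t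
       / qpoch (P * q ^+ k) q t))
  = qbinom (k + t + m) (k + t) q * (qpoch (P * q ^+ (k + t)) q m
     / qpoch (u * q ^+ (k + t + m + (k + t)).-1) q m) * qbinom (k + t) k q.
Proof.
move=> Hu' HP'.
have D1 (i n : nat) : qpoch (u * q ^+ i) q n != 0.
  by apply: qpoch_neq0 => j; rewrite -mulrA -exprD.
have D2 (i n : nat) : qpoch (P * q ^+ i) q n != 0.
  by apply: qpoch_neq0 => j; rewrite -mulrA -exprD.
rewrite !qpochD -!(mulrA u) -!(mulrA P) -!(exprD q).
have -> : qpoch (u * q ^+ ((k + t + m + k).-1 + t)) q m =
    qpoch (u * q ^+ (k + t + m + (k + t)).-1) q m.
  case: m => [|m]; first by rewrite !qpoch0.
  by congr (qpoch (u * q ^+ _)); lia.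
have E : qbinom (k + t + m) k q * qbinom (t + m) t q =
    qbinom (k + t + m) (k + t) q * qbinom (k + t) k q.
  rewrite /qbinom !addKn (_ : k + t + m - k = t + m)%N; last lia.
  by field; rewrite !qpochq_neq0.
rewrite [LHS](_ : _ = qbinom (k + t + m) k q * qbinom (t + m) t q *
  (qpoch (P * q ^+ (k + t)) q m / qpoch (u * q ^+ (k + t + m + (k + t)).-1) q m)).
  by rewrite E; ring.
by field; rewrite !D1 !D2.
Qed.

(** For psi = h_k(x) this expands alpha_n in the h_k: [awcoef] leads from alpha_n to the p_i, and
    [conn] from p_i to the h_k. *)
Lemma c_awsum n (psi : nat -> K) :
  \sum_(k < n.+1) c n k y r1 z r2 q * psi k =
  awsum q (2 * r1 * y) (r1 ^+ 2) (2 * r2 * z) (r2 ^+ 2) n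
    (fun i => conn q (2 * r1 * y) (r1 ^+ 2) 0 0 i psi).
Proof.
transitivity (\sum_(k < n.+1) \sum_(i < n.+1) if (k <= i)%N then
   awcoef q (2 * r1 * y) (r1 ^+ 2) (2 * r2 * z) (r2 ^+ 2) n i *
   (qbinom i k q * U q (2 * r1 * y) (r1 ^+ 2) 0 0 (i - k) * psi k) else 0).
  apply: eq_bigr => -[k ltkn] _ /=.
  rewrite (sum_ge_shift (fun i =>
    awcoef q (2 * r1 * y) (r1 ^+ 2) (2 * r2 * z) (r2 ^+ 2) n i *
    (qbinom i k q * U q (2 * r1 * y) (r1 ^+ 2) 0 0 (i - k) * psi k)))//.
  rewrite /c mulr_sumr mulr_suml; apply: eq_bigr => -[t lttn] _ /=.
  have [m mE] : exists m, n = (k + t + m)%N by exists (n - k - t)%N; lia.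
  have -> : (n - k = t + m)%N by rewrite mE -addnA addKn.
  rewrite /awcoef -g_scale -b_scale.
  have := @c_coefE k t m _ _ Hu HP; rewrite -mE addKn => E.
  rewrite (addKn k).
  have -> : (n - (k + t) = m)%N by lia.
  set Q1 := qpoch (r1 ^+ 2 * r2 ^+ 2 * q ^+ (n + (k + t)).-1) q m in E *.
  rewrite [RHS](_ : _ = (qbinom n (k + t) q * (qpoch (r1 ^+ 2 * q ^+ (k + t)) q m / Q1) * qbinom (k + t) k q)
    * (r2 ^+ m * r1 ^+ t * b t y q * g m z y (r1 * r2 * q ^+ n.-1) q * psi k)); last ring.
  by rewrite -E; ring.
rewrite exchange_big /=; apply: eq_bigr => -[i ltin] _ /=.
rewrite (sum_le_widen (fun k => awcoef q (2 * r1 * y) (r1 ^+ 2) (2 * r2 * z) (r2 ^+ 2) n i *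
   (qbinom i k q * U q (2 * r1 * y) (r1 ^+ 2) 0 0 (i - k) * psi k)))//.
by rewrite /conn mulr_sumr.
Qed.

(** The coefficient of alpha_j in p_l(x|y,rho1,q), as [awsum_cbar_src] confirms. Its last two
    factors resemble [awmom] at index l - j for the parameters (q^j a, q^j b). *)
Definition cbar_src j l := if (j <= l)%N then qbinom l j q *
  (qpoch (r1 ^+ 2 * q ^+ j) q (l - j) / qpoch (r1 ^+ 2 * r2 ^+ 2 * q ^+ (2 * j)) q (l - j)
   * mom_num q (2 * r1 * y * q ^+ j) (r1 ^+ 2 * q ^+ (2 * j)) (2 * r2 * z) (r2 ^+ 2) (l - j))
  else 0.

Lemma cbarE n j : (j <= n)%N -> cbar n j y r1 z r2 q =
  conn q 0 0 (2 * r1 * y) (r1 ^+ 2) n (cbar_src j).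
Proof.
move=> jn; transitivity (\sum_(l < n.+1) if (j <= l)%N then
   qbinom n l q * U q 0 0 (2 * r1 * y) (r1 ^+ 2) (n - l) * cbar_src j l else 0); last first.
  by apply: eq_bigr => l _; rewrite /cbar_src; case: (j <= l)%N; rewrite ?mulr0.
rewrite (sum_ge_shift (fun l => qbinom n l q * U q 0 0 (2 * r1 * y) (r1 ^+ 2) (n - l) * cbar_src j l))//.
rewrite /cbar mulr_sumr; apply: eq_bigr => -[t lttn] _ /=.
rewrite /cbar_src leq_addr addKn -h_scale.
have -> : mom_num q (2 * r1 * y * q ^+ j) (r1 ^+ 2 * q ^+ (2 * j)) (2 * r2 * z) (r2 ^+ 2) t =
  r2 ^+ t * p t z y (r1 * r2 * q ^+ j) q.
  by rewrite p_U U_scale /mom_num mul2n -addnn exprD; congr U; ring.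
have -> : (n - j - t = n - (j + t))%N by lia.
have E : qbinom n j q * qbinom (n - j) t q = qbinom n (j + t) q * qbinom (j + t) j q.
  rewrite /qbinom addKn subnDA; field; rewrite !qpochq_neq0//.
rewrite [RHS](_ : _ = (qbinom n (j + t) q * qbinom (j + t) j q) *
   (r1 ^+ (n - (j + t)) * r2 ^+ t * qpoch (r1 ^+ 2 * q ^+ j) q t /
     qpoch (r1 ^+ 2 * r2 ^+ 2 * q ^+ (2 * j)) q t * h (n - (j + t)) y q *
     p t z y (r1 * r2 * q ^+ j) q)); last ring.
by rewrite -E; ring.
Qed.

End Translate.

(** * The coefficient matrices are inverse to each other *)

Section Inverse.
Variables (K : closedFieldType) (q : K).
Hypothesis Hq : forall i, 1 - q ^+ i.+1 != 0.
Variables (y z r1 r2 : K).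
Hypothesis Hu : forall i, 1 - r1 ^+ 2 * r2 ^+ 2 * q ^+ i != 0.
Hypothesis HP : forall i, 1 - r1 ^+ 2 * q ^+ i != 0.

Lemma factor2 (sg de : K) : exists c d, c + d = sg /\ c * d = de.
Proof.
have [c] := @GRing.solve_monicpoly K 2 (fun i => if i == 0%N then - de else sg) isT.
rewrite !big_ord_recr big_ord0 /= expr0 => E; exists c, (sg - c); split; first ring.
by rewrite mulrBr -expr2 E; ring.
Qed.

(** Lowering the summation index by j replaces (a,b) by (q^j a, q^j b) and n by n - j. What remains
    is a multiple of the moment of alpha_{n-j}. *)
Lemma awsum_cbar_src n j : (j <= n)%N ->
  awsum q (2 * r1 * y) (r1 ^+ 2) (2 * r2 * z) (r2 ^+ 2) n (cbar_src q y z r1 r2 j)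
  = (n == j)%:R.
Proof.
move=> jn.
have [c [d [cdE cdE']]] := factor2 (2 * r2 * z) (r2 ^+ 2).
pose S N := awsum q (2 * r1 * y * q ^+ j) (r1 ^+ 2 * q ^+ (2 * j)) (2 * r2 * z) (r2 ^+ 2) N
   (awmom q (2 * r1 * y * q ^+ j) (r1 ^+ 2 * q ^+ (2 * j)) (2 * r2 * z) (r2 ^+ 2)).
have uE i : r1 ^+ 2 * q ^+ (2 * j) * r2 ^+ 2 * q ^+ i = r1 ^+ 2 * r2 ^+ 2 * q ^+ (2 * j + i).
  by rewrite exprD; ring.
have SE N : S N = (N == 0%N)%:R.
  case: N => [|N]; first by rewrite /S awsum0// awmom0.
  rewrite /S -cdE -cdE'; apply: awsum_awmom => // i; last by rewrite -mulrA -exprD.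
  by rewrite cdE' uE.
have [N nE] : exists N, n = (j + N)%N by exists (n - j)%N; rewrite subnKC.
have -> : (n == j) = (N == 0%N) by rewrite nE -[X in _ == X]addn0 eqn_add2l.
rewrite -SE; transitivity (\sum_(i < n.+1) if (j <= i)%N then
  awcoef q (2 * r1 * y) (r1 ^+ 2) (2 * r2 * z) (r2 ^+ 2) n i * cbar_src q y z r1 r2 j i else 0).
  by apply: eq_bigr => i _; rewrite /cbar_src; case: (j <= i)%N; rewrite ?mulr0.
rewrite (sum_ge_shift (fun i => awcoef q (2 * r1 * y) (r1 ^+ 2) (2 * r2 * z) (r2 ^+ 2) n i * cbar_src q y z r1 r2 j i))//.
have Pj i k : qpoch (r1 ^+ 2 * q ^+ i) q k != 0.
  by apply: qpoch_neq0 => i'; rewrite -mulrA -exprD.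
have uj i k : qpoch (r1 ^+ 2 * r2 ^+ 2 * q ^+ i) q k != 0.
  by apply: qpoch_neq0 => i'; rewrite -(mulrA (_ * _)) -exprD.
(* The symbols in P from [awcoef] and [cbar_src] combine to (P q^j)_N, those in [S N] to (P q^2j)_N.
   Neither depends on t, so their quotient comes out of the sum. *)
transitivity (qbinom n j q * qpoch (r1 ^+ 2 * q ^+ j) q N / qpoch (r1 ^+ 2 * q ^+ (2 * j)) q N * S N); last first.
  rewrite SE; case: (N) nE => [|N'] -> /=; last by rewrite !mulr0.
  by rewrite addn0 qbinomnn// !qpoch0 divr1 !mulr1.
rewrite /S mulr_sumr nE addKn; apply: eq_bigr => -[t lttN] _ /=.
rewrite /cbar_src leq_addr addKn /awcoef /awmom.
have [m mE] : exists m, N = (t + m)%N by exists (N - t)%N; rewrite subnKC.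
have -> : (j + N - (j + t) = m)%N by lia.
have -> : (N - t = m)%N by lia.
have -> : gam q (2 * r1 * y * q ^+ j) (r1 ^+ 2 * q ^+ (2 * j)) (2 * r2 * z) (r2 ^+ 2) N m
   = gam q (2 * r1 * y) (r1 ^+ 2) (2 * r2 * z) (r2 ^+ 2) (j + N) m.
  case: (m) mE => [//|m'] mE; rewrite /gam; have -> : (j + N).-1 = (j + N.-1)%N by lia.
  by congr U; rewrite exprD ?mul2n -?addnn ?exprD; ring.
rewrite uE -[r1 ^+ 2 * q ^+ (2 * j) * q ^+ t]mulrA -exprD.
set g := gam _ _ _ _ _ _ _; set w := mom_num _ _ _ _ _ _.
have -> : qpoch (r1 ^+ 2 * r2 ^+ 2 * q ^+ (2 * j + (N + t).-1)) q m =
   qpoch (r1 ^+ 2 * r2 ^+ 2 * q ^+ (j + N + (j + t)).-1) q m.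
  case: (m) mE => [|m'] mE; first by rewrite !qpoch0.
  by congr (qpoch (_ * q ^+ _)); lia.
have -> : r1 ^+ 2 * q ^+ (2 * j) * r2 ^+ 2 = r1 ^+ 2 * r2 ^+ 2 * q ^+ (2 * j) by ring.
have -> : qpoch (r1 ^+ 2 * q ^+ j) q N =
  qpoch (r1 ^+ 2 * q ^+ j) q t * qpoch (r1 ^+ 2 * q ^+ (j + t)) q m.
  by rewrite mE qpochD (exprD q j t) (mulrA (r1 ^+ 2)).
have -> : qpoch (r1 ^+ 2 * q ^+ (2 * j)) q N =
  qpoch (r1 ^+ 2 * q ^+ (2 * j)) q t * qpoch (r1 ^+ 2 * q ^+ (2 * j + t)) q m.
  by rewrite mE qpochD (exprD q (2 * j) t) (mulrA (r1 ^+ 2)).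
have E : qbinom (j + N) (j + t) q * qbinom (j + t) j q = qbinom (j + N) j q * qbinom N t q.
  rewrite /qbinom !addKn (_ : j + N - (j + t) = N - t)%N; last lia.
  by field; rewrite !qpochq_neq0.
set Q := qpoch _ q m in g w *.
rewrite [LHS](_ : _ = qbinom (j + N) (j + t) q * qbinom (j + t) j q *
  (Q / qpoch (r1 ^+ 2 * r2 ^+ 2 * q ^+ (j + N + (j + t)).-1) q m * g *
   (qpoch (r1 ^+ 2 * q ^+ j) q t / qpoch (r1 ^+ 2 * r2 ^+ 2 * q ^+ (2 * j)) q t * w))); last ring.
rewrite {}E; field; rewrite ?Pj ?uj//.
Qed.

(** The two changes of basis meeting in the middle cancel by [connK]. *)
Lemma c_cbar n j : \sum_(k < n.+1) c n k y r1 z r2 q *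
    conn q 0 0 (2 * r1 * y) (r1 ^+ 2) k (cbar_src q y z r1 r2 j) = (n == j)%:R.
Proof.
have E := c_awsum Hq y z Hu HP n (fun k => conn q 0 0 (2 * r1 * y) (r1 ^+ 2) k
  (cbar_src q y z r1 r2 j)); cbv beta in E; rewrite {}E; transitivity (awsum q (2 * r1 * y) (r1 ^+ 2) (2 * r2 * z) (r2 ^+ 2) n
    (cbar_src q y z r1 r2 j)).
  by apply: eq_bigr => i _; rewrite connK.
have [jn|nj] := leqP j n; first exact: awsum_cbar_src.
rewrite ltn_eqF//= /awsum big1// => i _.
by rewrite /cbar_src leqNgt (leq_ltn_trans _ nj) ?mulr0// -ltnS.
Qed.

Lemma sum_c_cbar n : (0 < n)%N ->
  \sum_(k < n.+1) c n k y r1 z r2 q * cbar k 0 y r1 z r2 q = 0.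
Proof.
move=> n0; under eq_bigr do rewrite cbarE//.
by rewrite c_cbar; case: n n0.
Qed.

(** For finite square matrices a right inverse is a left inverse. [A] is cut off above the diagonal,
    where the formula for [c] has no meaning. *)
Lemma sum_cbar_c n : (0 < n)%N ->
  \sum_(k < n.+1) cbar n k y r1 z r2 q * c k 0 y r1 z r2 q = 0.
Proof.
move=> n0.
pose A := \matrix_(i < n.+1, k < n.+1) if (k <= i)%N then c i k y r1 z r2 q else 0.
pose B := \matrix_(k < n.+1, j < n.+1)
  conn q 0 0 (2 * r1 * y) (r1 ^+ 2) k (cbar_src q y z r1 r2 j).
have AB : A *m B = 1%:M.
  apply/matrixP => i j; rewrite !mxE -[RHS](c_cbar i j).
  pose F k := c i k y r1 z r2 q * conn q 0 0 (2 * r1 * y) (r1 ^+ 2) k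
     (cbar_src q y z r1 r2 j).
  have lein : (i <= n)%N by rewrite -ltnS.
  refine (etrans _ (sum_le_widen F lein)).
  by apply: eq_bigr => k _; rewrite !mxE /F; case: (k <= i)%N; rewrite ?mul0r.
have /matrixP/(_ ord_max ord0) := mulmx1C AB; rewrite !mxE /=.
rewrite -val_eqE /= gtn_eqF// => E; refine (etrans _ E); apply: eq_bigr => k _.
by rewrite !mxE /= cbarE// -ltnS.
Qed.
End Inverse.

(** * Telescoping of the partial sums *)

Section Partial.
Variables (K : fieldType) (q : K).
Hypothesis Hq : forall i, 1 - q ^+ i.+1 != 0.
Variables (s P c d u : K).
Hypothesis uE : u = P * (c * d).
Hypothesis Hu : forall i, 1 - u * q ^+ i != 0.
Hypothesis HP : forall i, 1 - P * q ^+ i != 0.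
Implicit Types (x : K) (n N : nat).

Definition hermc x n := U q 0 0 (2 * x) 1 n / qpoch q q n.

(** The moment functional applied to h_n, which [conn] expands in the p_j. *)
Definition ubar s P sg de n := conn q 0 0 s P n (awmom q s P sg de).

Lemma hermc_rec x n : 2 * x * hermc x n = (1 - q ^+ n.+1) * hermc x n.+1
  + (if n is k.+1 then hermc x k else 0).
Proof.
rewrite /hermc; case: n => [|n].
  by rewrite qpochSr qpoch0 /=; field; rewrite -(expr1 q) Hq oner_neq0.
rewrite U_rec !qpochSr -!exprS; field.
by rewrite !Hq qpochq_neq0.
Qed.

Lemma ubar_shift n :
  (1 + c ^+ 2) * ubar s P (c + d) (c * d) n
  - c * (ubar s P (c + d) (c * d) n.+1
     + (if n is k.+1 then (1 - q ^+ n) * ubar s P (c + d) (c * d) k else 0))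
  = shift_const s P c d u * ubar s P (q * c + d) (q * (c * d)) n.
Proof.
set mo := awmom q s P (c + d) (c * d).
have E : ubar s P (c + d) (c * d) n.+1
     + (if n is k.+1 then (1 - q ^+ n) * ubar s P (c + d) (c * d) k else 0) =
   conn q 0 0 s P n (jac q s P mo).
  by rewrite conn_jac// /ubar -/mo; case: (n) => [|k]; ring.
rewrite E /ubar /conn !mulr_sumr -sumrB; apply: eq_bigr => j _.
rewrite (mulrCA (shift_const _ _ _ _ _)) -(awmom_shift s uE Hu HP) -/mo /jac.
by case: (j : nat) => [|i]; ring.
Qed.

(** Of Christoffel-Darboux type: multiplication by 2x acts on [hermc] and on [ubar] by transposed
    three-term recurrences, so the interior terms cancel. *)
Lemma herm_partial x N :
  (1 - 2 * c * x + c ^+ 2) * \sum_(n < N.+1) hermc x n * ubar s P (c + d) (c * d) n =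
  shift_const s P c d u *
    \sum_(n < N.+1) hermc x n * ubar s P (q * c + d) (q * (c * d)) n
  + c * (hermc x N * ubar s P (c + d) (c * d) N.+1
         - (1 - q ^+ N.+1) * hermc x N.+1 * ubar s P (c + d) (c * d) N).
Proof.
set f := ubar s P (c + d) (c * d).
have step n : (1 - 2 * c * x + c ^+ 2) * (hermc x n * f n) = 
    shift_const s P c d u * (hermc x n * ubar s P (q * c + d) (q * (c * d)) n)
    + c * (hermc x n * f n.+1 - (1 - q ^+ n.+1) * hermc x n.+1 * f n)
    - (if n is k.+1 then c * (hermc x k * f n - (1 - q ^+ n) * hermc x n * f k) else 0).
  rewrite (mulrCA (shift_const s P c d u)) -ubar_shift -/f.
  transitivity ((1 + c ^+ 2) * hermc x n * f n - c * (2 * x * hermc x n) * f n); first ring.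
  by rewrite hermc_rec; case: n => [|n]; ring.
elim: N => [|N IH].
  by rewrite !big_ord_recr !big_ord0 /= !add0r step /= subr0.
rewrite big_ord_recr [in RHS]big_ord_recr /= !mulrDr IH step /=.
ring.
Qed.

Definition lin_prod s P c n := \prod_(j < n) (1 - c * s * q ^+ j + c ^+ 2 * P * (q ^+ j) ^+ 2).

(* The reciprocal of the square norm of alpha_n; [lin_prod s P c n] is (ac,bc)_n. *)
Definition inv_norm s P c d n := qpoch (P * (c * d)) q (2 * n)
  * qpoch (P * (c * d) * q ^+ n.-1) q n
  / (qpoch q q n * qpoch P q n * qpoch (c * d) q n
     * (lin_prod s P c n * lin_prod s P d n)).

Hypothesis Hcd : forall i, 1 - c * d * q ^+ i != 0.
Hypothesis Hc : forall i, 1 - c * s * q ^+ i + c ^+ 2 * P * (q ^+ i) ^+ 2 != 0.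
Hypothesis Hd : forall i, 1 - d * s * q ^+ i + d ^+ 2 * P * (q ^+ i) ^+ 2 != 0.

Lemma lin_prodSr a n : lin_prod s P a n.+1 =
  lin_prod s P a n * (1 - a * s * q ^+ n + a ^+ 2 * P * (q ^+ n) ^+ 2).
Proof. by rewrite /lin_prod big_ord_recr. Qed.

Lemma lin_prod_shift a n :
  (1 - a * s + a ^+ 2 * P) * lin_prod s P (q * a) n = lin_prod s P a n.+1.
Proof.
rewrite /lin_prod big_ord_recl /= expr0 expr1n !mulr1; congr (_ * _).
by apply: eq_bigr => i _; rewrite /bump /= (exprS q); ring.
Qed.

Lemma qpoch_shift a n : 1 - a != 0 ->
  qpoch (a * q) q n = qpoch a q n * (1 - a * q ^+ n) / (1 - a).
Proof. by move=> a0; rewrite -qpochSr qpochSl; field. Qed.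

(** Together with [inv_norm_shift] this makes the relations [awsum_rise] and [awsum_shift] adjoint
    with respect to the norms at (a,b,qc,d) and (a,b,c,d). *)
Lemma inv_norm_rise n :
  rise_const q s P c d u n * inv_norm s P (q * c) d n =
  shift_const s P c d u * inv_norm s P c d n.
Proof.
have u0 : 1 - u != 0 by have := Hu 0; rewrite expr0 mulr1.
have cd0 : 1 - c * d != 0 by have := Hcd 0; rewrite expr0 mulr1.
have c0 : 1 - c * s + c ^+ 2 * P != 0.
  by have := Hc 0; rewrite expr0 expr1n !mulr1.
have W0 m : lin_prod s P c m != 0 by apply/prodf_neq0.
have W1 m : lin_prod s P d m != 0 by apply/prodf_neq0.
have uqE : P * (q * c * d) = u * q by rewrite uE; ring.
have cdqE : q * c * d = c * d * q by ring.
rewrite /inv_norm uqE -uE.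
have -> : lin_prod s P (q * c) n = lin_prod s P c n.+1 / (1 - c * s + c ^+ 2 * P).
  by rewrite -lin_prod_shift [RHS]mulrC mulKf.
case: n => [|n].
  rewrite muln0 !qpoch0 /rise_const /= lin_prodSr /lin_prod !big_ord0 expr0 expr1n !mulr1 mul1r.
  by field; rewrite c0 ?oner_neq0.
have E : qpoch (u * q * q ^+ n) q n.+1 = qpoch (u * q ^+ n) q n.+1 *
    (1 - u * (q ^+ n.+1 * q ^+ n)) / (1 - u * q ^+ n).
  by rewrite mulrAC qpoch_shift//; congr (_ * (1 - _) / _); rewrite -mulrA mulrC [RHS]mulrC; ring.
rewrite -!pred_Sn {}E cdqE !qpoch_shift// lin_prodSr /rise_const /shift_const.
rewrite (_ : q ^+ (2 * n.+1) = q ^+ n.+1 * q ^+ n.+1); last by rewrite -exprD mul2n -addnn.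
have h1 := Hu n; have h2 := Hu (n.+1 + n); have h3 := Hu (n.+1 + n.+1).
rewrite !exprD in h2 h3.
have h4 := Hcd n.+1; have h5 := Hc n.+1.
have h6 := qpochq_neq0 Hq n.+1.
have h7 : qpoch P q n.+1 != 0 by apply: qpoch_neq0.
have h8 : qpoch (c * d) q n.+1 != 0 by apply: qpoch_neq0.
have h9 := W0 n.+1; have h10 := W1 n.+1.
by field; rewrite h1 h2 h3 h4 h5 h6 h7 h8 h9 h10 u0 cd0 c0.
Qed.

Lemma inv_norm_shift n :
  - c * inv_norm s P (q * c) d n =
  shift_const s P c d u * lower_const q s P c d u n * inv_norm s P c d n.+1.
Proof.
have u0 : 1 - u != 0 by have := Hu 0; rewrite expr0 mulr1.
have cd0 : 1 - c * d != 0 by have := Hcd 0; rewrite expr0 mulr1.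
have c0 : 1 - c * s + c ^+ 2 * P != 0.
  by have := Hc 0; rewrite expr0 expr1n !mulr1.
have W0 : lin_prod s P (q * c) n != 0.
  by have := lin_prod_shift c n; apply: contra_eq_neq => ->; rewrite mulr0 eq_sym; apply/prodf_neq0.
have W1 m : lin_prod s P d m != 0 by apply/prodf_neq0.
have uqE : P * (q * c * d) = u * q by rewrite uE; ring.
have cdqE : q * c * d = c * d * q by ring.
rewrite /inv_norm uqE -uE -pred_Sn cdqE -lin_prod_shift lin_prodSr.
have -> : qpoch (u * q * q ^+ n.-1) q n = qpoch (u * q ^+ n) q n.
  by case: n {W0} => [|n]; rewrite ?qpoch0// exprS mulrA.
have -> : qpoch u q (2 * n.+1) = (1 - u) * qpoch (u * q) q (2 * n)
    * (1 - u * (q ^+ n * q ^+ n.+1)).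
  rewrite mulnS !addSn add0n qpochSr qpochSl; congr (_ * (1 - _ * _)).
  by rewrite -exprD mul2n -addnn addnS.
rewrite (qpochSl _ (c * d)) (qpochSr _ q) -exprS (qpochSr _ P) (qpochSr _ (u * _)) -(mulrA u).
rewrite /lower_const /shift_const.
have h1 := Hu (n + n); have h2 := Hu (n + n.+1); have h3 := HP n.
rewrite !exprD in h1 h2.
have h4 := Hq n; have h5 := Hd n.
have h6 := qpochq_neq0 Hq n.
have h7 : qpoch P q n != 0 by apply: qpoch_neq0.
have h8 : qpoch (c * d * q) q n != 0 by apply: qpoch_neq0 => i; rewrite -mulrA -exprS.
have h9 := W1 n.
by field; rewrite h1 h2 h3 h4 h5 h6 h7 h8 h9 W0 u0 cd0 c0.
Qed.

(** The coefficient of h_0 in alpha_n, see [c_n0_bsum]. *)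
Definition bsum s P sg de n := awsum q s P sg de n (U q s P 0 0).
Definition awpoly s P sg de x n := awsum q s P sg de n (U q s P (2 * x) 1).

(** [awsum_rise] is applied to the polynomial and [awsum_shift] to the coefficient; by adjointness
    the products of neighbouring indices cancel. *)
Lemma aw_partial x N :
  (1 - 2 * c * x + c ^+ 2) *
   \sum_(n < N.+1) inv_norm s P (q * c) d n * bsum s P (q * c + d) (q * (c * d)) n
      * awpoly s P (q * c + d) (q * (c * d)) x n =
  shift_const s P c d u *
   \sum_(n < N.+1) inv_norm s P c d n * bsum s P (c + d) (c * d) n
      * awpoly s P (c + d) (c * d) x n
  - c * inv_norm s P (q * c) d N * bsum s P (q * c + d) (q * (c * d)) N
      * awpoly s P (c + d) (c * d) x N.+1.
Proof.
have rise n : (1 - 2 * c * x + c ^+ 2) * awpoly s P (q * c + d) (q * (c * d)) x n =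
   - c * awpoly s P (c + d) (c * d) x n.+1
  + rise_const q s P c d u n * awpoly s P (c + d) (c * d) x n.
  rewrite -(awsum_rise Hq s uE Hu) mulr_sumr; apply: eq_bigr => j _.
  have J := jacU q s P (2 * x) j; rewrite /shift_op mulrCA; congr (_ * _).
  transitivity ((1 + c ^+ 2) * U q s P (2 * x) 1 j - c * (2 * x * U q s P (2 * x) 1 j)); first ring.
  by rewrite -J /jac; case: (j : nat) => [|i]; ring.
have step n : (1 - 2 * c * x + c ^+ 2) *
    (inv_norm s P (q * c) d n.+1 * bsum s P (q * c + d) (q * (c * d)) n.+1
      * awpoly s P (q * c + d) (q * (c * d)) x n.+1) =
    shift_const s P c d u * (inv_norm s P c d n.+1 * bsum s P (c + d) (c * d) n.+1
      * awpoly s P (c + d) (c * d) x n.+1)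
    - c * inv_norm s P (q * c) d n.+1 * bsum s P (q * c + d) (q * (c * d)) n.+1
      * awpoly s P (c + d) (c * d) x n.+2
    + c * inv_norm s P (q * c) d n * bsum s P (q * c + d) (q * (c * d)) n
      * awpoly s P (c + d) (c * d) x n.+1.
  rewrite mulrCA rise /bsum (awsum_shift Hq _ uE Hu).
  set B' := awsum _ _ _ _ _ n.+1 _; set B := awsum _ _ _ _ _ n _.
  set A1 := awpoly _ _ _ _ _ n.+1; set A2 := awpoly _ _ _ _ _ n.+2.
  transitivity ((rise_const q s P c d u n.+1 * inv_norm s P (q * c) d n.+1) * B' * A1
     - c * inv_norm s P (q * c) d n.+1 * B' * A2); first ring.
  rewrite inv_norm_rise.
  transitivity (shift_const s P c d u * inv_norm s P c d n.+1 * B' * A1 -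
     c * inv_norm s P (q * c) d n.+1 * B' * A2 +
     ((shift_const s P c d u * lower_const q s P c d u n * inv_norm s P c d n.+1) * B * A1
      + c * inv_norm s P (q * c) d n * B * A1)); last ring.
  by rewrite -inv_norm_shift; ring.
elim: N => [|N IH]; last first.
  rewrite big_ord_recr [in RHS]big_ord_recr /= !mulrDr IH step.
  ring.
rewrite !big_ord_recr !big_ord0 /= !add0r mulrCA rise.
have := inv_norm_rise 0; set a := rise_const _ _ _ _ _ _ _; move=> E.
transitivity ((a * inv_norm s P (q * c) d 0) * bsum s P (q * c + d) (q * (c * d)) 0 * awpoly s P (c + d) (c * d) x 0
  - c * inv_norm s P (q * c) d 0 * bsum s P (q * c + d) (q * (c * d)) 0 *
  awpoly s P (c + d) (c * d) x 1); first ring.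
by rewrite E /bsum !awsum0//; ring.
Qed.
End Partial.

(** * Dominated convergence of complex series *)

Section Modulus.
Variable R : realType.
Local Notation C := (cplx R).
Implicit Types (x y a b : C) (u v : nat -> C).

(** The norm of [C] has values in [C]; this copy in [R] gives access to real analysis and to
    [lra]. *)
Definition nm (x : C) : R := complex.Re `|x|.

Lemma nmE x : `|x| = (nm x)%:C%C.
Proof. by rewrite /nm normc_def. Qed.

Lemma lerC (r t : R) : (r%:C%C <= t%:C%C :> C) = (r <= t).
Proof. by rewrite lecR. Qed.

Lemma ltrC (r t : R) : (r%:C%C < t%:C%C :> C) = (r < t).
Proof. by rewrite ltcR. Qed.

Lemma nm_ge0 x : 0 <= nm x.
Proof. by rewrite -lerC -nmE; exact: normr_ge0. Qed.

Lemma nmM x y : nm (x * y) = nm x * nm y.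
Proof. by apply: (@complexI R); rewrite rmorphM/= -!nmE normrM. Qed.

Lemma nmD x y : nm (x + y) <= nm x + nm y.
Proof. by rewrite -lerC rmorphD/= -!nmE ler_normD. Qed.

Lemma nmN x : nm (- x) = nm x.
Proof. by apply: (@complexI R); rewrite -!nmE normrN. Qed.

Lemma nmB x y : nm (x - y) <= nm x + nm y.
Proof. by rewrite (le_trans (nmD _ _))// nmN. Qed.

Lemma nm_dist x y : nm (x - y) = nm (y - x).
Proof. by rewrite -nmN opprB. Qed.

Lemma nm0 : nm 0 = 0.
Proof. by apply: (@complexI R); rewrite -nmE normr0. Qed.

Lemma nm1 : nm 1 = 1.
Proof. by apply: (@complexI R); rewrite -nmE normr1. Qed.

Lemma nm_eq0 x : (nm x == 0) = (x == 0).
Proof. by rewrite -(normr_eq0 x) nmE -(inj_eq (@complexI R)). Qed.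

Lemma nm_gt0 x : (0 < nm x) = (x != 0).
Proof. by rewrite lt_def nm_ge0 andbT nm_eq0. Qed.

Lemma nmV x : nm x^-1 = (nm x)^-1.
Proof. by apply: (@complexI R); rewrite fmorphV/= -!nmE normfV. Qed.

Lemma nmX x n : nm (x ^+ n) = nm x ^+ n.
Proof. by apply: (@complexI R); rewrite rmorphXn/= -!nmE normrX. Qed.

Lemma nm_prod n u : nm (\prod_(j < n) u j) = \prod_(j < n) nm (u j).
Proof. by rewrite (big_morph nm nmM nm1). Qed.

Lemma nm_sum n u : nm (\sum_(j < n) u j) <= \sum_(j < n) nm (u j).
Proof.
elim: n => [|n IH]; first by rewrite !big_ord0 nm0.
by rewrite !big_ord_recr (le_trans (nmD _ _))//= lerD2r.
Qed.

Lemma nm_real (r : R) : nm r%:C%C = `|r|.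
Proof. by rewrite /nm normc_def /= expr0n addr0 sqrtr_sqr. Qed.

Lemma nm_lt1 x : (`|x| < 1) = (nm x < 1).
Proof. by rewrite nmE -ltrC. Qed.

Lemma nm_Re x : `|complex.Re x| <= nm x.
Proof. by rewrite -lerC -nmE; exact: normc_ge_Re. Qed.

Lemma nm_Im x : `|complex.Im x| <= nm x.
Proof.
rewrite /nm normc_def /= -sqrtr_sqr ler_sqrt ?lerDr ?sqr_ge0//.
by rewrite addr_ge0 ?sqr_ge0.
Qed.

Lemma cvg_nm u a : u @ \oo --> a <-> forall e : R, 0 < e ->
  \forall n \near \oo, nm (u n - a) < e.
Proof.
split=> [/cvgrPdist_lt ua e e0|H].
  have /ua : 0 < e%:C%C :> C by rewrite ltrC.
  by apply: filterS => n; rewrite nmE ltrC nm_dist.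
apply/cvgrPdist_lt => e e0.
(* A positive element of [C] is real, because the order compares only numbers with equal imaginary
   parts. *)
have eE : e = (complex.Re e)%:C%C.
  by case: (e) e0 => r i; rewrite ltcE /= => /andP[/eqP ->].
have /H : 0 < complex.Re e by rewrite -ltrC -eE.
by apply: filterS => n; rewrite eE nmE ltrC nm_dist.
Qed.

Lemma cvg_nm_dom u a (f : nat -> R) : f @ \oo --> (0 : R) ->
  (forall n, nm (u n - a) <= f n) -> u @ \oo --> a.
Proof.
move=> /cvgrPdist_lt f0 uf; apply/cvg_nm => e /f0.
apply: filterS => n; rewrite sub0r normrN; apply: le_lt_trans.
by rewrite (le_trans (uf n))// ler_norm.
Qed.

Lemma cvg_real (f : nat -> R) (r : R) : f @ \oo --> r ->
  (fun n => (f n)%:C%C : C) @ \oo --> (r%:C%C : C).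
Proof.
move=> /cvgrPdist_lt fr; apply/cvg_nm => e /fr; apply: filterS => n.
by rewrite -rmorphB nm_real distrC.
Qed.

Lemma cvg_sumn (I : Type) (s : seq I) (f : nat -> I -> C) (g : I -> C) :
  (forall i, f ^~ i @ \oo --> g i) ->
  (fun n => \sum_(i <- s) f n i) @ \oo --> \sum_(i <- s) g i.
Proof.
move=> fg; elim: s => [|i s IH].
  by under eq_fun do rewrite big_nil; rewrite big_nil; exact: cvg_cst.
under eq_fun do rewrite big_cons.
by rewrite big_cons; exact: (cvgD (fg i) IH).
Qed.

Lemma cvg_prodn (I : Type) (s : seq I) (f : nat -> I -> C) (g : I -> C) :
  (forall i, f ^~ i @ \oo --> g i) ->
  (fun n => \prod_(i <- s) f n i) @ \oo --> \prod_(i <- s) g i.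
Proof.
move=> fg; elim: s => [|i s IH].
  by under eq_fun do rewrite big_nil; rewrite big_nil; exact: cvg_cst.
under eq_fun do rewrite big_cons.
by rewrite big_cons; exact: (cvgM (fg i) IH).
Qed.

Lemma cvg_pow x : nm x < 1 -> (fun n => x ^+ n) @ \oo --> (0 : C).
Proof.
move=> x1; apply: (@cvg_nm_dom _ _ (fun n => nm x ^+ n)).
  by apply: cvg_expr; rewrite ger0_norm ?nm_ge0.
by move=> n; rewrite subr0 nmX.
Qed.

Lemma cvg_shift1 u a : u @ \oo --> a -> (fun n => u n.+1) @ \oo --> a.
Proof. by move=> ua; rewrite (cvg_shiftS u). Qed.

Lemma cvg_double u a : u @ \oo --> a -> (fun n => u (2 * n)%N) @ \oo --> a.
Proof.
move=> /cvg_nm ua; apply/cvg_nm => e /ua [N _ H]; exists N => // n Nn.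
by apply: H => /=; rewrite (leq_trans Nn)// mul2n -addnn leq_addr.
Qed.

Lemma geo_tail (A r : R) m n : 0 <= r < 1 -> 0 <= A ->
  \sum_(m <= j < m + n) A * r ^+ j <= A * r ^+ m / (1 - r).
Proof.
move=> /andP[r0 r1] A0; have r1' : 0 < 1 - r by rewrite subr_gt0.
rewrite -mulr_sumr -mulrA ler_wpM2l// ler_pdivlMr//.
suff -> : (\sum_(m <= j < m + n) r ^+ j) * (1 - r) = r ^+ m - r ^+ (m + n).
  by rewrite lerBlDr lerDl exprn_ge0.
elim: n => [|n IH]; first by rewrite addn0 big_geq// mul0r subrr.
by rewrite addnS big_nat_recr ?leq_addr//= mulrDl IH exprS; ring.
Qed.

Lemma nm_series_dist (A r : R) u : 0 <= r < 1 -> 0 <= A ->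
  (forall n, nm (u n) <= A * r ^+ n) ->
  forall m n, (m <= n)%N -> nm (series u n - series u m) <= A * r ^+ m / (1 - r).
Proof.
move=> r01 A0 ur m n mn; rewrite sub_series_geq//.
rewrite -{1}(subnKC mn) (le_trans _ (geo_tail m (n - m) r01 A0))//.
elim: (n - m)%N => [|k IH]; first by rewrite addn0 !big_geq ?nm0.
by rewrite addnS !big_nat_recr ?leq_addr//= (le_trans (nmD _ _))// lerD.
Qed.

Lemma cvg_complex u (a : R) (b : R) :
  (fun n => complex.Re (u n)) @ \oo --> a -> (fun n => complex.Im (u n)) @ \oo --> b ->
  u @ \oo --> ((a +i* b)%C : C).
Proof.
move=> ua ub.
have -> : u = (fun n => (complex.Re (u n))%:C%C + (complex.Im (u n))%:C%C * 'i%C).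
  by apply/funext => n; rewrite [LHS]complexE mulrC.
have -> : (a +i* b)%C = a%:C%C + b%:C%C * 'i%C :> C by rewrite [LHS]complexE /= mulrC.
by apply: cvgD; [exact: cvg_real|apply: cvgM; [exact: cvg_real|exact: cvg_cst]].
Qed.

Lemma geo_cvg (A r : R) u : 0 <= r < 1 -> 0 <= A ->
  (forall n, nm (u n) <= A * r ^+ n) -> cvgn (series u).
Proof.
move=> /andP[r0 r1] A0 ur.
have dom (f : nat -> R) : (forall n, `|f n| <= A * r ^+ n) -> cvgn (series f).
  move=> fr; apply: normed_cvg; apply: (series_le_cvg _ _ fr).
  - by move=> n; exact: normr_ge0.
  - by move=> n; rewrite mulr_ge0 ?exprn_ge0.
  - by apply: is_cvg_geometric_series; rewrite ger0_norm.
have [a Ha] : exists a : R, series (fun n => complex.Re (u n)) @ \oo --> a.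
  by apply/cvg_ex; apply: dom => n; apply: le_trans (nm_Re _) (ur n).
have [b Hb] : exists b : R, series (fun n => complex.Im (u n)) @ \oo --> b.
  by apply/cvg_ex; apply: dom => n; apply: le_trans (nm_Im _) (ur n).
apply/cvg_ex; exists ((a +i* b)%C : C); apply: cvg_complex.
- rewrite (_ : (fun n => _) = series (fun n => complex.Re (u n)))//.
  by apply/funext => n; rewrite /series /= (big_morph _ (id1 := 0) (op1 := +%R) (@raddfD _ _ (@complex.Re R))).
- rewrite (_ : (fun n => _) = series (fun n => complex.Im (u n)))//.
  by apply/funext => n; rewrite /series /= raddf_sum.
Qed.

Lemma geo_lim_dist (A r : R) u a : 0 <= r < 1 -> 0 <= A ->
  (forall n, nm (u n) <= A * r ^+ n) -> series u @ \oo --> a ->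
  forall m, nm (a - series u m) <= A * r ^+ m / (1 - r).
Proof.
move=> r01 A0 ur ua m; apply/ler_addgt0Pr => e e0.
move/cvg_nm: ua => /(_ e e0) [N _ /(_ (maxn N m) (leq_maxl _ _))] H.
have := nm_series_dist r01 A0 ur (leq_maxr N m).
have := nmD (a - series u (maxn N m)) (series u (maxn N m) - series u m).
rewrite addrA subrK nm_dist in H *; move: H; set t := nm _; lra.
Qed.

(** The common geometric majorant makes the tails of both series smaller than e/3 beyond one index
    m; below m only finitely many limits are involved. *)
Lemma tannery (A r : R) (f : nat -> nat -> C) (g : nat -> C) (F : nat -> C) (G : C) :
  0 <= r < 1 -> 0 <= A ->
  (forall N n, nm (f N n) <= A * r ^+ n) ->
  (forall n, f ^~ n @ \oo --> g n) ->
  (forall N, series (f N) @ \oo --> F N) ->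
  series g @ \oo --> G ->
  F @ \oo --> G.
Proof.
move=> r01 A0 fr fg fF gG.
have gr n : nm (g n) <= A * r ^+ n.
  apply/ler_addgt0Pr => e e0; move/cvg_nm: (fg n) => /(_ e e0) [N _ /(_ N (leqnn _))] /= H.
  have := nmD (g n - f N n) (f N n); rewrite subrK nm_dist.
  have := fr N n; lra.
apply/cvg_nm => e e0.
have [m Hm] : exists m, A * r ^+ m / (1 - r) < e / 3.
  have /andP[r0 r1] := r01.
  have : (fun m => A / (1 - r) * r ^+ m) @ \oo --> (0 : R).
    rewrite -(mulr0 (A / (1 - r))); apply: cvgM; first exact: cvg_cst.
    by apply: cvg_expr; rewrite ger0_norm.
  move=> /cvgrPdist_lt /(_ (e / 3)); have e3 : 0 < e / 3 by rewrite divr_gt0.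
  move=> /(_ e3) [N _ /(_ N (leqnn _))] /=; rewrite sub0r normrN => /(le_lt_trans (ler_norm _)) H.
  by exists N; rewrite mulrAC.
have : (fun N => series (f N) m) @ \oo --> series g m by exact: cvg_sumn.
move=> /cvg_nm /(_ (e / 3)); have e3 : 0 < e / 3 by rewrite divr_gt0.
move=> /(_ e3); apply: filterS => N H.
have h1 := geo_lim_dist r01 A0 (fr N) (fF N) m.
have h2 := geo_lim_dist r01 A0 gr gG m.
have h3 := nmD (F N - series (f N) m) ((series (f N) m - series g m) - (G - series g m)).
have h4 := nmB (series (f N) m - series g m) (G - series g m).
rewrite (_ : F N - _ + _ = F N - G) in h3; last by ring.
move: h1 h2 h3 h4 H Hm; lra.
Qed.

End Modulus.

(** * Infinite products and growth of perturbed recurrences *)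

Section Products.
Variable R : realType.
Local Notation C := (cplx R).
Implicit Types (x y a b : C) (u v : nat -> C).

Lemma pow_small (k e : R) : 0 <= k < 1 -> 0 < e -> exists J, forall j, (J <= j)%N -> k ^+ j < e.
Proof.
move=> /andP[k0 k1] e0; have : (fun n => k ^+ n) @ \oo --> (0 : R).
  by apply: cvg_expr; rewrite ger0_norm.
move=> /cvgrPdist_lt /(_ e e0) [N _ H]; exists N => j /H /=.
by rewrite sub0r normrN; apply: le_lt_trans; exact: ler_norm.
Qed.

Lemma prod_le_exp (A k : R) u : 0 <= k < 1 -> 0 <= A ->
  (forall j, nm (u j - 1) <= A * k ^+ j) ->
  forall n, nm (\prod_(j < n) u j) <= expR (A / (1 - k)).
Proof.
move=> k01 A0 H n; rewrite nm_prod.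
have /andP[k0 k1] := k01.
apply: (@le_trans _ _ (expR (\sum_(0 <= j < 0 + n) A * k ^+ j))); last first.
  by rewrite ler_expR (le_trans (geo_tail 0 n k01 A0))// expr0 mulr1.
rewrite add0n big_mkord; elim: n => [|n IH]; first by rewrite !big_ord0 expR0.
rewrite !big_ord_recr /= expRD ler_pM ?prodr_ge0 ?nm_ge0//.
  by move=> i _; exact: nm_ge0.
rewrite (le_trans _ (expR_ge1Dx _))//.
by have := nmD 1 (u n - 1); rewrite addrC subrK nm1 => /le_trans; apply; rewrite lerD2l.
Qed.

(** The differences of successive partial products form the series [v], geometrically dominated
    thanks to [prod_le_exp]. *)
Lemma prod_cvg (A k : R) u : 0 <= k < 1 -> 0 <= A ->
  (forall j, nm (u j - 1) <= A * k ^+ j) ->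
  cvgn (fun n => \prod_(j < n) u j).
Proof.
move=> k01 A0 H; pose v n := \prod_(j < n) u j * (u n - 1).
have E n : \prod_(j < n) u j = 1 + series v n.
  elim: n => [|n IH]; first by rewrite big_ord0 /series /= big_geq// addr0.
  have -> : series v n.+1 = series v n + v n by rewrite /series /= big_nat_recr.
  by rewrite big_ord_recr /= /v IH; ring.
have : cvgn (series v).
  apply: (@geo_cvg _ (expR (A / (1 - k)) * A) k) => //.
    by rewrite mulr_ge0 ?expR_ge0.
  move=> n; rewrite nmM -mulrA ler_pM ?nm_ge0//.
  exact: (@prod_le_exp A k).
move=> /cvg_ex[l Hl]; apply/cvg_ex; exists (1 + l).
under eq_fun do rewrite E.
exact: (cvgD (@cvg_cst _ _ _ _ _) Hl).
Qed.

(** From some J on the factors have modulus at least 1/2; the finitely many earlier ones are paid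
    for by the sum in the constant. *)
Lemma inv_dom (A k : R) u : 0 < k < 1 -> 0 <= A ->
  (forall j, nm (u j - 1) <= A * k ^+ j) -> (forall j, u j != 0) ->
  exists2 B : R, 0 <= B & forall j, nm ((u j)^-1 - 1) <= B * k ^+ j.
Proof.
move=> /andP[k0 k1] A0 H u0.
have [J HJ] : exists J, forall j, (J <= j)%N -> A * k ^+ j <= 1 / 2.
  have [J HJ] := @pow_small k (1 / (2 * (A + 1))) ltac:(by rewrite ltW//=) ltac:(by rewrite divr_gt0// mulr_gt0// ltr_wpDl).
  exists J => j /HJ; rewrite ltr_pdivlMr ?mulr_gt0 ?ltr_wpDl// => h.
  have := exprn_ge0 j (ltW k0); move: h; set t := k ^+ j; nra.
have S0 : 0 <= \sum_(j < J) nm ((u j)^-1 - 1) / k ^+ j.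
  by apply: sumr_ge0 => i _; rewrite divr_ge0 ?nm_ge0 ?exprn_ge0// ltW.
exists (2 * A + \sum_(j < J) nm ((u j)^-1 - 1) / k ^+ j).
  by rewrite addr_ge0// mulr_ge0.
move=> j; have kj : 0 < k ^+ j by rewrite exprn_gt0.
have [jJ|Jj] := ltnP j J.
  rewrite -ler_pdivrMr// (bigD1 (Ordinal jJ))//= addrCA lerDl addr_ge0 ?mulr_ge0//.
  by apply: sumr_ge0 => i _; rewrite divr_ge0 ?nm_ge0 ?exprn_ge0// ltW.
have -> : (u j)^-1 - 1 = (1 - u j) / u j by rewrite mulrBl mul1r divff.
have uj : 1 / 2 <= nm (u j).
  have := nmD (u j) (1 - u j); rewrite addrC subrK nm1 nm_dist.
  have := HJ _ Jj; have := H j; lra.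
rewrite nmM nmV ler_pdivrMr; last by apply: lt_le_trans uj.
rewrite nm_dist (le_trans (H j))//.
have := mulr_ge0 A0 (ltW kj); have := mulr_ge0 S0 (ltW kj).
set S := \sum_(j < J) _; set t := k ^+ j; nra.
Qed.

(** The lower bound is the upper bound for the product of the reciprocals. *)
Lemma prod_bounds (A k : R) u : 0 < k < 1 -> 0 <= A ->
  (forall j, nm (u j - 1) <= A * k ^+ j) -> (forall j, u j != 0) ->
  exists2 m : R, 0 < m & forall n, m <= nm (\prod_(j < n) u j) <= m^-1.
Proof.
move=> k01 A0 H u0; have k01' : 0 <= k < 1 by case/andP: k01 => /ltW -> ->.
have [B B0 HB] := inv_dom k01 A0 H u0.
pose E := expR (A / (1 - k) + B / (1 - k)).
have E1 : expR (A / (1 - k)) <= E.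
  by rewrite ler_expR lerDl divr_ge0// subr_ge0; case/andP: k01 => _ /ltW.
have E2 : expR (B / (1 - k)) <= E.
  by rewrite ler_expR lerDr divr_ge0// subr_ge0; case/andP: k01 => _ /ltW.
exists E^-1 => [|n]; first by rewrite invr_gt0 expR_gt0.
rewrite invrK (le_trans (prod_le_exp k01' A0 H n))// andbT.
have := prod_le_exp k01' B0 HB n; rewrite prodfV nmV => h.
rewrite -[leRHS]invrK lef_pV2 ?posrE ?expR_gt0 ?invr_gt0 ?nm_gt0 ?(le_trans h)//.
by apply/prodf_neq0.
Qed.

Lemma prod_lim_neq0 (A k : R) u l : 0 < k < 1 -> 0 <= A ->
  (forall j, nm (u j - 1) <= A * k ^+ j) -> (forall j, u j != 0) ->
  (fun n => \prod_(j < n) u j) @ \oo --> l -> l != 0.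
Proof.
move=> k01 A0 H u0 ul; have [m m0 Hm] := prod_bounds k01 A0 H u0.
apply/eqP => l0; move: ul; rewrite l0 => /cvg_nm /(_ m m0) [N _ /(_ N (leqnn _))] /=.
by rewrite subr0 ltNge; case/andP: (Hm N) => ->.
Qed.

(** Comparison with the real products of 1 - al k^j and 1 + al k^j gives bounds uniform in a, q and
    n. *)
Lemma qpoch_bounds (al k : R) : 0 <= al < 1 -> 0 < k < 1 ->
  exists2 m : R, 0 < m & forall (a q : C) n, nm a <= al -> nm q <= k ->
    m <= nm (qpoch a q n) <= m^-1.
Proof.
move=> /andP[al0 al1] k01; have /andP[k0 k1] := k01.
pose u j : C := (1 - al * k ^+ j)%:C%C; pose v j : C := (1 + al * k ^+ j)%:C%C.
have t01 j : 0 <= al * k ^+ j <= al.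
  by rewrite mulr_ge0 ?exprn_ge0 ?(ltW k0)//= ler_piMr// exprn_ile1// ltW.
have uE j : nm (u j) = 1 - al * k ^+ j.
  by rewrite nm_real ger0_norm//; have := t01 j; lra.
have vE j : nm (v j) = 1 + al * k ^+ j.
  by rewrite nm_real ger0_norm//; have := t01 j; lra.
have [m m0 Hm] : exists2 m : R, 0 < m & forall n, m <= nm (\prod_(j < n) u j) <= m^-1.
  apply: (@prod_bounds al k) => // j.
    by rewrite -rmorphB nm_real addrAC subrr add0r normrN ger0_norm//; case/andP: (t01 j).
  by rewrite -nm_gt0 uE; have := t01 j; lra.
have [m' m'0 Hm'] : exists2 m : R, 0 < m & forall n, m <= nm (\prod_(j < n) v j) <= m^-1.
  apply: (@prod_bounds al k) => // j.
    by rewrite -rmorphB nm_real addrAC subrr add0r ger0_norm//; case/andP: (t01 j).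
  by rewrite -nm_gt0 vE; have := t01 j; lra.
exists (Num.min m m') => [|a q n aal qk]; first by rewrite lt_min m0.
have aq j : nm (a * q ^+ j) <= al * k ^+ j.
  rewrite nmM nmX ler_pM ?exprn_ge0 ?nm_ge0//.
  by rewrite lerXn2r ?nnegrE ?nm_ge0// ltW.
rewrite /qpoch (nm_prod n (fun j => 1 - a * q ^+ j)); apply/andP; split.
- apply: (@le_trans _ _ m); first by rewrite ge_min lexx.
  case/andP: (Hm n) => /le_trans + _; apply; rewrite nm_prod.
  apply: ler_prod => j _; rewrite nm_ge0 uE /=.
  by have := nmD (1 - a * q ^+ j) (a * q ^+ j); rewrite subrK nm1; have := aq j; lra.
- apply: (@le_trans _ _ (m'^-1)); last first.
    by rewrite lef_pV2 ?posrE ?lt_min ?m0// ge_min lexx orbT.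
  case/andP: (Hm' n) => _; apply: le_trans; rewrite nm_prod.
  apply: ler_prod => j _; rewrite nm_ge0 vE /=.
  by have := nmB 1 (a * q ^+ j); rewrite nm1; have := aq j; lra.
Qed.

(** Bernoulli's inequality for (t'/t)^n: a sum of n + 1 terms costs only a slight increase of the
    rate. *)
Lemma pow_absorb (t t' : R) : 0 <= t < t' -> exists2 A : R, 0 <= A &
  forall n, n.+1%:R * t ^+ n <= A * t' ^+ n.
Proof.
move=> /andP[t0 tt']; have t'0 : 0 < t' by apply: le_lt_trans tt'.
have [->|tn0] := eqVneq t 0.
  exists 1 => // -[|n]; first by rewrite !expr0 !mulr1.
  by rewrite exprS mul0r mulr0 mul1r exprn_ge0// ltW.
have tp : 0 < t by rewrite lt_def tn0.
pose d := t' / t - 1; have d0 : 0 < d by rewrite subr_gt0 ltr_pdivlMr// mul1r.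
exists (1 + d^-1) => [|n]; first by rewrite addr_ge0// invr_ge0 ltW.
have -> : t' = (1 + d) * t by rewrite /d; field.
rewrite exprMn mulrA ler_wpM2r ?exprn_ge0//.
have B : 1 + n%:R * d <= (1 + d) ^+ n.
  elim: n => [|n IH]; first by rewrite mul0r addr0.
  rewrite exprS; have n0 : 0 <= n%:R :> R by [].
  apply: (@le_trans _ _ ((1 + d) * (1 + n%:R * d))).
    by rewrite -natr1; have := mulr_ge0 n0 (mulr_ge0 (ltW d0) (ltW d0)); set N : R := n%:R; nra.
  by rewrite ler_pM2l// ltr_wpDl.
apply: (@le_trans _ _ ((1 + d^-1) * (1 + n%:R * d))).
  have -> : (1 + d^-1) * (1 + n%:R * d) = n.+1%:R + (n%:R * d + d^-1).
    by rewrite -natr1; field; rewrite gt_eqF.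
  by rewrite lerDl addr_ge0 ?mulr_ge0 ?invr_ge0// ltW.
by rewrite ler_pM2l// addr_gt0 ?invr_gt0.
Qed.

(* The recurrence is a perturbation, of relative size k^m, of the one with
   characteristic roots ga and de.  The quantity |e m| + la |e m.+1 - ga e m| is
   multiplied by at most r at each step once k^m is small enough. *)
Lemma perturbed_rec_growth (rho r k B : R) : 0 <= rho < r -> 0 < k < 1 -> 0 <= B ->
  exists2 A : R, 0 <= A & forall (ga de : C) (e : nat -> C) M,
    nm ga <= rho -> nm de <= rho -> nm (e 0%N) <= B -> nm (e 1%N) <= B ->
    (forall m, (m < M)%N -> nm (e m.+2 - (ga + de) * e m.+1 + ga * de * e m)
        <= B * k ^+ m * (nm (e m.+1) + nm (e m))) ->
    forall m, (m <= M)%N -> nm (e m) <= A * r ^+ m.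
Proof.
move=> /andP[rho0 rr] k01 B0; have /andP[k0 k1] := k01.
have r0 : 0 < r by apply: le_lt_trans rr.
(* With this value la (r - rho)/2 = 1, which removes the remaining multiple of the modulus of [f m]
   from the step estimate. *)
pose la := 2 / (r - rho); have la0 : 0 < la by rewrite divr_gt0// subr_gt0.
have laE : la * (r - rho) = 2 by rewrite /la divfK// subr_eq0 gt_eqF.
pose K := B * (1 + la * (1 + rho)).
have K0 : 0 <= K by rewrite mulr_ge0// addr_ge0// mulr_ge0 ?(ltW la0)// addr_ge0.
have [J HJ] : exists J, forall j, (J <= j)%N -> K * k ^+ j <= (r - rho) / 2.
  have [J HJ] := @pow_small k ((r - rho) / 2 / (K + 1)) ltac:(by rewrite ltW//=)
    ltac:(by rewrite !divr_gt0 ?subr_gt0// ltr_wpDl).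
  exists J => j /HJ; rewrite ltr_pdivlMr ?ltr_wpDl// => h.
  have := exprn_ge0 j (ltW k0); move: h; set t := k ^+ j; nra.
pose A0 := B + la * (B + rho * B).
have A00 : 0 <= A0 by rewrite addr_ge0// mulr_ge0 ?(ltW la0)// addr_ge0// mulr_ge0.
(* Before [J] a step may multiply by r + K instead of r; [T] compensates for each of these steps. *)
pose T := (r + K) / r; have T1 : 1 <= T by rewrite ler_pdivlMr// mul1r lerDl.
exists (A0 * T ^+ J) => [|ga de e M ga1 de1 e0 e1 He].
  by rewrite mulr_ge0// exprn_ge0// (le_trans _ T1).
pose f m := e m.+1 - ga * e m; pose Am m := nm (e m) + la * nm (f m).
have f0 m : 0 <= nm (f m) by exact: nm_ge0.
have step m : (m < M)%N -> Am m.+1 <= (rho + (r - rho) / 2 + K * k ^+ m) * Am m.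
  move=> /He; set pe := _ - _ + _ => Hpe.
  have fE : f m.+1 = pe + de * f m by rewrite /f /pe; ring.
  have h1 : nm (e m.+1) <= rho * nm (e m) + nm (f m).
    have := nmD (ga * e m) (f m); rewrite /f addrC subrK nmM => h.
    by rewrite (le_trans h)// lerD2r ler_wpM2r ?nm_ge0.
  have h2 : nm (f m.+1) <= nm pe + rho * nm (f m).
    by rewrite fE (le_trans (nmD _ _))// lerD2l nmM ler_wpM2r ?nm_ge0.
  have kk : 0 <= k ^+ m by rewrite exprn_ge0// ltW.
  rewrite /Am /K; move: h1 h2 Hpe (f0 m) (nm_ge0 (e m)) (nm_ge0 (e m.+1)) kk.
  move: (nm (e m)) (nm (e m.+1)) (nm (f m)) (nm (f m.+1)) (nm pe) (k ^+ m).
  move=> E E1 F F1 Pe t h1 h2 h3 F0 E0 E10 t0.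
  have h4 : Pe <= B * t * ((1 + rho) * E + F).
    by apply: le_trans h3 _; rewrite ler_wpM2l ?mulr_ge0//; lra.
  have h5 : F1 <= B * t * ((1 + rho) * E + F) + rho * F by lra.
  have h6 : la * F1 <= la * (B * t * ((1 + rho) * E + F) + rho * F) by rewrite ler_pM2l.
  apply: (@le_trans _ _ (rho * E + F + la * (B * t * ((1 + rho) * E + F) + rho * F))).
    lra.
  rewrite -subr_ge0 (_ : _ - _ = (r - rho) / 2 * E + B * t * (E + la ^+ 2 * (1 + rho) * F)
     + (la * (r - rho) / 2 - 1) * F); last by field.
  have -> : la * (r - rho) / 2 - 1 = 0 by rewrite laE; field.
  rewrite mul0r addr0 addr_ge0//; first by rewrite mulr_ge0// divr_ge0// subr_ge0 ltW.
  rewrite mulr_ge0//; first exact: mulr_ge0.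
  by rewrite addr_ge0// mulr_ge0// mulr_ge0 ?sqr_ge0// addr_ge0.
have Am0 m : 0 <= Am m by rewrite addr_ge0 ?nm_ge0// mulr_ge0 ?nm_ge0// ltW.
have e_le m : nm (e m) <= Am m by rewrite lerDl mulr_ge0 ?nm_ge0// ltW.
have main m : (m <= M)%N -> Am m <= A0 * T ^+ (minn m J) * r ^+ m.
  elim: m => [_|m IH mM].
    rewrite min0n !expr0 !mulr1 /Am /A0 lerD// ler_pM2l//.
    by rewrite (le_trans (nmB _ _))// nmM lerD// ler_pM ?nm_ge0.
  have := step m mM; move/le_trans; apply.
  have {}IH := IH (ltnW mM).
  have Tp n : 0 <= T ^+ n by rewrite exprn_ge0// (le_trans _ T1).
  have rp n : 0 <= r ^+ n by rewrite exprn_ge0// ltW.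
  have kk : 0 <= k ^+ m <= 1 by rewrite exprn_ge0 ?exprn_ile1// ltW.
  have [mJ|Jm] := ltnP m J.
    apply: (@le_trans _ _ ((r + K) * Am m)).
      by apply: ler_wpM2r => //; move: kk; set t := k ^+ m; nra.
    apply: (@le_trans _ _ ((r + K) * (A0 * T ^+ minn m J * r ^+ m))).
      by rewrite ler_wpM2l// addr_ge0// ltW.
    rewrite (minn_idPl mJ) (minn_idPl (ltnW mJ)) !exprS.
    have -> : A0 * (T * T ^+ m) * (r * r ^+ m) = (T * r) * (A0 * T ^+ m * r ^+ m) by ring.
    by rewrite /T divfK ?gt_eqF.
  apply: (@le_trans _ _ (r * Am m)).
    by apply: ler_wpM2r => //; have := HJ _ Jm; lra.
  rewrite (minn_idPr Jm) in IH; rewrite (minn_idPr (leqW Jm)) exprS.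
  by rewrite [leRHS]mulrCA ler_pM2l.
move=> m mM; rewrite (le_trans (e_le m))// (le_trans (main m mM))//.
rewrite ler_wpM2r ?exprn_ge0 ?(ltW r0)// ler_wpM2l//.
by rewrite ler_weXn2l// geq_minr.
Qed.
End Products.

(** * Convergence of the Hermite series *)

Section Bounds.
Variable R : realType.
Local Notation C := (cplx R).
Variables (q : C) (k : R).
Hypothesis k01 : 0 < k < 1.
Hypothesis qk : nm q <= k.
Implicit Types (x y z a b c d s P : C).

Let k0 : 0 < k. Proof. by case/andP: k01. Qed.
Let k1 : k < 1. Proof. by case/andP: k01. Qed.

Lemma nm_qX m n : (m <= n)%N -> nm (q ^+ n) <= k ^+ m.
Proof.
move=> mn; rewrite nmX; apply: (@le_trans _ _ (k ^+ n)).
  by rewrite lerXn2r ?nnegrE ?nm_ge0// ltW.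
by rewrite ler_wiXn2l ?ltW.
Qed.

Lemma nm_1q m : nm (1 - q ^+ m) <= 2.
Proof.
rewrite (le_trans (nmB _ _))// nm1; have := nm_qX (leq0n m); rewrite expr0; lra.
Qed.

(** As q^m -> 0 the recurrence of [U] tends to the one with characteristic roots ga and de, with an
    error of size k^m. *)
Lemma U_growth (rho r B : R) : 0 <= rho < r -> 0 <= B ->
  exists2 A : R, 0 <= A & forall (n1 n2 ga de : C), nm n1 <= B -> nm n2 <= B ->
    nm ga <= rho -> nm de <= rho ->
    forall m, nm (U q n1 n2 (ga + de) (ga * de) m) <= A * r ^+ m.
Proof.
move=> rr B0; have rho0 : 0 <= rho by case/andP: rr.
have B0' : 0 <= 2 * B + rho ^+ 2 + 1 + 2 * rho.
  by rewrite !addr_ge0 ?mulr_ge0 ?sqr_ge0.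
have [A A0 HA] := perturbed_rec_growth rr k01 B0'.
exists A => // n1 n2 ga de h1 h2 h3 h4 m.
apply: (HA ga de (U q n1 n2 (ga + de) (ga * de)) m) => // [| |i _].
- by rewrite /= nm1; have := sqr_ge0 rho; lra.
- rewrite /= (le_trans (nmB _ _))//; have := nmD ga de; have := sqr_ge0 rho; lra.
rewrite U_rec; move: (U _ _ _ _ _ i) (U _ _ _ _ _ i.+1) => e0 e1.
rewrite (_ : _ + _ = (n2 * q ^+ i * (1 - q ^+ i.+1) + ga * de * q ^+ i.+1) * e0
   - n1 * q ^+ i.+1 * e1); last by ring.
rewrite (le_trans (nmB _ _))// [leRHS]mulrDr [leLHS]addrC lerD//.
  rewrite 2!nmM -mulrA mulrA ler_wpM2r ?nm_ge0//.
  apply: ler_pM; rewrite ?nm_ge0 ?nm_qX//.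
  by have := sqr_ge0 rho; lra.
rewrite nmM ler_wpM2r ?nm_ge0// (le_trans (nmD _ _))//.
have f1 : nm (n2 * q ^+ i * (1 - q ^+ i.+1)) <= B * k ^+ i * 2.
  rewrite 2!nmM ler_pM ?mulr_ge0 ?nm_ge0 ?nm_1q//.
  by rewrite ler_pM ?nm_ge0 ?nm_qX.
have f2 : nm (ga * de * q ^+ i.+1) <= rho ^+ 2 * k ^+ i.
  by rewrite 2!nmM ler_pM ?mulr_ge0 ?nm_ge0 ?nm_qX// expr2 ler_pM ?nm_ge0.
have kk : 0 <= k ^+ i by rewrite exprn_ge0// ltW.
by move: f1 f2 kk (mulr_ge0 rho0 kk); set t := k ^+ i; set w := rho ^+ 2; nra.
Qed.

(** Both q^i and q^(n-1) are O(k^i) as long as i < n, so the limiting recurrence has both roots 0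
    and every rate r > 0 is allowed. This estimate is what confines m to m <= n. *)
Lemma gam_growth (r B : R) : 0 < r -> 0 <= B ->
  exists2 A : R, 0 <= A & forall (s P sg de : C), nm (de * s) <= B ->
    nm (P * de ^+ 2) <= B -> nm sg <= B -> nm de <= B ->
    forall n m, (m <= n)%N -> nm (gam q s P sg de n m) <= A * r ^+ m.
Proof.
move=> r0 B0.
have rr : 0 <= (0 : R) < r by rewrite lexx.
have B0' : 0 <= 4 * B + 1 by rewrite addr_ge0// mulr_ge0.
have [A A0 HA] := perturbed_rec_growth rr k01 B0'.
exists A => // s P sg de h1 h2 h3 h4 n m mn.
apply: (HA 0 0 (gam q s P sg de n) n) => // [| | | |i ltin]; rewrite ?nm0//.
- by rewrite gam0 nm1 lerDr mulr_ge0.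
- rewrite gam1 (le_trans (nmB _ _))// nmM.
  have := nm_qX (leq0n n.-1); rewrite expr0 => h5.
  have := nm_ge0 (de * s); have := nm_ge0 (q ^+ n.-1); nra.
rewrite gam_rec; move: (gam _ _ _ _ _ n i) (gam _ _ _ _ _ n i.+1) => e0 e1.
have n1 : (i <= n.-1)%N by rewrite -ltnS prednK// (leq_trans _ ltin).
rewrite (_ : _ + _ = (de * s * q ^+ n.-1 - sg * q ^+ i.+1) * e1
   - (P * de ^+ 2 * q ^+ n.-1 ^+ 2 - de * q ^+ i) * (1 - q ^+ i.+1) * e0); last by ring.
have kk : 0 <= k ^+ i by rewrite exprn_ge0// ltW.
rewrite (le_trans (nmB _ _))// [leRHS]mulrDr lerD//.
  rewrite nmM ler_wpM2r ?nm_ge0// (le_trans (nmB _ _))//.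
  have f1 : nm (de * s * q ^+ n.-1) <= B * k ^+ i by rewrite nmM ler_pM ?nm_ge0 ?nm_qX.
  have f2 : nm (sg * q ^+ i.+1) <= B * k ^+ i by rewrite nmM ler_pM ?nm_ge0 ?nm_qX.
  by move: f1 f2 kk (mulr_ge0 B0 kk); set t := k ^+ i; nra.
rewrite nmM ler_wpM2r ?nm_ge0// nmM.
have f1 : nm (P * de ^+ 2 * q ^+ n.-1 ^+ 2) <= B * k ^+ i.
  rewrite nmM ler_pM ?nm_ge0// -exprM nm_qX//.
  by rewrite (leq_trans n1)// leq_pmulr.
have f2 : nm (de * q ^+ i) <= B * k ^+ i by rewrite nmM ler_pM ?nm_ge0 ?nm_qX.
apply: (@le_trans _ _ ((2 * (B * k ^+ i)) * 2)).
  rewrite ler_pM ?nm_ge0 ?nm_1q// (le_trans (nmB _ _))//; lra.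
by move: kk (mulr_ge0 B0 kk); set t := k ^+ i; nra.
Qed.

Lemma cvg_U (n1 n2 d1 d2 : nat -> C) (N1 N2 D1 D2 : C) m :
  n1 @ \oo --> N1 -> n2 @ \oo --> N2 -> d1 @ \oo --> D1 -> d2 @ \oo --> D2 ->
  (fun n => U q (n1 n) (n2 n) (d1 n) (d2 n) m) @ \oo --> U q N1 N2 D1 D2 m.
Proof.
move=> h1 h2 h3 h4; elim/nat_ind2: m => [| |m IH0 IH1].
- exact: cvg_cst.
- exact: (cvgB h3 h1).
have cst (x : C) : (fun=> x) @ \oo --> x by exact: cvg_cst.
exact: (cvgB (cvgM (cvgB h3 (cvgM h1 (cst _))) IH1)
  (cvgM (cvgM (cvgB h4 (cvgM h2 (cst _))) (cst _)) IH0)).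
Qed.

Lemma cvg_qpoch (a : nat -> C) (a0 : C) m : a @ \oo --> a0 ->
  (fun n => qpoch (a n) q m) @ \oo --> qpoch a0 q m.
Proof.
move=> h; apply: (@cvg_prodn _ _ _ (fun n (j : 'I_m) => 1 - a n * q ^+ j)) => j.
exact: (cvgB (@cvg_cst _ _ _ _ _) (cvgM h (@cvg_cst _ _ _ _ _))).
Qed.

Lemma subr1qXS_neq0 i : 1 - q ^+ i.+1 != 0.
Proof.
rewrite subr_eq0 eq_sym; apply/eqP => E; have := nm_qX (leqnn i.+1).
by rewrite E nm1 leNgt exprn_ilt1// ltW.
Qed.

Lemma subr1MqX_neq0 a i : nm a < 1 -> 1 - a * q ^+ i != 0.
Proof.
move=> a1; rewrite subr_eq0 eq_sym; apply/eqP => E.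
have := nm_qX (leq0n i); rewrite expr0 => h.
have := nm1 R; rewrite -E nmM; have := nm_ge0 a; have := nm_ge0 (q ^+ i); nra.
Qed.

Lemma qbinom_bound : exists2 M : R, 0 <= M & forall n j, nm (qbinom n j q) <= M.
Proof.
have [m m0 Hm] := @qpoch_bounds R k k ltac:(by rewrite ltW) k01.
exists (m^-1 * (m^-1 * m^-1)); first by rewrite !mulr_ge0// invr_ge0 ltW.
move=> n j; rewrite /qbinom invfM nmM nmM !nmV.
have h i : nm (qpoch q q i) <= m^-1 by have /andP[] := Hm q q i qk qk.
have h' i : (nm (qpoch q q i))^-1 <= m^-1.
  have /andP[m1 _] := Hm q q i qk qk.
  by rewrite lef_pV2 ?posrE// (lt_le_trans m0 m1).
by rewrite !ler_pM ?mulr_ge0 ?invr_ge0 ?nm_ge0.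
Qed.

Lemma herm_dom x (X : C) (rx : R) : 2 * x = X + X^-1 -> X != 0 -> nm X^-1 <= nm X ->
  nm X < rx -> exists2 A : R, 0 <= A & forall n, nm (hermc q x n) <= A * rx ^+ n.
Proof.
move=> xX X0 XX Xr.
have [A A0 HA] := @U_growth (nm X) rx 0 ltac:(by rewrite nm_ge0) (lexx _).
have [m m0 Hm] := @qpoch_bounds R k k ltac:(by rewrite ltW) k01.
exists (A * m^-1) => [|n]; first by rewrite mulr_ge0// invr_ge0 ltW.
rewrite /hermc nmM nmV mulrAC ler_pM ?invr_ge0 ?nm_ge0//.
  by rewrite xX -(divff X0); apply: HA; rewrite ?nm0.
have /andP[m1 _] := Hm q q n qk qk.
by rewrite lef_pV2 ?posrE// (lt_le_trans m0 m1).
Qed.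

(** One constant serves all admissible (c,d), in particular all shifted pairs. The summands have the
    intermediate rate [r1], and [pow_absorb] turns their number into the rate r. *)
Lemma ubar_dom a b (rho r al : R) : nm a <= rho -> nm b <= rho -> rho < r -> al < 1 ->
  nm (a * b) <= al -> exists2 A : R, 0 <= A & forall c d, nm c <= rho -> nm d <= rho ->
  nm (a * b * (c * d)) <= al ->
  forall n, nm (ubar q (a + b) (a * b) (c + d) (c * d) n) <= A * r ^+ n.
Proof.
move=> ar br rr al1 Pal; have rho0 : 0 <= rho by apply: le_trans ar; exact: nm_ge0.
have al0 : 0 <= al by apply: le_trans Pal; exact: nm_ge0.
pose r1 := (rho + r) / 2.
have rr1 : 0 <= rho < r1 by rewrite rho0 /r1; lra.
have r1r : 0 <= r1 < r by rewrite /r1; lra.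
have r10 : 0 <= r1 by case/andP: r1r.
have [A1 A10 H1] := U_growth rr1 (lexx 0).
pose B := rho ^+ 2 * (nm a + nm b) + nm (a * b) * (rho ^+ 2) ^+ 2.
have B1 : 0 <= rho ^+ 2 * (nm a + nm b) by rewrite mulr_ge0 ?addr_ge0 ?nm_ge0 ?sqr_ge0.
have B2 : 0 <= nm (a * b) * (rho ^+ 2) ^+ 2 by rewrite mulr_ge0 ?nm_ge0 ?sqr_ge0.
have B0 : 0 <= B by rewrite addr_ge0.
have [A2 A20 H2] := U_growth rr1 B0.
have [M M0 HM] := qbinom_bound.
have [m m0 Hm] := @qpoch_bounds R al k ltac:(by rewrite al0) k01.
have [A3 A30 H3] := pow_absorb r1r.
pose T := M * A1 * (m^-1 * m^-1 * A2).
have mi : 0 <= m^-1 by rewrite invr_ge0 ltW.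
have T0 : 0 <= T by rewrite /T !mulr_ge0.
exists (T * A3) => [|c d cr dr ual n]; first exact: mulr_ge0.
have cd : nm (c * d) <= rho ^+ 2 by rewrite nmM expr2 ler_pM ?nm_ge0.
have momb j : nm (awmom q (a + b) (a * b) (c + d) (c * d) j) <= m^-1 * m^-1 * A2 * r1 ^+ j.
  rewrite /awmom nmM nmM nmV -[leRHS]mulrA ler_pM ?mulr_ge0 ?invr_ge0 ?nm_ge0//.
    rewrite ler_pM ?invr_ge0 ?nm_ge0//.
      by have /andP[] := Hm _ _ j Pal qk.
    have /andP[m1 _] := Hm _ _ j ual qk.
    by rewrite lef_pV2 ?posrE// (lt_le_trans m0 m1).
  apply: H2 => //.
    rewrite nmM /B -[leLHS]addr0 lerD//.
    by rewrite ler_pM ?nm_ge0// nmD.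
  rewrite nmM nmX /B -[leLHS]add0r lerD//.
  by rewrite ler_wpM2l ?nm_ge0// lerXn2r ?nnegrE ?nm_ge0 ?sqr_ge0.
rewrite /ubar /conn (le_trans (nm_sum _ (fun j => qbinom n j q * U q 0 0 (a + b) (a * b) (n - j) * awmom q (a + b) (a * b) (c + d) (c * d) j)))//.
apply: (@le_trans _ _ (\sum_(j < n.+1) T * r1 ^+ n)).
  apply: ler_sum => j _; rewrite nmM nmM /T.
  have -> : r1 ^+ n = r1 ^+ (n - j) * r1 ^+ j by rewrite -exprD subnK// -ltnS.
  rewrite [leRHS](_ : _ = M * (A1 * r1 ^+ (n - j)) * (m^-1 * m^-1 * A2 * r1 ^+ j)); last by ring.
  by rewrite !ler_pM ?mulr_ge0 ?nm_ge0// H1 ?nm0.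
by rewrite sumr_const card_ord -mulr_natl mulrCA -mulrA ler_wpM2l.
Qed.
End Bounds.

Section Hermite.
Variable R : realType.
Local Notation C := (cplx R).
Variables (q : C) (k : R).
Hypothesis k01 : 0 < k < 1.
Hypothesis qk : nm q <= k.
Implicit Types (x y z a b c d s P F : C).

Let k1 : k < 1. Proof. by case/andP: k01. Qed.
Let HQ := subr1qXS_neq0 k01 qk.

Lemma series_ord (u : nat -> C) n : series u n = \sum_(i < n) u i.
Proof. by rewrite /series /= big_mkord. Qed.

(** Chains a shift in c with one in d, and one double shift with the next. *)
Lemma mul_chain (K : fieldType) (A B G k1' k2' g1 g2 : K) :
  A * G = k1' * g1 -> B * g1 = k2' * g2 -> A * B * G = k1' * k2' * g2.
Proof. by move=> E1 E2; rewrite mulrAC E1 -[RHS]mulrA -E2; ring. Qed.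

Lemma cvg_cmul (u : nat -> C) (y l : C) : u @ \oo --> l -> (fun n => y * u n) @ \oo --> y * l.
Proof. by move=> ul; exact: (cvgM (@cvg_cst _ _ _ _ _) ul). Qed.

Definition hterm x s P c d n := hermc q x n * ubar q s P (c + d) (c * d) n.

Lemma cvg_geo0 (A t : R) (u : nat -> C) : 0 <= t < 1 ->
  (forall n, nm (u n) <= A * t ^+ n) -> u @ \oo --> (0 : C).
Proof.
move=> /andP[t0 t1] H; apply: (@cvg_nm_dom _ _ _ (fun n => A * t ^+ n)).
  have e : (fun n => t ^+ n) @ \oo --> (0 : R) by apply: cvg_expr; rewrite ger0_norm.
  by rewrite -(mulr0 A); exact: (cvgM (@cvg_cst _ _ _ _ _) e).
by move=> n; rewrite subr0.
Qed.

Lemma herm_step x s P c d F F' (A1 A2 rx r : R) :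
  nm P < 1 -> nm (P * (c * d)) < 1 -> 0 <= rx -> 0 <= r -> rx * r < 1 ->
  (forall n, nm (hermc q x n) <= A1 * rx ^+ n) ->
  (forall n, nm (ubar q s P (c + d) (c * d) n) <= A2 * r ^+ n) ->
  series (hterm x s P c d) @ \oo --> F ->
  series (hterm x s P (q * c) d) @ \oo --> F' ->
  (1 - 2 * c * x + c ^+ 2) * F = shift_const s P c d (P * (c * d)) * F'.
Proof.
move=> P1 u1 rx0 r0 rr Hh Hu SF SF'.
have t01 : 0 <= rx * r < 1 by rewrite mulr_ge0.
pose bd N : C := c * (hermc q x N * ubar q s P (c + d) (c * d) N.+1
         - (1 - q ^+ N.+1) * hermc q x N.+1 * ubar q s P (c + d) (c * d) N).
have E N : (1 - 2 * c * x + c ^+ 2) * series (hterm x s P c d) N.+1 =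
   shift_const s P c d (P * (c * d)) * series (hterm x s P (q * c) d) N.+1 + bd N.
  rewrite [in LHS](series_ord (hterm x s P c d) N.+1).
  rewrite (series_ord (hterm x s P (q * c) d) N.+1) /hterm -(mulrA q c d).
  rewrite (herm_partial HQ s (erefl _) (fun i => subr1MqX_neq0 k01 qk i u1) (fun i => subr1MqX_neq0 k01 qk i P1)).
  by [].
have bd0 : bd @ \oo --> (0 : C).
  rewrite -(mulr0 c); apply: cvg_cmul.
  have b1 : (fun N => hermc q x N * ubar q s P (c + d) (c * d) N.+1) @ \oo --> (0 : C).
    apply: (@cvg_geo0 (A1 * A2 * r) (rx * r)) => // n.
    rewrite nmM (_ : A1 * A2 * r * _ = (A1 * rx ^+ n) * (A2 * r ^+ n.+1)).
      by rewrite ler_pM ?nm_ge0.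
    by rewrite exprMn exprS; ring.
  have b2 : (fun N => (1 - q ^+ N.+1) * hermc q x N.+1 * ubar q s P (c + d) (c * d) N) @ \oo --> (0 : C).
    apply: (@cvg_geo0 (2 * A1 * A2 * rx) (rx * r)) => // n.
    rewrite 2!nmM (_ : 2 * A1 * A2 * rx * _ = (2 * (A1 * rx ^+ n.+1)) * (A2 * r ^+ n)).
      by rewrite !ler_pM ?mulr_ge0 ?nm_ge0// (nm_1q k01).
    by rewrite exprMn exprS; ring.
  by have := cvgB b1 b2; rewrite subr0; apply.
have h1 : (fun N => (1 - 2 * c * x + c ^+ 2) * series (hterm x s P c d) N.+1) @ \oo -->
  (1 - 2 * c * x + c ^+ 2) * F.
  exact: (cvg_cmul (cvg_shift1 SF)).
have h2 : (fun N => (1 - 2 * c * x + c ^+ 2) * series (hterm x s P c d) N.+1) @ \oo -->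
  shift_const s P c d (P * (c * d)) * F' + 0.
  under eq_fun do rewrite E.
  exact: (cvgD (cvg_cmul (cvg_shift1 SF')) bd0).
by rewrite -[RHS]addr0; apply: cvg_unique h1 h2.
Qed.

Lemma htermC x s P c d : hterm x s P c d = hterm x s P d c.
Proof. by apply/funext => n; rewrite /hterm addrC (mulrC c). Qed.

(* Both parameters are shifted in turn: the constants multiply up to the
   quotient of the two infinite products as the shift is iterated. *)
Definition double_const s P c d : C :=
  shift_const s P c d (P * (c * d)) * shift_const s P d (q * c) (P * (d * (q * c))).

(** A double shift advances cd and Pcd by two powers of q, hence the index 2N, while the factors
    attached to c and to d advance by one. *)
Lemma double_constE s P c d N : nm P < 1 -> nm (c * d) <= 1 ->
  \prod_(j < N) double_const s P (q ^+ j * c) (q ^+ j * d) =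
  lin_prod q s P c N * lin_prod q s P d N * qpoch (c * d) q (2 * N)
  / qpoch (P * (c * d)) q (2 * N).
Proof.
move=> P1 cd1; have u1 : nm (P * (c * d)) < 1.
  by rewrite nmM; have := nm_ge0 P; have := nm_ge0 (c * d); nra.
have Hu i := subr1MqX_neq0 k01 qk i u1.
elim: N => [|N IH].
  by rewrite big_ord0 muln0 !qpoch0 /lin_prod !big_ord0 !mul1r invr1.
rewrite big_ord_recr /= {}IH mulnS !addSn add0n !qpochSr !lin_prodSr.
rewrite /double_const /shift_const.
have h1 := Hu (2 * N)%N; have h2 := Hu (2 * N).+1.
have h3 : qpoch (P * (c * d)) q (2 * N) != 0 by apply: qpoch_neq0.
rewrite (exprS q (2 * N)) (_ : q ^+ (2 * N) = q ^+ N * q ^+ N) in h1 h2 *; last first.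
  by rewrite -exprD mul2n addnn.
by field; rewrite h1 h2 h3.
Qed.

Lemma w_split x z c d t r : c + d = 2 * r * z -> c * d = r ^+ 2 ->
  (1 - 2 * (t * c) * x + (t * c) ^+ 2) * (1 - 2 * (t * d) * x + (t * d) ^+ 2) =
  w x z (r * t).
Proof.
move=> E1 E2; rewrite /w.
rewrite (_ : _ * _ = 1 - 2 * t * (c + d) * x + t ^+ 2 * ((c + d) ^+ 2 - 2 * (c * d))
  + 4 * t ^+ 2 * (c * d) * x ^+ 2 - 2 * t ^+ 3 * (c * d) * (c + d) * x
  + t ^+ 4 * (c * d) ^+ 2); last by ring.
by rewrite E1 E2; ring.
Qed.

Lemma ubar00 s P n : ubar q s P 0 0 n = U q 0 0 s P n.
Proof.
rewrite /ubar /conn big_ord_recl big1 ?addr0; last first.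
  move=> i _; rewrite /awmom [mom_num _ _ _ _ _ _]mom_numS0 !mulr0//.
by rewrite /= awmom0 mulr1 qbinom0// mul1r subn0.
Qed.

Lemma cvg_sq (u : nat -> C) (l : C) : u @ \oo --> l -> (fun n => u n ^+ 2) @ \oo --> l ^+ 2.
Proof. by move=> ul; under eq_fun do rewrite expr2; rewrite expr2; exact: (cvgM ul ul). Qed.

Lemma cvg_qpow y : (fun N => q ^+ N * y) @ \oo --> (0 : C).
Proof.
have q1 : nm q < 1 by apply: le_lt_trans k1.
by rewrite -(mul0r y); exact: (cvgM (cvg_pow q1) (@cvg_cst _ _ _ _ _)).
Qed.

Lemma cvg_sum_shift c d : (fun N => q ^+ N * c + q ^+ N * d) @ \oo --> (0 : C).
Proof. by rewrite -(addr0 0); exact: (cvgD (cvg_qpow c) (cvg_qpow d)). Qed.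

Lemma cvg_prod_shift c d : (fun N => q ^+ N * c * (q ^+ N * d)) @ \oo --> (0 : C).
Proof. by rewrite -(mulr0 0); exact: (cvgM (cvg_qpow c) (cvg_qpow d)). Qed.

Lemma cvg_awmom s P (sg de : nat -> C) j : sg @ \oo --> (0 : C) -> de @ \oo --> (0 : C) ->
  (fun N => awmom q s P (sg N) (de N) j) @ \oo --> awmom q s P 0 0 j.
Proof.
move=> h1 h2.
have e1 : (fun N => de N * s) @ \oo --> 0 * s by exact: (cvgM h2 (@cvg_cst _ _ _ _ _)).
have e2 : (fun N => P * de N ^+ 2) @ \oo --> P * 0 ^+ 2 by exact: (cvg_cmul (cvg_sq h2)).
have e3 : (fun N => qpoch (P * de N) q j) @ \oo --> qpoch (P * 0) q j.
  by apply: cvg_qpoch; exact: (cvg_cmul h2).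
have e4 : qpoch (P * 0) q j != 0 by rewrite mulr0 qpoch0l oner_neq0.
have e5 : (fun N => (qpoch (P * de N) q j)^-1) @ \oo --> (qpoch (P * 0) q j)^-1.
  exact: (cvgV e4 e3).
exact: (cvgM (cvg_cmul e5) (cvg_U e1 e2 h1 h2)).
Qed.

Lemma cvg_ubar s P (sg de : nat -> C) n : sg @ \oo --> (0 : C) -> de @ \oo --> (0 : C) ->
  (fun N => ubar q s P (sg N) (de N) n) @ \oo --> ubar q s P 0 0 n.
Proof.
move=> h1 h2; apply: cvg_sumn => j; apply: cvg_cmul; exact: cvg_awmom.
Qed.

(** The limits W, L, Q1, Q2 stay abstract so that the statement serves both rounds: (a,b,c,d) and
    then (0,0,a,b). *)
Lemma herm_limit x (X a b c d : C) (rho : R) :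
  2 * x = X + X^-1 -> X != 0 -> nm X^-1 <= nm X ->
  nm a <= rho -> nm b <= rho -> nm c <= rho -> nm d <= rho ->
  rho * nm X < 1 -> nm (a * b) < 1 -> nm (c * d) < 1 ->
  let s := a + b in let P := a * b in
  exists F F0 : C,
  [/\ series (hterm x s P c d) @ \oo --> F,
      series (fun n => hermc q x n * U q 0 0 s P n) @ \oo --> F0 &
      forall W L Q1 Q2 : C,
      (fun N => \prod_(j < N) ((1 - 2 * (q ^+ j * c) * x + (q ^+ j * c) ^+ 2)
          * (1 - 2 * (q ^+ j * d) * x + (q ^+ j * d) ^+ 2))) @ \oo --> W ->
      (fun N => lin_prod q s P c N * lin_prod q s P d N) @ \oo --> L ->
      (fun N => qpoch (c * d) q N) @ \oo --> Q1 ->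
      (fun N => qpoch (P * (c * d)) q N) @ \oo --> Q2 -> Q2 != 0 ->
      W * F = L * Q1 / Q2 * F0].
Proof.
move=> xX X0 XX ar br cr dr rX P1 cd1 s P.
have rho0 : 0 <= rho by apply: le_trans ar; exact: nm_ge0.
have [r [rx [rr Xr rrx]]] : exists r rx, [/\ rho < r, nm X < rx & rx * r < 1].
  have xi0 := nm_ge0 X; set xi := nm X in xi0 rX *.
  (* Since 0 < e < 1, the product (rho + e)(xi + e) is less than rho xi + e (rho + xi + 2) = 1. *)
  pose e := (1 - rho * xi) / (rho + xi + 2).
  have p0 : 0 < rho + xi + 2 by lra.
  have e0 : 0 < e by rewrite divr_gt0// subr_gt0.
  have eE : e * (rho + xi + 2) = 1 - rho * xi by rewrite /e divfK ?gt_eqF.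
  have e1 : e < 1 by rewrite /e ltr_pdivrMr//; have := mulr_ge0 rho0 xi0; lra.
  exists (rho + e), (xi + e); split; [lra|lra|nra].
have rx0 : 0 <= rx by apply: le_trans (ltW Xr); exact: nm_ge0.
have r0 : 0 <= r by rewrite (le_trans rho0)// ltW.
have [A1 A10 H1] := herm_dom k01 qk xX X0 XX Xr.
have u1 : nm (P * (c * d)) < 1.
  by rewrite nmM; have := nm_ge0 P; have := nm_ge0 (c * d); move: P1 cd1; rewrite -/P; nra.
pose al := Num.max (nm P) (nm (P * (c * d))).
have al1 : al < 1 by rewrite gt_max P1.
have Pal : nm P <= al by rewrite le_max lexx.
have [A2 A20 H2] := ubar_dom k01 qk ar br rr al1 Pal.
pose pw i j := (q ^+ i * c, q ^+ j * d).
have q1 i y : nm (q ^+ i * y) <= nm y.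
  have := nm_qX k01 qk (leq0n i); rewrite expr0 nmM => h.
  by rewrite -[leRHS]mul1r ler_wpM2r ?nm_ge0.
have H2' i j n : nm (ubar q s P (q ^+ i * c + q ^+ j * d) (q ^+ i * c * (q ^+ j * d)) n)
    <= A2 * r ^+ n.
  apply: H2; rewrite ?(le_trans (q1 _ _))//.
  rewrite le_max (_ : _ * _ = q ^+ (i + j) * (P * (c * d))) ?q1 ?orbT//.
  by rewrite exprD /P; ring.
have hd i j n : nm (hterm x s P (q ^+ i * c) (q ^+ j * d) n) <= A1 * A2 * (rx * r) ^+ n.
  rewrite /hterm nmM exprMn (_ : _ * (_ * _) = (A1 * rx ^+ n) * (A2 * r ^+ n)); last by ring.
  by rewrite ler_pM ?nm_ge0.
have t01 : 0 <= rx * r < 1 by rewrite mulr_ge0.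
have AA : 0 <= A1 * A2 by rewrite mulr_ge0.
have H20 n : nm (ubar q s P 0 0 n) <= A2 * r ^+ n.
  have al0 : 0 <= al by rewrite le_max nm_ge0.
  by have := @H2 0 0; rewrite addr0 !mulr0 nm0 => /(_ rho0 rho0 al0 n).
have Hc00 : exists F : C, series (fun n => hermc q x n * U q 0 0 s P n) @ \oo --> F.
  apply/cvg_ex; apply: (geo_cvg t01 AA) => n; rewrite -ubar00.
  rewrite nmM exprMn (_ : _ * (_ * _) = (A1 * rx ^+ n) * (A2 * r ^+ n)); last by ring.
  by rewrite ler_pM ?nm_ge0.
(* The sum after i shifts of c and j shifts of d; [G N.+1 N] is the halfway value of a double
   shift. *)
pose G i j := limn (series (hterm x s P (q ^+ i * c) (q ^+ j * d))).
have HG i j : series (hterm x s P (q ^+ i * c) (q ^+ j * d)) @ \oo --> G i j.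
  exact: (geo_cvg t01 AA (hd i j)).
have [F0 HF0] := Hc00.
have := HG 0%N 0%N; rewrite !expr0 !mul1r => HG0.
exists (G 0%N 0%N), F0; split=> // W L Q1 Q2 HW HL HQ1 HQ2 Q20.
have q_c i y : q ^+ i.+1 * y = q * (q ^+ i * y) by rewrite exprS mulrA.
have step N : (1 - 2 * (q ^+ N * c) * x + (q ^+ N * c) ^+ 2)
    * (1 - 2 * (q ^+ N * d) * x + (q ^+ N * d) ^+ 2) * G N N =
    double_const s P (q ^+ N * c) (q ^+ N * d) * G N.+1 N.+1.
  have ul i j : nm (P * (q ^+ i * c * (q ^+ j * d))) < 1.
    rewrite (_ : _ * _ = q ^+ (i + j) * (P * (c * d))); last by rewrite exprD; ring.
    exact: le_lt_trans (q1 _ _) u1.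
  have u2 := ul N N.+1.+1; have u3 := ul N.+1 N.
  have h2 := H2' N N; have h3 := H2' N.+1 N.
  have s1 := HG N N; have s2 := HG N.+1 N; have s3 := HG N.+1 N.+1.
  move: (ul N N) u3 h2 h3 s1 s2 s3; rewrite !q_c.
  move: (q ^+ N * c) (q ^+ N * d) (G N N) (G N.+1 N) (G N.+1 N.+1).
  move=> c' d' g0 g1 g2 u3 u4 h2 h3 s1 s2 s3.
  apply: (mul_chain (herm_step P1 u3 rx0 r0 rrx H1 h2 s1 s2)).
  apply: (herm_step P1 _ rx0 r0 rrx H1 (A2 := A2)).
  - by move: u3; rewrite (mulrC d').
  - by move=> n; move: (h3 n); rewrite (addrC d') (mulrC d').
  - by rewrite htermC; exact: s2.
  - by rewrite htermC; exact: s3.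
have iter N : \prod_(j < N) ((1 - 2 * (q ^+ j * c) * x + (q ^+ j * c) ^+ 2)
          * (1 - 2 * (q ^+ j * d) * x + (q ^+ j * d) ^+ 2)) * G 0%N 0%N =
    \prod_(j < N) double_const s P (q ^+ j * c) (q ^+ j * d) * G N N.
  elim: N => [|N IH]; first by rewrite !big_ord0 !mul1r.
  rewrite big_ord_recr [in RHS]big_ord_recr /=.
  exact: mul_chain IH (step N).
have GF0 : (fun N => G N N) @ \oo --> F0.
  apply: (tannery t01 AA (fun N => hd N N) _ (fun N => HG N N) HF0) => n.
  by rewrite -ubar00; apply: cvg_cmul; apply: cvg_ubar; [exact: cvg_sum_shift|exact: cvg_prod_shift].
have h1 : (fun N => \prod_(j < N) ((1 - 2 * (q ^+ j * c) * x + (q ^+ j * c) ^+ 2)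
          * (1 - 2 * (q ^+ j * d) * x + (q ^+ j * d) ^+ 2)) * G 0%N 0%N) @ \oo --> W * G 0%N 0%N.
  exact: (cvgM HW (@cvg_cst _ _ _ _ _)).
have h2 : (fun N => \prod_(j < N) ((1 - 2 * (q ^+ j * c) * x + (q ^+ j * c) ^+ 2)
          * (1 - 2 * (q ^+ j * d) * x + (q ^+ j * d) ^+ 2)) * G 0%N 0%N) @ \oo --> L * Q1 / Q2 * F0.
  under eq_fun do rewrite iter double_constE ?(ltW cd1)//.
  exact: (cvgM (cvgM (cvgM HL (cvg_double HQ1)) (cvgV Q20 (cvg_double HQ2))) GF0).
exact: cvg_unique h1 h2.
Qed.
End Hermite.

(** * Convergence of the Askey-Wilson series *)

Section AskeyWilson.
Variable R : realType.
Local Notation C := (cplx R).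
Variables (q : C) (k : R).
Hypothesis k01 : 0 < k < 1.
Hypothesis qk : nm q <= k.
Implicit Types (x y z a b c d s P F : C).

Let k1 : k < 1. Proof. by case/andP: k01. Qed.

Definition aterm x s P c d n :=
  inv_norm q s P c d n * bsum q s P (c + d) (c * d) n * awpoly q s P (c + d) (c * d) x n.

(** A product started at q^i c is a quotient of two partial products started at c, which are bounded
    above and away from 0. *)
Lemma lin_bound s P c :
  (forall i, 1 - c * s * q ^+ i + c ^+ 2 * P * (q ^+ i) ^+ 2 != 0) ->
  exists2 T : R, 0 <= T & forall i n, (nm (lin_prod q s P (q ^+ i * c) n))^-1 <= T.
Proof.
move=> H; pose u j := 1 - c * s * q ^+ j + c ^+ 2 * P * (q ^+ j) ^+ 2.
have B0 : 0 <= nm (c * s) + nm (c ^+ 2 * P) by rewrite addr_ge0 ?nm_ge0.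
have [m m0 Hm] : exists2 m : R, 0 < m & forall n, m <= nm (\prod_(j < n) u j) <= m^-1.
  apply: (prod_bounds k01 B0) => // j.
  rewrite /u (_ : _ - 1 = c ^+ 2 * P * (q ^+ j) ^+ 2 - c * s * q ^+ j); last by ring.
  rewrite (le_trans (nmB _ _))// [leRHS]mulrDl [leRHS]addrC lerD//.
    rewrite nmM ler_wpM2l ?nm_ge0// -exprM; apply: nm_qX => //.
    by rewrite muln2 -addnn leq_addr.
  by rewrite nmM ler_wpM2l ?nm_ge0//; apply: nm_qX.
exists (m^-1 * m^-1) => [|i n]; first by rewrite mulr_ge0// invr_ge0 ltW.
have E : \prod_(j < i + n) u j = \prod_(j < i) u j * lin_prod q s P (q ^+ i * c) n.
  elim: n => [|n IH]; first by rewrite addn0 /lin_prod big_ord0 mulr1.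
  rewrite addnS big_ord_recr /= IH lin_prodSr -mulrA; congr (_ * (_ * _)).
  by rewrite /u exprD; ring.
have /andP[l1 l2] := Hm i; have /andP[l3 l4] := Hm (i + n)%N.
have p1 : 0 < nm (\prod_(j < i) u j) by exact: lt_le_trans m0 l1.
have p3 : 0 < nm (\prod_(j < i + n) u j) by exact: lt_le_trans m0 l3.
have -> : (nm (lin_prod q s P (q ^+ i * c) n))^-1 =
   nm (\prod_(j < i) u j) * (nm (\prod_(j < i + n) u j))^-1.
  by rewrite E nmM invfM mulrA divff ?gt_eqF// mul1r.
by rewrite ler_pM ?invr_ge0 ?nm_ge0// lef_pV2 ?posrE.
Qed.

Lemma awcoef_bound (al B dl : R) : 0 <= al < 1 -> 0 <= B -> 0 < dl ->
  exists2 T : R, 0 <= T & forall s P sg de, nm (de * s) <= B ->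
    nm (P * de ^+ 2) <= B -> nm sg <= B -> nm de <= B -> nm P <= al ->
    nm (P * de) <= al ->
    forall n j, (j <= n)%N -> nm (awcoef q s P sg de n j) <= T * dl ^+ (n - j).
Proof.
move=> al01 B0 dl0.
have [A A0 HA] := gam_growth k01 qk dl0 B0.
have [M M0 HM] := qbinom_bound k01 qk.
have [m m0 Hm] := qpoch_bounds al01 k01.
have mi : 0 <= m^-1 by rewrite invr_ge0 ltW.
exists (M * (m^-1 * m^-1) * A) => [|s P sg de h1 h2 h3 h4 h5 h6 n j jn].
  by rewrite !mulr_ge0.
have qa a i : nm a <= al -> nm (a * q ^+ i) <= al.
  move=> aal; have := nm_qX k01 qk (leq0n i); rewrite expr0 nmM => h.
  by rewrite (le_trans _ aal)// ler_piMr ?nm_ge0.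
rewrite /awcoef nmM (nmM (qbinom n j q)) (nmM (qpoch (P * _) q _)) nmV -[leRHS]mulrA ler_pM ?mulr_ge0 ?invr_ge0 ?nm_ge0//; last first.
  by apply: HA; rewrite ?leq_subr.
rewrite ler_pM ?mulr_ge0 ?invr_ge0 ?nm_ge0// ler_pM ?invr_ge0 ?nm_ge0//.
  by have /andP[] := Hm _ _ (n - j)%N (qa _ j h5) qk.
have /andP[m1 _] := Hm _ _ (n - j)%N (qa _ (n + j).-1 h6) qk.
by rewrite lef_pV2 ?posrE// (lt_le_trans m0 m1).
Qed.

Lemma succ_le_pow2 n : n.+1%:R <= 2 ^+ n :> R.
Proof. by rewrite -natrX ler_nat ltn_expl. Qed.

(** The n + 1 terms are estimated crudely by 2^n; the freedom in [dl] makes up for it. *)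
Lemma awsum_bound s P sg de (phi : nat -> C) (T A t dl : R) n : 0 <= T -> 0 <= A -> 0 <= t -> 0 <= dl <= t ->
  (forall j, (j <= n)%N -> nm (awcoef q s P sg de n j) <= T * dl ^+ (n - j)) ->
  (forall j, nm (phi j) <= A * t ^+ j) ->
  nm (awsum q s P sg de n phi) <= T * A * (2 * t) ^+ n.
Proof.
move=> T0 A0 t0 /andP[dl0 dlt] h1 h2.
rewrite (le_trans (nm_sum _ (fun j => awcoef q s P sg de n j * phi j)))//.
apply: (@le_trans _ _ (\sum_(j < n.+1) T * A * t ^+ n)).
  apply: ler_sum => j _; have jn : (j <= n)%N by rewrite -ltnS.
  have -> : t ^+ n = t ^+ (n - j) * t ^+ j by rewrite -exprD subnK.
  rewrite nmM (_ : T * A * _ = (T * t ^+ (n - j)) * (A * t ^+ j)); last by ring.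
  rewrite ler_pM ?nm_ge0// (le_trans (h1 _ jn))// ler_wpM2l//.
  by rewrite lerXn2r ?nnegrE.
rewrite sumr_const card_ord -[_ *+ n.+1]mulr_natl mulrCA ler_wpM2l ?mulr_ge0//.
by rewrite exprMn ler_wpM2r ?exprn_ge0// succ_le_pow2.
Qed.

Lemma inv_norm_bound s P c d : nm P < 1 -> nm (c * d) < 1 ->
  (forall i, 1 - c * s * q ^+ i + c ^+ 2 * P * (q ^+ i) ^+ 2 != 0) ->
  (forall i, 1 - d * s * q ^+ i + d ^+ 2 * P * (q ^+ i) ^+ 2 != 0) ->
  exists2 T : R, 0 <= T & forall i j n,
    nm (inv_norm q s P (q ^+ i * c) (q ^+ j * d) n) <= T.
Proof.
move=> P1 cd1 Hc Hd.
pose al := Num.max (Num.max (nm P) (nm (c * d))) k.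
have al01 : 0 <= al < 1 by rewrite !gt_max P1 cd1 k1 !le_max nm_ge0.
have [T1 T10 H1] := lin_bound Hc; have [T2 T20 H2] := lin_bound Hd.
have [m m0 Hm] := qpoch_bounds al01 k01.
have mi : 0 <= m^-1 by rewrite invr_ge0 ltW.
exists (m^-1 * m^-1 * (m^-1 * m^-1 * m^-1 * (T1 * T2))) => [|i j n]; first by rewrite !mulr_ge0.
have qle l y : nm (q ^+ l * y) <= nm y.
  have := nm_qX k01 qk (leq0n l); rewrite expr0 nmM => h.
  by rewrite -[leRHS]mul1r ler_wpM2r ?nm_ge0.
have cdal : nm (q ^+ i * c * (q ^+ j * d)) <= al.
  rewrite (_ : _ * _ = q ^+ (i + j) * (c * d)); last by rewrite exprD; ring.
  by rewrite (le_trans (qle _ _))// !le_max lexx orbT.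
have Pal : nm P <= al by rewrite !le_max lexx.
have ual : nm (P * (q ^+ i * c * (q ^+ j * d))) <= al.
  by rewrite nmM (le_trans _ cdal)// ler_piMl ?nm_ge0// ltW.
have ual' l : nm (P * (q ^+ i * c * (q ^+ j * d)) * q ^+ l) <= al.
  by rewrite mulrC (le_trans (qle _ _)).
have qal : nm q <= al by rewrite (le_trans qk)// le_max lexx orbT.
have up a l : nm a <= al -> nm (qpoch a q l) <= m^-1.
  by move=> aal; have /andP[] := Hm _ _ l aal qk.
have dn a l : nm a <= al -> (nm (qpoch a q l))^-1 <= m^-1.
  move=> aal; have /andP[m1 _] := Hm _ _ l aal qk.
  by rewrite lef_pV2 ?posrE// (lt_le_trans m0 m1).
rewrite /inv_norm !(nmM, nmV) !invfM.
by rewrite !ler_pM ?mulr_ge0 ?invr_ge0 ?nm_ge0 ?up ?dn.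
Qed.

(* Both bounds are uniform in the shifts; their product decays like 2^-n. *)
Lemma aw_dom x (X : C) s P c d : 2 * x = X + X^-1 -> X != 0 -> nm X^-1 <= nm X ->
  nm P < 1 -> nm (c * d) < 1 ->
  (forall i, 1 - c * s * q ^+ i + c ^+ 2 * P * (q ^+ i) ^+ 2 != 0) ->
  (forall i, 1 - d * s * q ^+ i + d ^+ 2 * P * (q ^+ i) ^+ 2 != 0) ->
  exists A1 A2 t1 t2 : R, [/\ [/\ 0 <= A1, 0 <= A2, 0 <= t1, 0 <= t2 & t1 * t2 < 1],
    forall i j n, let c' := q ^+ i * c in let d' := q ^+ j * d in
      nm (awpoly q s P (c' + d') (c' * d') x n) <= A1 * t1 ^+ n &
    forall i j n, let c' := q ^+ i * c in let d' := q ^+ j * d in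
      nm (inv_norm q s P c' d' n * bsum q s P (c' + d') (c' * d') n) <= A2 * t2 ^+ n].
Proof.
move=> xX X0 XX P1 cd1 Hc Hd.
(* [dl] is such that the final rates 2 [rx] and 2 [dl] multiply to 1/2. *)
pose rx := nm X + 1; pose dl := 1 / (8 * rx).
have rx1 : 1 <= rx by rewrite lerDr nm_ge0.
have rx0 : 0 < rx by apply: lt_le_trans rx1.
have dl0 : 0 < dl by rewrite divr_gt0// mulr_gt0.
have dlE : dl * rx = 1 / 8 by rewrite /dl; field; rewrite gt_eqF.
have dl1 : dl <= 1 by nra.
pose al := nm P; have al01 : 0 <= al < 1 by rewrite nm_ge0.
pose B := nm (c * d) * nm s + nm P * nm (c * d) ^+ 2 + (nm c + nm d) + nm (c * d) + nm s + nm P.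
have B0 : 0 <= B by rewrite !addr_ge0 ?mulr_ge0 ?sqr_ge0 ?nm_ge0.
have [T T0 HT] := awcoef_bound al01 B0 dl0.
have [Ti Ti0 HTi] := inv_norm_bound P1 cd1 Hc Hd.
have XB : 0 <= nm X < rx by rewrite nm_ge0 /rx ltrDl ltr01.
have [Ax Ax0 HAx] := U_growth k01 qk XB B0.
(* The sequence summed in [bsum] has both characteristic roots 0, so its rate can be taken small
   enough to outweigh the growth of [awpoly]. *)
have zB : 0 <= (0 : R) < dl by rewrite lexx.
have [Ab Ab0 HAb] := U_growth k01 qk zB B0.
have nn y : 0 <= nm y := nm_ge0 y.
have sB : nm s <= B.
  rewrite /B; have := mulr_ge0 (nn (c * d)) (nn s); have := mulr_ge0 (nn P) (sqr_ge0 (nm (c * d))).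
  have := nn c; have := nn d; have := nn (c * d); have := nn P; lra.
have PB : nm P <= B.
  rewrite /B; have := mulr_ge0 (nn (c * d)) (nn s); have := mulr_ge0 (nn P) (sqr_ge0 (nm (c * d))).
  have := nn c; have := nn d; have := nn (c * d); have := nn s; lra.
have qle l y : nm (q ^+ l * y) <= nm y.
  have := nm_qX k01 qk (leq0n l); rewrite expr0 nmM => h.
  by rewrite -[leRHS]mul1r ler_wpM2r ?nm_ge0.
have HE i j n l : (l <= n)%N -> nm (awcoef q s P (q ^+ i * c + q ^+ j * d)
    (q ^+ i * c * (q ^+ j * d)) n l) <= T * dl ^+ (n - l).
  have e1 : nm (q ^+ i * c * (q ^+ j * d)) <= nm (c * d).
    by rewrite (_ : _ * _ = q ^+ (i + j) * (c * d)) ?qle// exprD; ring.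
  have e2 : nm (q ^+ i * c + q ^+ j * d) <= nm c + nm d.
    by rewrite (le_trans (nmD _ _))// lerD.
  move: e1 e2; move: (q ^+ i * c + _) (q ^+ i * c * _) => sg de e1 e2.
  have f1 : nm (de * s) <= nm (c * d) * nm s by rewrite nmM ler_wpM2r.
  have f2 : nm (P * de ^+ 2) <= nm P * nm (c * d) ^+ 2.
    by rewrite nmM nmX ler_wpM2l// lerXn2r ?nnegrE.
  have g1 := mulr_ge0 (nn (c * d)) (nn s); have g2 := mulr_ge0 (nn P) (sqr_ge0 (nm (c * d))).
  have n1 := nn c; have n2 := nn d; have n3 := nn (c * d); have n4 := nn s; have n5 := nn P.
  apply: HT.
  - by rewrite /B; lra.
  - by rewrite /B; lra.
  - by rewrite /B; lra.
  - by rewrite /B; lra.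
  - by rewrite /al.
  - by rewrite nmM /al ler_piMr// (le_trans e1)// ltW.
have t2E : 2 * rx * (2 * dl) < 1 by lra.
exists (T * Ax), (Ti * (T * Ab)), (2 * rx), (2 * dl); split.
- have T3 := mulr_ge0 T0 Ab0; have h2 : 0 <= 2 * rx by lra. have h3 : 0 <= 2 * dl by lra.
  by split => //; exact: mulr_ge0.
- move=> i j n /=; apply: (awsum_bound (dl := dl)) => //; rewrite ?(ltW rx0)//.
  + by rewrite (ltW dl0) /=; exact: le_trans dl1 rx1.
  + exact: HE.
  + move=> l; rewrite xX -(divff X0); exact: HAx.
- move=> i j n /=; rewrite nmM -[leRHS]mulrA ler_pM ?nm_ge0//.
  apply: (awsum_bound (dl := dl)) => //; rewrite ?(ltW dl0) ?lexx//.
  + exact: HE.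
  + by move=> l; have := HAb s P 0 0 sB PB; rewrite nm0 addr0 mulr0; apply.
Qed.
End AskeyWilson.

Section AskeyWilsonLimit.
Variable R : realType.
Local Notation C := (cplx R).
Variables (q : C) (k : R).
Hypothesis k01 : 0 < k < 1.
Hypothesis qk : nm q <= k.
Implicit Types (x y z a b c d s P F : C).

Let HQ := subr1qXS_neq0 k01 qk.

(** Compared with [herm_step] the sums at c and at qc exchange places, as befits the reciprocal
    expansion. *)
Lemma aw_step x s P c d F F' (A1 A2 t1 t2 : R) :
  nm P < 1 -> nm (c * d) < 1 ->
  (forall i, 1 - c * s * q ^+ i + c ^+ 2 * P * (q ^+ i) ^+ 2 != 0) ->
  (forall i, 1 - d * s * q ^+ i + d ^+ 2 * P * (q ^+ i) ^+ 2 != 0) ->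
  0 <= t1 -> 0 <= t2 -> t1 * t2 < 1 ->
  (forall n, nm (awpoly q s P (c + d) (c * d) x n) <= A1 * t1 ^+ n) ->
  (forall n, nm (inv_norm q s P (q * c) d n * bsum q s P (q * c + d) (q * c * d) n)
     <= A2 * t2 ^+ n) ->
  series (aterm q x s P c d) @ \oo --> F ->
  series (aterm q x s P (q * c) d) @ \oo --> F' ->
  (1 - 2 * c * x + c ^+ 2) * F' = shift_const s P c d (P * (c * d)) * F.
Proof.
move=> P1 cd1 Hc Hd t10 t20 tt H1 H2 SF SF'.
have t01 : 0 <= t1 * t2 < 1 by rewrite mulr_ge0.
have u1 : nm (P * (c * d)) < 1.
  by rewrite nmM; have := nm_ge0 P; have := nm_ge0 (c * d); nra.
pose bd N : C := c * (inv_norm q s P (q * c) d N * bsum q s P (q * c + d) (q * c * d) N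
      * awpoly q s P (c + d) (c * d) x N.+1).
have E N : (1 - 2 * c * x + c ^+ 2) * series (aterm q x s P (q * c) d) N.+1 =
   shift_const s P c d (P * (c * d)) * series (aterm q x s P c d) N.+1 - bd N.
  rewrite [in LHS](series_ord (aterm q x s P (q * c) d) N.+1).
  rewrite (series_ord (aterm q x s P c d) N.+1) /aterm /bd -(mulrA q c d).
  rewrite (aw_partial HQ (erefl _) (fun i => subr1MqX_neq0 k01 qk i u1) (fun i => subr1MqX_neq0 k01 qk i P1)
    (fun i => subr1MqX_neq0 k01 qk i cd1) Hc Hd).
  by rewrite !mulrA.
have bd0 : bd @ \oo --> (0 : C).
  rewrite -(mulr0 c); apply: cvg_cmul.
  apply: (@cvg_geo0 _ (A1 * A2 * t1) (t1 * t2)) => // n.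
  rewrite nmM (_ : A1 * A2 * t1 * _ = (A2 * t2 ^+ n) * (A1 * t1 ^+ n.+1)).
    by rewrite ler_pM ?nm_ge0.
  by rewrite exprMn exprS; ring.
have h1 : (fun N => (1 - 2 * c * x + c ^+ 2) * series (aterm q x s P (q * c) d) N.+1) @ \oo -->
  (1 - 2 * c * x + c ^+ 2) * F'.
  exact: (cvg_cmul (cvg_shift1 SF')).
have h2 : (fun N => (1 - 2 * c * x + c ^+ 2) * series (aterm q x s P (q * c) d) N.+1) @ \oo -->
  shift_const s P c d (P * (c * d)) * F - 0.
  under eq_fun do rewrite E.
  exact: (cvgB (cvg_cmul (cvg_shift1 SF)) bd0).
by rewrite -[RHS]subr0; apply: cvg_unique h1 h2.
Qed.

Lemma atermC x s P c d : aterm q x s P c d = aterm q x s P d c.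
Proof.
apply/funext => n; rewrite /aterm /inv_norm (addrC c) (mulrC c).
by rewrite [lin_prod q s P c n * _]mulrC.
Qed.

Lemma inv_norm00 s P n : inv_norm q s P 0 0 n = (qpoch q q n * qpoch P q n)^-1.
Proof.
rewrite /inv_norm /lin_prod !big1; last first.
- by move=> i _; rewrite expr0n /= !mul0r subr0 addr0.
by rewrite mulr0 mulr0 mul0r !qpoch0l !mulr1 mul1r.
Qed.

Lemma awsum00 s P phi n : awsum q s P 0 0 n phi = phi n.
Proof.
rewrite /awsum big_ord_recr big1 /= ?add0r ?(awcoefnn HQ) ?mul1r//.
move=> j _; rewrite /awcoef -[(n - j)%N in X in _ * X * _]prednK ?subn_gt0//.
by rewrite gamS0 mulr0 mul0r.
Qed.

Definition aterm0 x s P n :=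
  (qpoch q q n * qpoch P q n)^-1 * U q s P 0 0 n * U q s P (2 * x) 1 n.

Lemma aterm00 x s P n : aterm q x s P 0 0 n = aterm0 x s P n.
Proof. by rewrite /aterm addr0 mulr0 inv_norm00 /bsum /awpoly !awsum00. Qed.

Lemma cvg_lin_prod s P (c : nat -> C) n : c @ \oo --> (0 : C) ->
  (fun N => lin_prod q s P (c N) n) @ \oo --> lin_prod q s P 0 n.
Proof.
move=> h; apply: (@cvg_prodn _ _ _ (fun N (j : 'I_n) => 1 - c N * s * q ^+ j + c N ^+ 2 * P * (q ^+ j) ^+ 2)) => j.
have cst (y : C) : (fun=> y) @ \oo --> y by exact: cvg_cst.
exact: (cvgD (cvgB (cst 1) (cvgM (cvgM h (cst s)) (cst _))) (cvgM (cvgM (cvg_sq h) (cst P)) (cst _))).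
Qed.

Lemma cvg_awsum s P (sg de : nat -> C) n phi : sg @ \oo --> (0 : C) -> de @ \oo --> (0 : C) ->
  (fun N => awsum q s P (sg N) (de N) n phi) @ \oo --> awsum q s P 0 0 n phi.
Proof.
move=> h1 h2; apply: (@cvg_sumn _ _ _ (fun N (j : 'I_n.+1) => awcoef q s P (sg N) (de N) n j * phi j)) => j.
have cst (y : C) : (fun=> y) @ \oo --> y by exact: cvg_cst.
have e1 : (fun N => de N * s * q ^+ n.-1) @ \oo --> 0 * s * q ^+ n.-1.
  exact: (cvgM (cvgM h2 (cst _)) (cst _)).
have e2 : (fun N => P * de N ^+ 2 * (q ^+ n.-1) ^+ 2) @ \oo --> P * 0 ^+ 2 * (q ^+ n.-1) ^+ 2.
  exact: (cvgM (cvg_cmul (cvg_sq h2)) (cst _)).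
have e3 : (fun N => qpoch (P * de N * q ^+ (n + j).-1) q (n - j)) @ \oo -->
   qpoch (P * 0 * q ^+ (n + j).-1) q (n - j).
  by apply: cvg_qpoch; exact: (cvgM (cvg_cmul h2) (cst _)).
have e4 : qpoch (P * 0 * q ^+ (n + j).-1) q (n - j) != 0.
  by rewrite mulr0 mul0r qpoch0l oner_neq0.
have e5 : (fun N => (qpoch (P * de N * q ^+ (n + j).-1) q (n - j))^-1) @ \oo -->
   (qpoch (P * 0 * q ^+ (n + j).-1) q (n - j))^-1 by exact: (cvgV e4 e3).
exact: (cvgM (cvgM (cvg_cmul (cvg_cmul e5)) (cvg_U h1 h2 e1 e2)) (cst _)).
Qed.

Lemma cvg_inv_norm s P c d n : nm P < 1 ->
  (fun N => inv_norm q s P (q ^+ N * c) (q ^+ N * d) n) @ \oo --> inv_norm q s P 0 0 n.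
Proof.
move=> P1; have cst (y : C) : (fun=> y) @ \oo --> y by exact: cvg_cst.
have e0 : (fun N => q ^+ N * c * (q ^+ N * d)) @ \oo --> (0 * 0 : C).
  by rewrite mulr0; exact: (cvg_prod_shift k01 qk c d).
have e1 : (fun N => qpoch (P * (q ^+ N * c * (q ^+ N * d))) q (2 * n)) @ \oo -->
  qpoch (P * (0 * 0)) q (2 * n) by apply: cvg_qpoch; exact: (cvg_cmul e0).
have e2 : (fun N => qpoch (P * (q ^+ N * c * (q ^+ N * d)) * q ^+ n.-1) q n) @ \oo -->
  qpoch (P * (0 * 0) * q ^+ n.-1) q n.
  by apply: cvg_qpoch; exact: (cvgM (cvg_cmul e0) (cst _)).
have e3 : (fun N => qpoch (q ^+ N * c * (q ^+ N * d)) q n) @ \oo --> qpoch (0 * 0) q n.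
  by apply: cvg_qpoch; exact: e0.
have e4 : (fun N => lin_prod q s P (q ^+ N * c) n) @ \oo --> lin_prod q s P 0 n.
  by apply: cvg_lin_prod; exact: (cvg_qpow k01 qk c).
have e5 : (fun N => lin_prod q s P (q ^+ N * d) n) @ \oo --> lin_prod q s P 0 n.
  by apply: cvg_lin_prod; exact: (cvg_qpow k01 qk d).
have e6 : (fun N => qpoch q q n * qpoch P q n * qpoch (q ^+ N * c * (q ^+ N * d)) q n *
    (lin_prod q s P (q ^+ N * c) n * lin_prod q s P (q ^+ N * d) n)) @ \oo -->
   qpoch q q n * qpoch P q n * qpoch (0 * 0) q n * (lin_prod q s P 0 n * lin_prod q s P 0 n).
  exact: (cvgM (cvg_cmul e3) (cvgM e4 e5)).
have e7 : qpoch q q n * qpoch P q n * qpoch (0 * 0) q n * (lin_prod q s P 0 n * lin_prod q s P 0 n) != 0.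
  rewrite !mulf_neq0//.
  - exact: qpochq_neq0.
  - by apply: qpoch_neq0 => i; exact: (subr1MqX_neq0 k01 qk i P1).
  - by rewrite mulr0 qpoch0l oner_neq0.
  - by apply/prodf_neq0 => i _; rewrite expr0n /= !mul0r subr0 addr0 oner_neq0.
  - by apply/prodf_neq0 => i _; rewrite expr0n /= !mul0r subr0 addr0 oner_neq0.
have e8 : (fun N => (qpoch q q n * qpoch P q n * qpoch (q ^+ N * c * (q ^+ N * d)) q n *
    (lin_prod q s P (q ^+ N * c) n * lin_prod q s P (q ^+ N * d) n))^-1) @ \oo -->
   (qpoch q q n * qpoch P q n * qpoch (0 * 0) q n * (lin_prod q s P 0 n * lin_prod q s P 0 n))^-1.
  exact: (cvgV e7 e6).
exact: (cvgM (cvgM e1 e2) e8).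
Qed.

Lemma aw_limit x (X s P c d : C) :
  2 * x = X + X^-1 -> X != 0 -> nm X^-1 <= nm X ->
  nm P < 1 -> nm (c * d) < 1 ->
  (forall i, 1 - c * s * q ^+ i + c ^+ 2 * P * (q ^+ i) ^+ 2 != 0) ->
  (forall i, 1 - d * s * q ^+ i + d ^+ 2 * P * (q ^+ i) ^+ 2 != 0) ->
  exists F F0 : C,
  [/\ series (aterm q x s P c d) @ \oo --> F,
      series (aterm0 x s P) @ \oo --> F0 &
      forall W L Q1 Q2 : C,
      (fun N => \prod_(j < N) ((1 - 2 * (q ^+ j * c) * x + (q ^+ j * c) ^+ 2)
          * (1 - 2 * (q ^+ j * d) * x + (q ^+ j * d) ^+ 2))) @ \oo --> W ->
      (fun N => lin_prod q s P c N * lin_prod q s P d N) @ \oo --> L ->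
      (fun N => qpoch (c * d) q N) @ \oo --> Q1 ->
      (fun N => qpoch (P * (c * d)) q N) @ \oo --> Q2 -> Q2 != 0 ->
      L * Q1 / Q2 * F = W * F0].
Proof.
move=> xX X0 XX P1 cd1 Hc Hd.
have [A1 [A2 [t1 [t2 [[A10 A20 t10 t20 tt] H1 H2]]]]] := aw_dom k01 qk xX X0 XX P1 cd1 Hc Hd.
rewrite /= in H1 H2.
have q1 i y : nm (q ^+ i * y) <= nm y.
  have := nm_qX k01 qk (leq0n i); rewrite expr0 nmM => h.
  by rewrite -[leRHS]mul1r ler_wpM2r ?nm_ge0.
have hd i j n : nm (aterm q x s P (q ^+ i * c) (q ^+ j * d) n) <= A2 * A1 * (t1 * t2) ^+ n.
  rewrite /aterm nmM exprMn (_ : _ * (_ * _) = (A2 * t2 ^+ n) * (A1 * t1 ^+ n)); last by ring.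
  by rewrite ler_pM ?nm_ge0.
have t01 : 0 <= t1 * t2 < 1 by rewrite mulr_ge0.
have AA : 0 <= A2 * A1 by rewrite mulr_ge0.
have lim0 n : (fun N => aterm q x s P (q ^+ N * c) (q ^+ N * d) n) @ \oo --> aterm0 x s P n.
  have h1 := cvg_sum_shift k01 qk c d; have h2 := cvg_prod_shift k01 qk c d.
  have -> : aterm0 x s P n = inv_norm q s P 0 0 n * bsum q s P 0 0 n * awpoly q s P 0 0 x n.
    by rewrite -aterm00 /aterm addr0 mulr0.
  have i1 : (fun N => inv_norm q s P (q ^+ N * c) (q ^+ N * d) n) @ \oo --> inv_norm q s P 0 0 n.
    by apply: cvg_inv_norm; exact: P1.
  have i2 phi : (fun N => awsum q s P (q ^+ N * c + q ^+ N * d) (q ^+ N * c * (q ^+ N * d)) n phi)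
      @ \oo --> awsum q s P 0 0 n phi by apply: cvg_awsum; [exact: h1|exact: h2].
  exact: (cvgM (cvgM i1 (i2 _)) (i2 _)).
(* The termwise limits inherit the uniform majorant, which yields convergence of the limit
   series. *)
have Hc00 : exists F : C, series (aterm0 x s P) @ \oo --> F.
  apply/cvg_ex; apply: (geo_cvg t01 AA) => n.
  apply/ler_addgt0Pr => e e0.
  move/cvg_nm: (lim0 n) => /(_ e e0) [N _ /(_ N (leqnn _))] /= H.
  have h3 := nmD (aterm0 x s P n - aterm q x s P (q ^+ N * c) (q ^+ N * d) n)
    (aterm q x s P (q ^+ N * c) (q ^+ N * d) n).
  by move: h3 H (hd N N n); rewrite subrK nm_dist; lra.
pose G i j := limn (series (aterm q x s P (q ^+ i * c) (q ^+ j * d))).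
have HG i j : series (aterm q x s P (q ^+ i * c) (q ^+ j * d)) @ \oo --> G i j.
  exact: (geo_cvg t01 AA (hd i j)).
have [F0 HF0] := Hc00.
have := HG 0%N 0%N; rewrite !expr0 !mul1r => HG0.
exists (G 0%N 0%N), F0; split=> // W L Q1 Q2 HW HL HQ1 HQ2 Q20.
have q_c i y : q ^+ i.+1 * y = q * (q ^+ i * y) by rewrite exprS mulrA.
have Hc' i j : 1 - q ^+ i * c * s * q ^+ j + (q ^+ i * c) ^+ 2 * P * (q ^+ j) ^+ 2 != 0.
  by move: (Hc (i + j)%N); apply: contra_neq => <-; rewrite exprD; ring.
have Hd' i j : 1 - q ^+ i * d * s * q ^+ j + (q ^+ i * d) ^+ 2 * P * (q ^+ j) ^+ 2 != 0.
  by move: (Hd (i + j)%N); apply: contra_neq => <-; rewrite exprD; ring.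
have step N : double_const q s P (q ^+ N * c) (q ^+ N * d) * G N N =
    (1 - 2 * (q ^+ N * c) * x + (q ^+ N * c) ^+ 2)
    * (1 - 2 * (q ^+ N * d) * x + (q ^+ N * d) ^+ 2) * G N.+1 N.+1.
  have ul i j : nm (q ^+ i * c * (q ^+ j * d)) < 1.
    rewrite (_ : _ * _ = q ^+ (i + j) * (c * d)); last by rewrite exprD; ring.
    exact: le_lt_trans (q1 _ _) cd1.
  have u3 := ul N.+1 N.
  have a1 := H1 N N; have a2 := H1 N.+1 N.
  have b1 := H2 N.+1 N; have b2 := H2 N.+1 N.+1.
  have s1 := HG N N; have s2 := HG N.+1 N; have s3 := HG N.+1 N.+1.
  have c1 := Hc' N; have c2 := Hc' N.+1; have d1 := Hd' N.
  move: (ul N N) u3 a1 a2 b1 b2 s1 s2 s3 c1 c2 d1; rewrite !q_c.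
  move: (q ^+ N * c) (q ^+ N * d) (G N N) (G N.+1 N) (G N.+1 N.+1).
  move=> c' d' g0 g1 g2 u3 u4 a1 a2 b1 b2 s1 s2 s3 c1 c2 d1.
  have E1 := aw_step P1 u3 c1 d1 t10 t20 tt a1 b1 s1 s2.
  apply: (mul_chain (esym E1)); apply/esym.
  apply: (aw_step P1 _ d1 c2 t10 t20 tt (A1 := A1) (A2 := A2)).
  - by move: u4; rewrite (mulrC d').
  - by move=> n; move: (a2 n); rewrite (addrC d') (mulrC d').
  - move=> n; move: (b2 n); rewrite (addrC (q * d')) (mulrC (q * d') (q * c')).
    suff -> : inv_norm q s P (q * d') (q * c') n = inv_norm q s P (q * c') (q * d') n by [].
    by rewrite /inv_norm (mulrC (q * d')) [lin_prod q s P (q * d') n * _]mulrC.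
  - by rewrite atermC; exact: s2.
  - by rewrite atermC; exact: s3.
have iter N : \prod_(j < N) double_const q s P (q ^+ j * c) (q ^+ j * d) * G 0%N 0%N =
    \prod_(j < N) ((1 - 2 * (q ^+ j * c) * x + (q ^+ j * c) ^+ 2)
          * (1 - 2 * (q ^+ j * d) * x + (q ^+ j * d) ^+ 2)) * G N N.
  elim: N => [|N IH]; first by rewrite !big_ord0 !mul1r.
  rewrite big_ord_recr [in RHS]big_ord_recr /=.
  exact: mul_chain IH (step N).
have GF0 : (fun N => G N N) @ \oo --> F0.
  exact: (tannery t01 AA (fun N => hd N N) lim0 (fun N => HG N N) HF0).
have h1 : (fun N => \prod_(j < N) ((1 - 2 * (q ^+ j * c) * x + (q ^+ j * c) ^+ 2)
          * (1 - 2 * (q ^+ j * d) * x + (q ^+ j * d) ^+ 2)) * G N N) @ \oo --> W * F0.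
  exact: (cvgM HW GF0).
have h2 : (fun N => \prod_(j < N) ((1 - 2 * (q ^+ j * c) * x + (q ^+ j * c) ^+ 2)
          * (1 - 2 * (q ^+ j * d) * x + (q ^+ j * d) ^+ 2)) * G N N) @ \oo --> L * Q1 / Q2 * G 0%N 0%N.
  under eq_fun do rewrite -iter (double_constE k01 qk _ _ P1 (ltW cd1)).
  exact: (cvgM (cvgM (cvgM HL (cvg_double HQ1)) (cvgV Q20 (cvg_double HQ2))) (@cvg_cst _ _ _ _ _)).
exact: cvg_unique h2 h1.
Qed.
End AskeyWilsonLimit.

(** * The two expansions *)

Section Degenerate.
Variables (K : fieldType) (q : K).
Hypothesis Hq : forall i, 1 - q ^+ i.+1 != 0.

Lemma U0000 m : U q 0 0 0 0 m.+1 = 0.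
Proof.
elim: m => [|m IH]; first by rewrite /= subrr.
by rewrite U_rec IH; ring.
Qed.

(** Numerator and denominator of the generating function cancel. *)
Lemma conn_diag s P n phi : conn q s P s P n phi = phi n.
Proof.
have Z m : U q s P s P m.+1 = 0.
  elim/nat_ind2: m => [||m IH0 IH1]; [by rewrite /= subrr| |].
    by rewrite /= expr0 !subrr; ring.
  by rewrite U_rec IH0 IH1; ring.
rewrite /conn big_ord_recr big1 /=.
  by rewrite add0r qbinomnn// subnn !mul1r.
by move=> j _; rewrite -[(n - j)%N]prednK ?subn_gt0// Z mulr0 mul0r.
Qed.

(** With sg = a + b and de = ab this identifies the series at (0,0,a,b) with the limit series of the
    first round; [bsum_P0], [awpoly_P0] and [inv_norm_P0] do the same for the second expansion. *)
Lemma ubar_P0 sg de n : ubar q 0 0 sg de n = U q 0 0 sg de n.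
Proof.
by rewrite /ubar conn_diag /awmom !mul0r !qpoch0l invr1 !mul1r /mom_num !(mulr0, mul0r).
Qed.

Lemma awcoef_P0 sg de n j : awcoef q 0 0 sg de n j = qbinom n j q * U q sg de 0 0 (n - j).
Proof. by rewrite /awcoef /gam !(mul0r, mulr0) !qpoch0l divr1 mulr1. Qed.

Lemma bsum_P0 sg de n : bsum q 0 0 sg de n = U q sg de 0 0 n.
Proof.
rewrite /bsum /awsum big_ord_recl big1 ?addr0 => [|i _]; last by rewrite lift0 U0000 mulr0.
by rewrite awcoef_P0 qbinom0// subn0 mul1r mulr1.
Qed.

Lemma awpoly_P0 sg de x n : awpoly q 0 0 sg de x n = U q sg de (2 * x) 1 n.
Proof.
rewrite -(conn_U Hq sg de 0 0); apply: eq_bigr => j _.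
by rewrite awcoef_P0.
Qed.

Lemma inv_norm_P0 c d n : inv_norm q 0 0 c d n = (qpoch q q n * qpoch (c * d) q n)^-1.
Proof.
rewrite /inv_norm /lin_prod !big1; last first.
- by move=> i _; rewrite !(mulr0, mul0r) subr0 addr0.
- by move=> i _; rewrite !(mulr0, mul0r) subr0 addr0.
by rewrite !mul0r !qpoch0l !mulr1 mul1r.
Qed.

Lemma c_n0_bsum y z r1 r2 n : (forall i, 1 - r1 ^+ 2 * r2 ^+ 2 * q ^+ i != 0) ->
  (forall i, 1 - r1 ^+ 2 * q ^+ i != 0) ->
  c n 0 y r1 z r2 q = bsum q (2 * r1 * y) (r1 ^+ 2) (2 * r2 * z) (r2 ^+ 2) n.
Proof.
move=> Hu HP; have := c_awsum Hq y z Hu HP n (fun k => (k == 0%N)%:R).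
rewrite big_ord_recl big1 ?addr0 => [|i _]; last by rewrite /= mulr0.
rewrite /= mulr1 => ->; apply: eq_bigr => i _; congr (_ * _).
rewrite /conn big_ord_recl big1 ?addr0 => [|j _]; last by rewrite /= mulr0.
by rewrite /= mulr1 qbinom0// mul1r subn0.
Qed.
End Degenerate.

Section Final.
Variable R : realType.
Local Notation C := (cplx R).
Variables (q : C) (k : R).
Hypothesis k01 : 0 < k < 1.
Hypothesis qk : nm q <= k.
Implicit Types (x y z a b c d s P F : C).

Let HQ := subr1qXS_neq0 k01 qk.

Lemma w_dom x y (r : C) : exists2 B : R, 0 <= B &
  forall j, nm (w x y (r * q ^+ j) - 1) <= B * k ^+ j.
Proof.
pose B := nm (- (4 * x * y * r)) + nm (4 * r ^+ 2 * (x ^+ 2 + y ^+ 2) - 2 * r ^+ 2)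
  + nm (- (4 * x * y * r ^+ 3)) + nm (r ^+ 4).
exists B => [|j]; first by rewrite !addr_ge0 ?nm_ge0.
set t := q ^+ j.
have tm m : nm (t ^+ m.+1) <= k ^+ j.
  by rewrite -exprM; apply: nm_qX => //; rewrite leq_pmulr.
rewrite (_ : w x y (r * t) - 1 = - (4 * x * y * r) * t ^+ 1
  + (4 * r ^+ 2 * (x ^+ 2 + y ^+ 2) - 2 * r ^+ 2) * t ^+ 2
  + - (4 * x * y * r ^+ 3) * t ^+ 3 + r ^+ 4 * t ^+ 4); last by rewrite /w; ring.
have gen (a1 a2 a3 a4 : C) : nm (a1 * t ^+ 1 + a2 * t ^+ 2 + a3 * t ^+ 3 + a4 * t ^+ 4)
    <= (nm a1 + nm a2 + nm a3 + nm a4) * k ^+ j.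
  have h (e : C) m : nm (e * t ^+ m.+1) <= nm e * k ^+ j by rewrite nmM ler_wpM2l ?nm_ge0.
  rewrite !mulrDl (le_trans (nmD _ _))// lerD// (le_trans (nmD _ _))// lerD//.
  by rewrite (le_trans (nmD _ _))// lerD.
exact: gen.
Qed.

Lemma cvg_w x y (r : C) :
  (fun n => \prod_(j < n) w x y (r * q ^+ j)) @ \oo --> prod_inf (fun j => w x y (r * q ^+ j)).
Proof.
have [B B0 HB] := w_dom x y r.
have k01' : 0 <= k < 1 by case/andP: k01 => /ltW -> ->.
exact: (prod_cvg k01' B0 HB).
Qed.

Lemma w_inf_neq0 x y (r : C) : (forall j, w x y (r * q ^+ j) != 0) ->
  prod_inf (fun j => w x y (r * q ^+ j)) != 0.
Proof.
move=> H; have [B B0 HB] := w_dom x y r.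
by apply: (prod_lim_neq0 k01 B0 HB H); exact: cvg_w.
Qed.

Lemma q_dom a j : nm (1 - a * q ^+ j - 1) <= nm a * k ^+ j.
Proof.
rewrite (_ : _ - 1 = - (a * q ^+ j)); last by ring.
by rewrite nmN nmM ler_wpM2l ?nm_ge0//; apply: nm_qX.
Qed.

Lemma cvg_qinf a : (fun n => qpoch a q n) @ \oo --> qpoch_inf a q.
Proof.
have k01' : 0 <= k < 1 by case/andP: k01 => /ltW -> ->.
exact: (prod_cvg k01' (nm_ge0 a) (q_dom a)).
Qed.

Lemma qinf_neq0 a : nm a < 1 -> qpoch_inf a q != 0.
Proof.
move=> a1.
apply: (prod_lim_neq0 k01 (nm_ge0 a) (q_dom a) (fun j => subr1MqX_neq0 k01 qk j a1)).
exact: cvg_qinf.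
Qed.

Lemma wC x y (a : C) : w x y a = w y x a.
Proof. by rewrite /w; ring. Qed.

(** The root of larger modulus is selected because it governs the growth of h_n(x). *)
Lemma unit_pair x : exists X : C, [/\ 2 * x = X + X^-1, X != 0 & nm X^-1 <= nm X].
Proof.
have [X1 [X2 [E1 E2]]] := @factor2 C (2 * x) 1.
have n1 : X1 != 0 by apply/eqP => e; move: E2; rewrite e mul0r => /eqP; rewrite eq_sym oner_eq0.
have e2 : X2 = X1^-1 by rewrite -[X1^-1]mulr1 -E2 mulKf.
have [h|h] := leP (nm X1^-1) (nm X1).
  by exists X1; split=> //; rewrite -e2.
exists X1^-1; rewrite invrK invr_eq0; split=> //; last exact: ltW.
by rewrite -e2 addrC.
Qed.

(** Otherwise t = 1/(XY) would satisfy |t| <= |r| and be a zero of w(x,y|t). *)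
Lemma conv_pair x y (r : C) (X Y : C) : 2 * x = X + X^-1 -> X != 0 ->
  2 * y = Y + Y^-1 -> Y != 0 -> (forall t : C, `|t| <= `|r| -> w x y t != 0) ->
  nm (r * Y) * nm X < 1.
Proof.
move=> xX X0 yY Y0 H; rewrite -nmM ltNge; apply/negP => h.
pose t := (X * Y)^-1.
have XY0 : 0 < nm (X * Y) by rewrite nm_gt0 mulf_neq0.
have tr : `|t| <= `|r|.
  rewrite !nmE lerC /t nmV -div1r ler_pdivrMr// -nmM.
  by rewrite (_ : r * (X * Y) = r * Y * X)//; ring.
have /negP := H t tr; apply; apply/eqP.
have := @w_split R x y Y Y^-1 t 1; rewrite !mulr1 mul1r expr1n => <-.
- have -> : t * Y = X^-1 by rewrite /t; field; rewrite X0 Y0.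
  rewrite (_ : 2 * X^-1 * x = X^-1 * (2 * x)); last by ring.
  rewrite xX; have -> : 1 - X^-1 * (X + X^-1) + X^-1 ^+ 2 = 0 by field.
  by rewrite mul0r.
- by rewrite -yY.
- by rewrite divff.
Qed.

Section Params.
Variables (y z rho1 rho2 : C).
Hypothesis r11 : nm rho1 < 1.
Hypothesis r21 : nm rho2 < 1.
Local Notation s := (2 * rho1 * y).
Local Notation P := (rho1 ^+ 2).

Let P1 : nm P < 1. Proof. by rewrite nmX expr_lt1 ?nm_ge0. Qed.
Let D1 : nm (rho2 ^+ 2) < 1. Proof. by rewrite nmX expr_lt1 ?nm_ge0. Qed.
Let u1 : nm (P * rho2 ^+ 2) < 1.
Proof. by rewrite nmM; have := nm_ge0 P; have := nm_ge0 (rho2 ^+ 2); have := P1; have := D1; nra. Qed.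

Definition u_term x n : C := h n x q / qpoch q q n
        * \sum_(s < n.+1)
            qbinom n s q
            * (rho1 ^+ (n - s) * rho2 ^+ s * qpoch (rho1 ^+ 2) q s
               / qpoch (rho1 ^+ 2 * rho2 ^+ 2) q s)
            * h (n - s) y q * p s z y (rho1 * rho2) q.

Definition v_term x n : C :=
  let P := rho1 ^+ 2 * rho2 ^+ 2 * q ^+ n.-1 in
        alpha n x y rho1 z rho2 q
        / (qpoch q q n * \prod_(j < n) w z y (rho1 * rho2 * q ^+ j))
        * (qpoch (rho1 ^+ 2 * rho2 ^+ 2) q (2 * n) / qpoch (rho2 ^+ 2) q n)
        * \sum_(s < n.+1)
            qbinom n s q
            * (rho2 ^+ (n - s) * rho1 ^+ s * qpoch P q s
               / qpoch (rho1 ^+ 2) q s)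
            * b s y q * g (n - s) z y (rho1 * rho2 * q ^+ n.-1) q.

Variables (c d : C).
Hypothesis cdE : c + d = 2 * rho2 * z.
Hypothesis cdP : c * d = rho2 ^+ 2.

Lemma prod_w x n :
  \prod_(j < n) ((1 - 2 * (q ^+ j * c) * x + (q ^+ j * c) ^+ 2)
          * (1 - 2 * (q ^+ j * d) * x + (q ^+ j * d) ^+ 2)) =
  \prod_(j < n) w x z (rho2 * q ^+ j).
Proof. by apply: eq_bigr => j _; rewrite (w_split x _ cdE cdP). Qed.

(** This is [w_split] with y in place of x and t = rho1 q^j. *)
Lemma lin_w j :
  (1 - c * s * q ^+ j + c ^+ 2 * P * (q ^+ j) ^+ 2)
  * (1 - d * s * q ^+ j + d ^+ 2 * P * (q ^+ j) ^+ 2) =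
  w y z (rho1 * rho2 * q ^+ j).
Proof.
have := w_split y (rho1 * q ^+ j) cdE cdP.
rewrite (_ : rho2 * (rho1 * q ^+ j) = rho1 * rho2 * q ^+ j); last by ring.
by move=> <-; ring.
Qed.

Lemma lin_prod_w n :
  lin_prod q s P c n * lin_prod q s P d n = \prod_(j < n) w y z (rho1 * rho2 * q ^+ j).
Proof. by rewrite /lin_prod -big_split; apply: eq_bigr => j _; exact: lin_w. Qed.

Lemma u_termE x : u_term x = hterm q x s P c d.
Proof.
apply/funext => n; rewrite /u_term /hterm /hermc /ubar cdE cdP -ubarE -h_U.
by [].
Qed.

(** The factor (rho1^2)_n / (rho1^2 rho2^2 q^(n-1))_n of c_{n,0} cancels against the same symbols in
    [inv_norm]. *)
Lemma v_termE x : v_term x = aterm q x s P c d.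
Proof.
apply/funext => n; rewrite /v_term /aterm /awpoly cdE cdP -alphaE.
have Hu i : 1 - P * rho2 ^+ 2 * q ^+ i != 0 by exact: (subr1MqX_neq0 k01 qk i u1).
have HP i : 1 - P * q ^+ i != 0 by exact: (subr1MqX_neq0 k01 qk i P1).
rewrite -(c_n0_bsum HQ y z n Hu HP) /Defs.c addn0 subn0 qbinom0// expr0 mulr1.
rewrite /inv_norm cdP lin_prod_w.
have -> : \prod_(j < n) w z y (rho1 * rho2 * q ^+ j) = \prod_(j < n) w y z (rho1 * rho2 * q ^+ j).
  by apply: eq_bigr => j _; rewrite wC.
have n1 : qpoch P q n != 0 by exact: qpoch_neq0.
have n2 : qpoch (P * rho2 ^+ 2 * q ^+ n.-1) q n != 0.
  by apply: qpoch_neq0 => i; rewrite -(mulrA (P * rho2 ^+ 2)) -exprD.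
move: (alpha _ _ _ _ _ _ _) n1 n2 => al n1 n2.
set S1 := \sum_(s < n.+1) _.
have n3 := qpochq_neq0 HQ n.
have n4 : qpoch (rho2 ^+ 2) q n != 0.
  by apply: qpoch_neq0 => i; exact: (subr1MqX_neq0 k01 qk i D1).
rewrite !invfM; move: S1 n1 n2 n3 n4; move: (\prod_(j < n) _) => W S1.
move: W^-1 => iW; move: (qpoch P q n) (qpoch (P * rho2 ^+ 2 * q ^+ n.-1) q n) (qpoch q q n)
  (qpoch (rho2 ^+ 2) q n) (qpoch _ q (2 * n)) => Q1 Q2 Q3 Q4 Q5 n1 n2 n3 n4.
by field; rewrite ?n1 ?n2 ?n3 ?n4.
Qed.

Lemma hterm_lim0 x : series (fun n => hermc q x n * U q 0 0 0 0 n) @ \oo --> (1 : C).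
Proof.
rewrite -(cvg_shiftS (series _)); apply: cvg_near_cst; near=> n.
rewrite /= series_ord big_ord_recl big1 ?addr0 => [|i _]; last by rewrite lift0 U0000 mulr0.
by rewrite /hermc qpoch0 /= divr1 mulr1.
Unshelve. all: by end_near. Qed.

Lemma aterm_lim0 x : series (aterm0 q x 0 0) @ \oo --> (1 : C).
Proof.
rewrite -(cvg_shiftS (series _)); apply: cvg_near_cst; near=> n.
rewrite /= series_ord big_ord_recl big1 ?addr0 => [|i _].
  by rewrite /aterm0 !qpoch0 /= mulr1 invr1 !mulr1.
by rewrite /aterm0 lift0 U0000 mulr0 mul0r.
Unshelve. all: by end_near. Qed.

Lemma f_C2N_E x : (forall j, w x y (rho1 * q ^+ j) != 0) ->
  (forall j, w x z (rho2 * q ^+ j) != 0) ->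
  f_C2N x y rho1 z rho2 q = f_h x q *
   (qpoch_inf P q * qpoch_inf (rho2 ^+ 2) q * prod_inf (fun j => w y z (rho1 * rho2 * q ^+ j))
    / (qpoch_inf (P * rho2 ^+ 2) q * (prod_inf (fun j => w x y (rho1 * q ^+ j))
       * prod_inf (fun j => w x z (rho2 * q ^+ j))))).
Proof.
move=> H1 H2; rewrite /f_C2N; congr (_ * (_ / (_ * _))).
apply: cvg_lim => //; under eq_fun do rewrite big_split.
have c1 : (fun n => \prod_(j < n) w x y (rho1 * q ^+ j)) @ \oo -->
  prod_inf (fun j => w x y (rho1 * q ^+ j)) by exact: cvg_w.
have c2 : (fun n => \prod_(j < n) w x z (rho2 * q ^+ j)) @ \oo -->
  prod_inf (fun j => w x z (rho2 * q ^+ j)) by exact: cvg_w.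
exact: (cvgM c1 c2).
Qed.

Lemma shift_pair (r t : C) : exists Y : C, [/\ 2 * t = Y + Y^-1, Y != 0 &
  r * Y + r * Y^-1 = 2 * r * t /\ r * Y * (r * Y^-1) = r ^+ 2].
Proof.
have [Y [yY Y0 _]] := unit_pair t; exists Y; split=> //; split.
  by rewrite -mulrDr -yY; ring.
by field.
Qed.
End Params.

Lemma lin_prod_P0 (c d : C) n : lin_prod q 0 0 c n * lin_prod q 0 0 d n = 1.
Proof. by rewrite /lin_prod !big1 ?mulr1// => j _; ring. Qed.

Lemma cvg_limE (v : nat -> C) F : v @ \oo --> F -> cvgn v /\ limn v = F.
Proof.
move=> vF; split; last exact: cvg_lim vF.
by apply/cvg_ex; exists F; exact: vF.
Qed.

Lemma first_expansion x y z rho1 rho2 : nm rho1 < 1 -> nm rho2 < 1 ->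
  conv_domain x y rho1 z rho2 ->
  cvgn (series (u_term y z rho1 rho2 x)) /\
  f_C2N x y rho1 z rho2 q = f_h x q * limn (series (u_term y z rho1 rho2 x)).
Proof.
move=> r11 r21 [D1 D2].
have [X [xX X0 XX]] := unit_pair x.
have [Y [yY Y0 [sE PE]]] := shift_pair rho1 y.
have [Z [zZ Z0 [cdE cdP]]] := shift_pair rho2 z.
have a1 := conv_pair xX X0 yY Y0 D1; have c1 := conv_pair xX X0 zZ Z0 D2.
have yV : 2 * y = Y^-1 + Y^-1^-1 by rewrite invrK addrC.
have zV : 2 * z = Z^-1 + Z^-1^-1 by rewrite invrK addrC.
have Yv : Y^-1 != 0 by rewrite invr_eq0.
have Zv : Z^-1 != 0 by rewrite invr_eq0.
have b1 := conv_pair xX X0 yV Yv D1; have d1 := conv_pair xX X0 zV Zv D2.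
move: (rho1 * Y) (rho1 * Y^-1) (rho2 * Z) (rho2 * Z^-1) sE PE cdE cdP a1 b1 c1 d1.
move=> a b c d sE PE cdE cdP a1 b1 c1 d1.
have nX : 0 < nm X by rewrite nm_gt0.
pose rho := Num.max (Num.max (nm a) (nm b)) (Num.max (nm c) (nm d)).
have rX : rho * nm X < 1.
  by rewrite -ltr_pdivlMr// !gt_max !ltr_pdivlMr// a1 b1 c1 d1.
have ar : nm a <= rho by rewrite !le_max lexx.
have br : nm b <= rho by rewrite !le_max lexx orbT.
have cr : nm c <= rho by rewrite !le_max lexx !orbT.
have dr : nm d <= rho by rewrite !le_max lexx !orbT.
have rho0 : 0 <= rho by rewrite (le_trans _ ar)// nm_ge0.
have P1 : nm (rho1 ^+ 2) < 1 by rewrite nmX expr_lt1 ?nm_ge0.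
have Q1 : nm (rho2 ^+ 2) < 1 by rewrite nmX expr_lt1 ?nm_ge0.
have u1 : nm (rho1 ^+ 2 * rho2 ^+ 2) < 1.
  by rewrite nmM; have := nm_ge0 (rho1 ^+ 2); have := nm_ge0 (rho2 ^+ 2); nra.
have P1' := P1; have Q1' := Q1; rewrite -PE in P1'; rewrite -cdP in Q1'.
have [F [F0 [SF SF0 HF]]] := herm_limit k01 qk xX X0 XX ar br cr dr rX P1' Q1'.
have z1 : nm (0 * 0 : C) < 1 by rewrite mulr0 nm0 ltr01.
have zr : nm (0 : C) <= rho by rewrite nm0.
(* Second round, at (0,0,a,b): it starts from the limit series of the first round, and its own limit
   is 1. *)
have [G [G0 [SG SG0 HG]]] := herm_limit k01 qk xX X0 XX zr zr ar br rX z1 P1'.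
rewrite sE PE in SF SF0 HF; rewrite addr0 mulr0 in SG SG0 HG.
have GF : G = F0.
  have e : hterm q x 0 0 a b = (fun n => hermc q x n * U q 0 0 (2 * rho1 * y) (rho1 ^+ 2) n).
    by apply/funext => n; rewrite /hterm ubar_P0// ?sE ?PE//; exact: HQ.
  by rewrite e in SG; exact: cvg_unique SG SF0.
have G1 : G0 = 1 by exact: cvg_unique SG0 (hterm_lim0 x).
have wt (r : C) j : `|r * q ^+ j| <= `|r|.
  rewrite !nmE lerC nmM; have := nm_qX k01 qk (leq0n j); rewrite expr0 => h.
  by rewrite ler_piMr ?nm_ge0.
have w1 j : w x y (rho1 * q ^+ j) != 0 by exact: D1.
have w2 j : w x z (rho2 * q ^+ j) != 0 by exact: D2.
have n1 := w_inf_neq0 w1; have n2 := w_inf_neq0 w2.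
have n3 := qinf_neq0 P1; have n4 := qinf_neq0 Q1; have n5 := qinf_neq0 u1.
have cst1 : (fun=> 1 : C) @ \oo --> (1 : C) by exact: cvg_cst.
have E1 : prod_inf (fun j => w x z (rho2 * q ^+ j)) * F =
  prod_inf (fun j => w y z (rho1 * rho2 * q ^+ j)) * qpoch_inf (rho2 ^+ 2) q
  / qpoch_inf (rho1 ^+ 2 * rho2 ^+ 2) q * F0.
  apply: HF; last exact: n5.
  - under eq_fun do rewrite (prod_w cdE cdP); exact: cvg_w.
  - under eq_fun do rewrite (lin_prod_w _ _ cdE cdP); exact: cvg_w.
  - rewrite cdP; exact: cvg_qinf.
  - rewrite cdP; exact: cvg_qinf.
have E2 : prod_inf (fun j => w x y (rho1 * q ^+ j)) * G = 1 * qpoch_inf (rho1 ^+ 2) q / 1 * G0.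
  apply: HG; last exact: oner_neq0.
  - under eq_fun do rewrite (prod_w sE PE); exact: cvg_w.
  - under eq_fun do rewrite lin_prod_P0; exact: cst1.
  - rewrite PE; exact: cvg_qinf.
  - under eq_fun do rewrite mul0r qpoch0l; exact: cst1.
rewrite GF G1 in E2.
have -> : u_term y z rho1 rho2 x = hterm q x (2 * rho1 * y) (rho1 ^+ 2) c d.
  by apply: u_termE; [exact: cdE|exact: cdP].
have SFc := (cvg_limE SF).1.
have SFl := (cvg_limE SF).2.
split; first exact: SFc.
rewrite [X in _ = _ * X]SFl.
rewrite (f_C2N_E w1 w2); congr (_ * _).
apply: (mulfI n2); rewrite E1.
have -> : F0 = qpoch_inf (rho1 ^+ 2) q / prod_inf (fun j => w x y (rho1 * q ^+ j)).
  by rewrite -[LHS](mulKf n1) E2 divr1 mulr1 mul1r mulrC.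
by field; rewrite n1 n2 n5.
Qed.

Lemma second_expansion x y z rho1 rho2 : nm rho1 < 1 -> nm rho2 < 1 ->
  nonsingular x y rho1 z rho2 q ->
  cvgn (series (v_term y z rho1 rho2 x)) /\
  f_h x q = f_C2N x y rho1 z rho2 q * limn (series (v_term y z rho1 rho2 x)).
Proof.
move=> r11 r21 ns.
have w1 j : w x y (rho1 * q ^+ j) != 0 by have [] := ns j.
have w2 j : w x z (rho2 * q ^+ j) != 0 by have [] := ns j.
have w3 j : w y z (rho1 * rho2 * q ^+ j) != 0 by have [_ _] := ns j; rewrite wC.
have [X [xX X0 XX]] := unit_pair x.
have [Y [yY Y0 [sE PE]]] := shift_pair rho1 y.
have [Z [zZ Z0 [cdE cdP]]] := shift_pair rho2 z.
move: (rho1 * Y) (rho1 * Y^-1) (rho2 * Z) (rho2 * Z^-1) sE PE cdE cdP.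
move=> a b c d sE PE cdE cdP.
have P1 : nm (rho1 ^+ 2) < 1 by rewrite nmX expr_lt1 ?nm_ge0.
have Q1 : nm (rho2 ^+ 2) < 1 by rewrite nmX expr_lt1 ?nm_ge0.
have u1 : nm (rho1 ^+ 2 * rho2 ^+ 2) < 1.
  by rewrite nmM; have := nm_ge0 (rho1 ^+ 2); have := nm_ge0 (rho2 ^+ 2); nra.
have P1' := P1; have Q1' := Q1; rewrite -PE in P1'; rewrite -cdP in Q1'.
have Hcd i := w3 i; have {}Hcd i : _ * _ != 0 := etrans (congr1 (fun t => t != 0) (lin_w y rho1 cdE cdP i)) (w3 i).
(* By [lin_w] the factors in c and in d multiply to a value of [w] that is nonzero, so neither
   vanishes. *)
have Hc i : 1 - c * (2 * rho1 * y) * q ^+ i + c ^+ 2 * rho1 ^+ 2 * (q ^+ i) ^+ 2 != 0.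
  by have := Hcd i; rewrite mulf_eq0 negb_or => /andP[].
have Hd i : 1 - d * (2 * rho1 * y) * q ^+ i + d ^+ 2 * rho1 ^+ 2 * (q ^+ i) ^+ 2 != 0.
  by have := Hcd i; rewrite mulf_eq0 negb_or => /andP[].
have H0 t i : 1 - t * 0 * q ^+ i + t ^+ 2 * 0 * (q ^+ i) ^+ 2 != 0 :> C.
  by rewrite !mulr0 !mul0r subr0 addr0 oner_neq0.
have z1 : nm (0 : C) < 1 by rewrite nm0 ltr01.
have [F [F0 [SF SF0 HF]]] := aw_limit k01 qk xX X0 XX P1 Q1' Hc Hd.
have [G [G0 [SG SG0 HG]]] := aw_limit k01 qk xX X0 XX z1 P1' (H0 a) (H0 b).
have GF : G = F0.
  have e : aterm q x 0 0 a b = aterm0 q x (2 * rho1 * y) (rho1 ^+ 2); last first.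
    by rewrite e in SG; exact: cvg_unique SG SF0.
  apply/funext => n; rewrite /aterm /aterm0 inv_norm_P0 (bsum_P0 HQ) (awpoly_P0 HQ).
  by rewrite sE PE.
have G1 : G0 = 1 by exact: cvg_unique SG0 (aterm_lim0 x).
have n1 := w_inf_neq0 w1; have n2 := w_inf_neq0 w2; have n6 := w_inf_neq0 w3.
have n3 := qinf_neq0 P1; have n4 := qinf_neq0 Q1; have n5 := qinf_neq0 u1.
have cst1 : (fun=> 1 : C) @ \oo --> (1 : C) by exact: cvg_cst.
have E1 : prod_inf (fun j => w y z (rho1 * rho2 * q ^+ j)) * qpoch_inf (rho2 ^+ 2) q
  / qpoch_inf (rho1 ^+ 2 * rho2 ^+ 2) q * F = prod_inf (fun j => w x z (rho2 * q ^+ j)) * F0.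
  apply: HF; last exact: n5.
  - under eq_fun do rewrite (prod_w cdE cdP); exact: cvg_w.
  - under eq_fun do rewrite (lin_prod_w _ _ cdE cdP); exact: cvg_w.
  - rewrite cdP; exact: cvg_qinf.
  - rewrite cdP; exact: cvg_qinf.
have E2 : 1 * qpoch_inf (rho1 ^+ 2) q / 1 * G = prod_inf (fun j => w x y (rho1 * q ^+ j)) * G0.
  apply: HG; last exact: oner_neq0.
  - under eq_fun do rewrite (prod_w sE PE); exact: cvg_w.
  - under eq_fun do rewrite lin_prod_P0; exact: cst1.
  - rewrite PE; exact: cvg_qinf.
  - under eq_fun do rewrite mul0r qpoch0l; exact: cst1.
rewrite GF G1 in E2.
have -> : v_term y z rho1 rho2 x = aterm q x (2 * rho1 * y) (rho1 ^+ 2) c d.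
  by apply: v_termE; [exact: r11|exact: r21|exact: cdE|exact: cdP].
have SFc := (cvg_limE SF).1.
have SFl := (cvg_limE SF).2.
split; first exact: SFc.
rewrite [X in _ = _ * X]SFl.
rewrite (f_C2N_E w1 w2) -mulrA.
set W1 := prod_inf (fun j => w x y _) in n1 E2 *.
set W2 := prod_inf (fun j => w x z _) in n2 E1 *.
set L := prod_inf (fun j => w y z _) in n6 E1 *.
have -> : F = W2 * (W1 / qpoch_inf (rho1 ^+ 2) q) * qpoch_inf (rho1 ^+ 2 * rho2 ^+ 2) q
   / (L * qpoch_inf (rho2 ^+ 2) q).
  have F0E : F0 = W1 / qpoch_inf (rho1 ^+ 2) q.
    by rewrite -[W1]mulr1 -E2 divr1 mul1r mulrC mulKf.
  by rewrite -F0E -E1; field; rewrite n4 n5 n6.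
by rewrite [X in _ = _ * X](_ : _ = 1) ?mulr1//; field; rewrite n1 n2 n3 n4 n5 n6.
Qed.
End Final.

Theorem theorem9 (R : realType) (y z rho1 rho2 q : cplx R)
    (hy : `|y| < 1) (hz : `|z| < 1)
    (hrho1 : `|rho1| < 1) (hrho2 : `|rho2| < 1) (hq : `|q| < 1) :
  (forall n : nat, (1 <= n)%N ->
     \sum_(k < n.+1) c n k y rho1 z rho2 q * cbar k 0 y rho1 z rho2 q = 0 /\
     \sum_(k < n.+1) cbar n k y rho1 z rho2 q * c k 0 y rho1 z rho2 q = 0)
  /\
  (forall x : cplx R, `|x| < 1 ->
     (conv_domain x y rho1 z rho2 ->
      let u := fun n : nat =>
        h n x q / qpoch q q n
        * \sum_(s < n.+1)
            qbinom n s q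
            * (rho1 ^+ (n - s) * rho2 ^+ s * qpoch (rho1 ^+ 2) q s
               / qpoch (rho1 ^+ 2 * rho2 ^+ 2) q s)
            * h (n - s) y q * p s z y (rho1 * rho2) q in
      cvgn (series u) /\
      f_C2N x y rho1 z rho2 q = f_h x q * limn (series u))
     /\
     (nonsingular x y rho1 z rho2 q ->
      let v := fun n : nat =>
        let P := rho1 ^+ 2 * rho2 ^+ 2 * q ^+ n.-1 in
        alpha n x y rho1 z rho2 q
        / (qpoch q q n * \prod_(j < n) w z y (rho1 * rho2 * q ^+ j))
        * (qpoch (rho1 ^+ 2 * rho2 ^+ 2) q (2 * n) / qpoch (rho2 ^+ 2) q n)
        * \sum_(s < n.+1)
            qbinom n s q
            * (rho2 ^+ (n - s) * rho1 ^+ s * qpoch P q s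
               / qpoch (rho1 ^+ 2) q s)
            * b s y q * g (n - s) z y (rho1 * rho2 * q ^+ n.-1) q in
      cvgn (series v) /\
      f_h x q = f_C2N x y rho1 z rho2 q * limn (series v))).
Proof.
rewrite nm_lt1 in hrho1; rewrite nm_lt1 in hrho2; rewrite nm_lt1 in hq.
(* The midpoint of |q| and 1 is positive even for q = 0, so powers of [k] may be divided by. *)
pose k := (1 + nm q) / 2.
have k01 : 0 < k < 1 by have := nm_ge0 q; rewrite /k; lra.
have qk : nm q <= k by rewrite /k; lra.
have P1 : nm (rho1 ^+ 2) < 1 by rewrite nmX expr_lt1 ?nm_ge0.
have Q1 : nm (rho2 ^+ 2) < 1 by rewrite nmX expr_lt1 ?nm_ge0.
have u1 : nm (rho1 ^+ 2 * rho2 ^+ 2) < 1.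
  by rewrite nmM; have := nm_ge0 (rho1 ^+ 2); have := nm_ge0 (rho2 ^+ 2); nra.
split=> [n n0|x _]; last first.
  split=> H.
  - exact: (first_expansion k01 qk hrho1 hrho2 H).
  - exact: (second_expansion k01 qk hrho1 hrho2 H).
have HQ := subr1qXS_neq0 k01 qk.
have Hu i := subr1MqX_neq0 k01 qk i u1; have HP i := subr1MqX_neq0 k01 qk i P1.
split; first exact: (sum_c_cbar HQ y z Hu HP n0).
exact: (sum_cbar_c HQ y z Hu HP n0).
Qed.
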